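(* Let $\rho\in(0,\infty)$. Let $X$ be a ball Banach function space on $\mathbb R^n$, and let $X'$ be its Köthe associate space. For $0<q<\infty$ and $C>0$ consider the inequality $$\left\|\Big(\sum_{j=1}^N(\mathcal M^{\mathrm{loc}}_\rho f_j)^q\Big)^{1/q}\right\|_X\le C\left\|\Big(\sum_{j=1}^N|f_j|^q\Big)^{1/q}\right\|_X .\qquad(\ast)$$ (i) The following statements are equivalent. (a) $\mathcal M^{\mathrm{loc}}_\rho:X\to X$ and $\mathcal M^{\mathrm{loc}}_\rho:X'\to X'$ are bounded. (b) There exist $q\in(1,\infty)$ and a constant $C>0$ such that $(\ast)$ holds for every $N\in\mathbb N$ and every finite family $\{f_j\}_{j=1}^N$ of measurable functions for which the right-hand side is finite ($C$ being independent of $N$ and of the family). (c) For every $q\in(1,\infty)$ there is a constant $C>0$ such that $(\ast)$ holds for every $N\in\mathbb N$ and every finite family $\{f_j\}_{j=1}^N$ of measurable functions for which the right-hand side is finite ($C$ being independent of $N$ and of the family). (ii) If $q\in(0,\infty)$ and there is a finite constant $C$ such that $(\ast)$ holds for every $N\in\mathbb N$ and every finite family $\{f_j\}_{j=1}^N$ of measurable functions, then $q>1$. More precisely, for $0<q\le1$ and every ball quasi-Banach function space $Y$ on $\mathbb R^n$, there is no finite constant $C$ such that $(\ast)$ with $X$ replaced by $Y$ holds for every $N\in\mathbb N$ and every finite family of measurable functions for which the right-hand side is finite. (iii) Fix $1<q<\infty$ and $C>0$. Suppose that $(\ast)$, with this $q$ and $C$, holds for every $N\in\mathbb N$ and every finite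 family of measurable functions for which the right-hand side is finite. Then, for every sequence $\{f_j\}_{j=1}^\infty$ of measurable functions with $\big(\sum_{j=1}^\infty|f_j|^q\big)^{1/q}\in X$, $$\left\|\Big(\sum_{j=1}^\infty(\mathcal M^{\mathrm{loc}}_\rho f_j)^q\Big)^{1/q}\right\|_X\le C\left\|\Big(\sum_{j=1}^\infty|f_j|^q\Big)^{1/q}\right\|_X .$$ Conversely, this estimate for all such sequences implies $(\ast)$ for all finite families, with the same constant $C$. (iv) The following statements are equivalent, and the constant $C$ may be chosen to be the same in (a)--(c). (a) There is $C>0$ such that $\|\mathcal M^{\mathrm{loc}}_\rho f\|_X\le C\|f\|_X$ for all $f\in X$. (b) There is $C>0$ such that, for every $N\in\mathbb N$ and every finite family $\{f_j\}_{j=1}^N$ with $\max_{1\le j\le N}|f_j|\in X$, $\ \big\|\max_{1\le j\le N}\mathcal M^{\mathrm{loc}}_\rho f_j\big\|_X\le C\big\|\max_{1\le j\le N}|f_j|\big\|_X$. (c) There is $C>0$ such that, for every sequence $\{f_j\}_{j=1}^\infty$ with $\sup_j|f_j|\in X$, $\ \big\|\sup_j\mathcal M^{\mathrm{loc}}_\rho f_j\big\|_X\le C\big\|\sup_j|f_j|\big\|_X$. These equivalent conditions need not imply that $\mathcal M^{\mathrm{loc}}_\rho$ is bounded on $X'$ (i.e. there is a ball Banach function space on $\mathbb R^n$ for which they hold while $\mathcal M^{\mathrm{loc}}_\rho$ is not bounded on its Köthe associate space).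
   Context: Functions on $\mathbb R^n$ are identified when equal a.e. (Lebesgue measure). Ball Banach function space $X$: a complete normed linear space of measurable functions on $\mathbb R^n$ such that (1) if $f\in X$ and $|g|\le|f|$ a.e. with $g$ measurable, then $g\in X$ and $\|g\|_X\le\|f\|_X$; (2) (Fatou) if $f_k\in X$, $0\le f_k\uparrow f$ a.e. and $\sup_k\|f_k\|_X<\infty$, then $f\in X$ and $\|f\|_X=\sup_k\|f_k\|_X$; (3) $\mathbf 1_B\in X$ for every ball $B$; (4) for every ball $B$ there is $C_B$ with $\int_B|f|\,dx\le C_B\|f\|_X$ for all $f\in X$. Ball quasi-Banach function space: a quasi-Banach space of measurable functions on $\mathbb R^n$ satisfying (1)--(3) (condition (4) is not required). If a (possibly extended-valued) measurable function is not in the space, its (quasi-)norm is taken to be $+\infty$. Köthe associate space: $X'=\{g \text{ measurable}:\ \|g\|_{X'}:=\sup_{\|f\|_X\le1}\int_{\mathbb R^n}|fg|\,dx<\infty\}$. Local maximal operator: for measurable $f$, $\mathcal M^{\mathrm{loc}}_\rho f(x)=\sup_{Q\ni x,\ \ell(Q)\le\rho}\frac1{|Q|}\int_Q|f|\in[0,\infty]$, the supremum being over axis-parallel cubes $Q\subset\mathbb R^n$ of side length $\ell(Q)\le\rho$ containing $x$; integrals may equal $+\infty$. An operator $T$ is bounded on $Z$ if there is $C<\infty$ with $\|Tf\|_Z\le C\|f\|_Z$ for all $f\in Z$. *)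

(* Defs.v *)
From HB Require Import structures.
From mathcomp Require Import all_boot all_order all_algebra.
From mathcomp Require Import all_classical all_reals all_analysis.

Set Implicit Arguments.
Unset Strict Implicit.
Unset Printing Implicit Defensive.

Import Order.TTheory GRing.Theory Num.Theory.
Import numFieldNormedType.Exports.

Local Open Scope classical_set_scope.
Local Open Scope ring_scope.

(* R^n is [n.-tuple R] with the library's product of Borel sigma-algebras.    *)
(* Functions only matter up to a.e. equality, and every Lebesgue measurable   *)
(* function is a.e. equal to a Borel one, so measurability is taken to be     *)
(* Borel measurability. Scalars are real.                                     *)

Section lebesgue_step.
Context {R : realType} (n : nat).
Variable m : {sigma_finite_measure set (n.-tuple R) -> \bar R}.

Definition tcons (p : measurableTypeR R * n.-tuple R) : n.+1.-tuple R :=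
  [tuple of (p.1 : R) :: p.2].

Lemma measurable_tcons : measurable_fun [set: _] tcons.
Proof.
by apply: measurable_cons; [exact: measurable_fst|exact: measurable_snd].
Qed.

Definition leb_step : set (n.+1.-tuple R) -> \bar R :=
  pushforward (lebesgue_measure \x m)%E tcons.

Let leb_step0 : leb_step set0 = 0%E.
Proof. by rewrite /leb_step /pushforward preimage_set0 measure0. Qed.

Let leb_step_ge0 A : (0 <= leb_step A)%E.
Proof. by rewrite /leb_step /pushforward; exact: measure_ge0. Qed.

Let leb_step_sigma_additive : semi_sigma_additive leb_step.
Proof.
rewrite /leb_step; apply: measure_semi_sigma_additive.
exact: measurable_tcons.
Qed.

HB.instance Definition _ := isMeasure.Build _ _ _ leb_step
  leb_step0 leb_step_ge0 leb_step_sigma_additive.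

Let leb_step_sigma_finite : sigma_finite setT leb_step.
Proof.
have /sigma_finiteP[F [TF ndF Foo]] := sigma_finiteT (@lebesgue_measure R).
have /sigma_finiteP[H [TH ndH Hoo]] := sigma_finiteT m.
pose G (t : n.+1.-tuple R) : measurableTypeR R * n.-tuple R :=
  (thead t, [tuple of behead t]).
have GK : cancel tcons G.
  by move=> [x t]; congr pair => //; apply/val_inj.
have KG : cancel G tcons.
  by move=> t; rewrite /tcons /G /= [RHS]tuple_eta; apply/val_inj.
have mG : measurable_fun setT G.
  apply: measurable_fun_pair => /=; last exact: measurable_behead.
  exact: (measurable_tnth ord0).
exists (fun k => G @^-1` (F k `*` H k)).
  rewrite -preimage_bigcup; apply/esym/seteqP; split => // t _ /=.
  have [i _ Fi] : (\bigcup_i F i) (G t).1 by rewrite -TF.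
  have [j _ Hj] : (\bigcup_j H j) (G t).2 by rewrite -TH.
  exists (maxn i j) => //; split.
    by move: Fi; exact/subsetPset/ndF/leq_maxl.
  by move: Hj; exact/subsetPset/ndH/leq_maxr.
move=> k; have [mF Fk] := Foo k; have [mH Hk] := Hoo k.
have mFH : measurable (F k `*` H k) by exact: measurableX.
split; first by rewrite -[X in measurable X]setTI; exact: mG.
rewrite /leb_step /pushforward (_ : _ @^-1` _ = F k `*` H k); last first.
  by apply/funext => p; exact: (congr1 (F k `*` H k) (GK p)).
by rewrite product_measure1E// lte_mul_pinfty// ge0_fin_numE.
Qed.

HB.instance Definition _ :=
  Measure_isSigmaFinite.Build _ _ _ leb_step leb_step_sigma_finite.

End lebesgue_step.

Fixpoint lebesgue_Rn (R : realType) (n : nat) :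
    {sigma_finite_measure set (n.-tuple R) -> \bar R} :=
  if n is k.+1 then leb_step (lebesgue_Rn R k) else dirac [tuple].

Lemma lebesgue_Rn_box (R : realType) (n : nat) (A : 'I_n -> set R) :
  (forall i, measurable (A i)) ->
  lebesgue_Rn R n [set x | forall i, A i (tnth x i)] =
  (\prod_(i < n) lebesgue_measure (A i))%E.
Proof.
elim: n A => [|n IH] A mA.
  rewrite big_ord0 /= diracE mem_set//; by case.
rewrite big_ord_recl -IH//= /leb_step /pushforward.
set B := [set x : n.-tuple R | _].
have mB : measurable B.
  have -> : B = \bigcap_(i in [set: 'I_n])
      (fun x => tnth x i) @^-1` A (lift ord0 i).
    by apply/seteqP; split=> x Bx i; [move=> _; exact: (Bx i)|exact: (Bx i I)].
  apply: fin_bigcap_measurable => // i _.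
  rewrite -[X in measurable X]setTI; exact: measurable_tnth.
rewrite -product_measure1E//; last exact: mA.
congr (product_measure1 _ _ _).
apply/seteqP; split => -[x t] /=.
  move=> h; split; first exact: (h ord0).
  by move=> i; have := h (lift ord0 i); rewrite tnthS.
move=> [Ax Bt] i; have [->|i0] := eqVneq i ord0; first exact: Ax.
have [j ->] : exists j, i = lift ord0 j.
  by case: (unliftP ord0 i) => [j ->|ij]; [exists j|rewrite ij eqxx in i0].
by rewrite tnthS; exact: Bt.
Qed.

Section function_spaces.
Context {R : realType} {n : nat}.
Local Notation Rn := (n.-tuple R).
Local Notation mu := (lebesgue_Rn R n).

(* A space of functions on R^n is a set of representatives with a norm on it; *)
(* the value of the norm outside the set is irrelevant. It is a predicate on  *)
(* everywhere finite functions, whereas [mem_fspace] and [enorm] below apply  *)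
(* to extended-valued ones, through a.e. equal representatives.               *)
Record fspace := FSpace {
  fcar :> (Rn -> R) -> Prop;
  fnorm : (Rn -> R) -> R }.

Definition mem_fspace (X : fspace) (F : Rn -> \bar R) : Prop :=
  exists2 f, X f & {ae mu, forall x, F x = (f x)%:E}.

(* The set below is empty when F is not in X, in which case its infimum is    *)
(* +oo; otherwise it is a singleton as soon as the norm is a.e.-invariant.    *)
Definition enorm (X : fspace) (F : Rn -> \bar R) : \bar R :=
  ereal_inf [set (fnorm X f)%:E |
    f in [set f | X f /\ {ae mu, forall x, F x = (f x)%:E}]].

Record quasi_normed (K : R) (X : fspace) : Prop := QuasiNormed {
  qn_measurable : forall f, X f -> measurable_fun [set: Rn] f ;
  qn_mem0 : X (cst 0) ;
  qn_memD : forall f g, X f -> X g -> X (f \+ g) ;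
  qn_memZ : forall (c : R) f, X f -> X (fun x => c * f x) ;
  qn_norm_ge0 : forall f, X f -> 0 <= fnorm X f ;
  qn_norm_eq0 : forall f, X f ->
    fnorm X f = 0 <-> {ae mu, forall x, f x = 0} ;
  qn_normZ : forall (c : R) f, X f ->
    fnorm X (fun x => c * f x) = `|c| * fnorm X f ;
  qn_normD : forall f g, X f -> X g ->
    fnorm X (f \+ g) <= K * (fnorm X f + fnorm X g) }.

Definition complete_fspace (X : fspace) : Prop :=
  forall u : nat -> Rn -> R, (forall k, X (u k)) ->
  (forall e : R, 0 < e -> exists N, forall k l, (N <= k)%N -> (N <= l)%N ->
     fnorm X (u k \- u l) < e) ->
  exists2 f, X f & fnorm X (u k \- f) @[k --> \oo] --> (0 : R).

Definition Rn_ball (c : Rn) (r : R) : set Rn :=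
  [set x | \sum_(i < n) (tnth x i - tnth c i) ^+ 2 < r ^+ 2].

Definition ideal_property (X : fspace) : Prop :=
  forall f g : Rn -> R, X f -> measurable_fun [set: Rn] g ->
  {ae mu, forall x, `|g x| <= `|f x|} -> X g /\ fnorm X g <= fnorm X f.

(* The limit F may take the value +oo a priori.                               *)
Definition fatou_property (X : fspace) : Prop :=
  forall (f : nat -> Rn -> R) (F : Rn -> \bar R), (forall k, X (f k)) ->
  {ae mu, forall x, [/\ forall k, 0 <= f k x,
     forall k, f k x <= f k.+1 x & (f k x)%:E @[k --> \oo] --> F x]} ->
  (ereal_sup (range (fun k => (fnorm X (f k))%:E)) < +oo)%E ->
  mem_fspace X F /\
  enorm X F = ereal_sup (range (fun k => (fnorm X (f k))%:E)).

Definition contains_balls (X : fspace) : Prop :=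
  forall (c : Rn) (r : R), 0 < r -> X \1_(Rn_ball c r).

Definition integrable_on_balls (X : fspace) : Prop :=
  forall (c : Rn) (r : R), 0 < r -> exists C : R, forall f, X f ->
  (\int[mu]_(x in Rn_ball c r) `|f x|%:E <= (C * fnorm X f)%:E)%E.

Definition ball_quasi_Banach (X : fspace) : Prop :=
  [/\ exists K, quasi_normed K X, complete_fspace X,
      ideal_property X, fatou_property X & contains_balls X].

Definition ball_Banach (X : fspace) : Prop :=
  [/\ quasi_normed 1 X, complete_fspace X, ideal_property X,
      fatou_property X & contains_balls X /\ integrable_on_balls X].

Definition kothe_norm (X : fspace) (g : Rn -> R) : \bar R :=
  ereal_sup [set (\int[mu]_x `|f x * g x|%:E)%E |
    f in [set f | X f /\ fnorm X f <= 1]].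

Definition kothe (X : fspace) : fspace := FSpace
  [set g | measurable_fun [set: Rn] g /\ (kothe_norm X g < +oo)%E]
  (fun g => fine (kothe_norm X g)).

(* Open cubes; closed ones give an a.e. equal maximal function.               *)
Definition cube (a : Rn) (l : R) : set Rn :=
  [set x | forall i, tnth a i < tnth x i < tnth a i + l].

Definition local_maximal (rho : R) (f : Rn -> R) (x : Rn) : \bar R :=
  ereal_sup [set z | exists (a : Rn) (l : R), [/\ 0 < l <= rho, cube a l x &
    z = ((mu (cube a l))^-1 * \int[mu]_(y in cube a l) `|f y|%:E)%E]].

Definition bounded_on (T : (Rn -> R) -> Rn -> \bar R) (Z : fspace) : Prop :=
  exists C : R, forall f, Z f ->
  (enorm Z (T f) <= C%:E * enorm Z (EFin \o f))%E.

Definition lq_fin (q : R) (N : nat) (F : 'I_N -> Rn -> \bar R) (x : Rn) : \bar R :=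
  ((\sum_(j < N) F j x `^ q) `^ q^-1)%E.

Definition lq_seq (q : R) (F : nat -> Rn -> \bar R) (x : Rn) : \bar R :=
  ((\sum_(0 <= j <oo) F j x `^ q) `^ q^-1)%E.

(* Only used for nonnegative F, so that 0 is a neutral element.               *)
Definition max_fin (N : nat) (F : 'I_N -> Rn -> \bar R) (x : Rn) : \bar R :=
  \big[maxe/0%E]_(j < N) F j x.

Definition sup_seq (F : nat -> Rn -> \bar R) (x : Rn) : \bar R :=
  ereal_sup (range (F ^~ x)).

Definition absE (f : Rn -> R) (x : Rn) : \bar R := `|f x|%:E.

Definition vv_ineq (X : fspace) (rho q C : R) (N : nat)
    (f : 'I_N -> Rn -> R) : Prop :=
  (enorm X (lq_fin q (fun j => local_maximal rho (f j))) <=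
   C%:E * enorm X (lq_fin q (fun j => absE (f j))))%E.

Definition vv_finite (X : fspace) (rho q C : R) : Prop :=
  forall (N : nat) (f : 'I_N -> Rn -> R),
  (forall j, measurable_fun [set: Rn] (f j)) ->
  (enorm X (lq_fin q (fun j => absE (f j))) < +oo)%E ->
  vv_ineq X rho q C f.

Definition vv_sequence (X : fspace) (rho q C : R) : Prop :=
  forall f : nat -> Rn -> R,
  (forall j, measurable_fun [set: Rn] (f j)) ->
  mem_fspace X (lq_seq q (fun j => absE (f j))) ->
  (enorm X (lq_seq q (fun j => local_maximal rho (f j))) <=
   C%:E * enorm X (lq_seq q (fun j => absE (f j))))%E.

Definition scalar_bound (X : fspace) (rho C : R) : Prop :=
  forall f, X f ->
  (enorm X (local_maximal rho f) <= C%:E * enorm X (EFin \o f))%E.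

Definition max_bound (X : fspace) (rho C : R) : Prop :=
  forall (N : nat) (f : 'I_N -> Rn -> R),
  (forall j, measurable_fun [set: Rn] (f j)) ->
  mem_fspace X (max_fin (fun j => absE (f j))) ->
  (enorm X (max_fin (fun j => local_maximal rho (f j))) <=
   C%:E * enorm X (max_fin (fun j => absE (f j))))%E.

Definition sup_bound (X : fspace) (rho C : R) : Prop :=
  forall f : nat -> Rn -> R,
  (forall j, measurable_fun [set: Rn] (f j)) ->
  mem_fspace X (sup_seq (fun j => absE (f j))) ->
  (enorm X (sup_seq (fun j => local_maximal rho (f j))) <=
   C%:E * enorm X (sup_seq (fun j => absE (f j))))%E.

End function_spaces.
Arguments fspace : clear implicits.

(* Main.v *)
(* (i) The cubes of side at most rho are captured, up to a factor 6^n, by 2^n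
   dyadic grids translated by thirds, and averages over the cells of these grids
   are dominated by the local maximal operator at scale 8 rho, which inherits the
   bounds of the one at scale rho. By Fatou's property everything then reduces,
   uniformly, to the maximal operator T along nested partitions of a finite set
   carrying a lattice seminorm N. If T is bounded for N and for the dual of N, a
   function norming the vector-valued expression and the expression itself are
   majorised by almost T-invariant weights (Rubio de Francia), and a weighted L^q
   bound gives the vector-valued inequality. Conversely, the vector-valued
   inequality applied to averages over principal classes bounds T for the dual
   of N.
   (ii) The local maximal functions of adjacent thin slabs have the harmonic
   series as their sum, while their indicators add up to 1; the same slabs show
   that the operator is unbounded on L^1, the associate of L^infty.
   (iii), (iv) Fatou's property, and M f_j <= M (sup_i |f_i|). *)
Require Import Defs.
From mathcomp Require Import all_boot all_order all_algebra.
From mathcomp Require Import all_classical all_reals all_analysis.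
From mathcomp Require Import measurable_realfun ring lra zify.

Set Implicit Arguments.
Unset Strict Implicit.
Unset Printing Implicit Defensive.

Import Order.TTheory GRing.Theory Num.Theory.
Import numFieldNormedType.Exports.

Local Open Scope classical_set_scope.
Local Open Scope ring_scope.

(** * Powers and averages over nested finite partitions *)

(** Finite sets replace a duality theory for [X]: the second associate never enters, since over a
    finite grid a norming functional comes from an elementary Hahn-Banach argument and the Rubio de
    Francia series can be cut off. The price is that every constant has to be independent of the
    mesh, the extent and the number of functions, because the grids are refined and enlarged
    afterwards. A quantity such as the dual bound of the constant function, finite on each grid but
    without control, may only be paid for by an arbitrarily small [eps]. The scale 8 rho has two
    sources. The translation by thirds needs coarsest cells of side above 3 rho, and 4 rho is taken;
    and a half-open cell is compared with an open cube of twice its side. Three doublings of the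
    scale provide this. *)

Lemma eq_lew {disp} {T : porderType disp} (x y : T) : x = y -> (x <= y)%O.
Proof. by move=> ->. Qed.

Section powR_inequalities.
Context {R : realType}.
Implicit Types (x y p : R).

Lemma le_powR p x y : 0 <= p -> 0 <= x -> x <= y -> x `^ p <= y `^ p.
Proof.
by move=> p0 x0 xy; apply: ge0_ler_powR => //; rewrite nnegrE// (le_trans x0).
Qed.

Lemma powRVK p x : 0 < p -> 0 <= x -> (x `^ p^-1) `^ p = x.
Proof. by move=> p0 x0; rewrite -powRrM mulVf ?gt_eqF// powRr1. Qed.

Lemma powRKV p x : 0 < p -> 0 <= x -> (x `^ p) `^ p^-1 = x.
Proof. by move=> p0 x0; rewrite -powRrM divff ?gt_eqF// powRr1. Qed.

Lemma mulr_powRB1l p x : 0 <= x -> 0 < p -> x `^ (p - 1) * x = x `^ p.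
Proof. by move=> x0 p0; rewrite mulrC mulr_powRB1. Qed.

(** Young's inequality for x and y^(p-1) with the exponents p and p/(p-1), multiplied by p. *)
Lemma young_powRB1 p x y : 1 < p -> 0 <= x -> 0 <= y ->
  p * (x * y `^ (p - 1)) <= x `^ p + (p - 1) * y `^ p.
Proof.
move=> p1 x0 y0; have p0 : 0 < p by lra.
have q0 : 0 < p - 1 by lra.
have := @conjugate_powR _ x (y `^ (p - 1)) p (p / (p - 1)) x0 (powR_ge0 _ _) p0.
rewrite divr_gt0// => /(_ isT).
have -> : p^-1 + (p / (p - 1))^-1 = 1 by field; rewrite !gt_eqF.
move=> /(_ erefl); rewrite -powRrM.
have -> : (p - 1) * (p / (p - 1)) = p by field; rewrite gt_eqF.
move=> h; have := ler_wpM2l (ltW p0) h.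
suff -> : p * (x `^ p / p + y `^ p / (p / (p - 1))) = x `^ p + (p - 1) * y `^ p by [].
by field; rewrite !gt_eqF.
Qed.

(** The increment of the p-th power is measured by that of the (p-1)-th power. In [doob] the latter
    is constant on the classes of a partition, so that an average in front of it can be removed. *)
Lemma powR_sub_le_conj p x y : 1 < p -> 0 <= x -> 0 <= y ->
  x `^ p - y `^ p <= p / (p - 1) * (x * (x `^ (p - 1) - y `^ (p - 1))).
Proof.
move=> p1 x0 y0; have p0 : 0 < p by lra.
have q0 : 0 < p - 1 by lra.
rewrite mulrAC ler_pdivlMr// [x * _]mulrBr mulr_powRB1//.
have := young_powRB1 p1 x0 y0; nra.
Qed.

Lemma powR_sub_le p x y : 1 < p -> 0 <= x -> 0 <= y ->
  x `^ p - y `^ p <= p * (x `^ (p - 1) * (x - y)).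
Proof.
move=> p1 x0 y0; have p0 : 0 < p by lra.
have := young_powRB1 p1 y0 x0.
rewrite [x `^ _ * _]mulrBr mulr_powRB1l// [_ * y]mulrC; nra.
Qed.

(** Either a x <= eta y and the first term suffices, or y < (a / eta) x and the second one does. *)
Lemma powR_absorb p a eta x y : 1 < p -> 0 < a -> 0 < eta -> 0 <= x -> 0 <= y ->
  a * (x * y `^ (p - 1)) <= eta * y `^ p + a * (a / eta) `^ (p - 1) * x `^ p.
Proof.
move=> p1 a0 e0 x0 y0; have p0 : 0 < p by lra.
have c0 : 0 <= a * (a / eta) `^ (p - 1) * x `^ p.
  by rewrite !mulr_ge0 ?powR_ge0// ltW.
have d0 : 0 <= eta * y `^ p by rewrite mulr_ge0 ?powR_ge0// ltW.
have [h|h] := leP (a * x) (eta * y).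
  rewrite mulrA -(mulr_powRB1 y0 p0) [leRHS]addrC -[leLHS]add0r; apply: lerD => //.
  by rewrite mulrA ler_wpM2r// powR_ge0.
rewrite -[leLHS]add0r; apply: lerD => //.
rewrite -[leRHS]mulrA ler_pM2l// -(mulr_powRB1 x0 p0) mulrCA ler_wpM2l//.
rewrite -powRM ?divr_ge0 ?(ltW a0) ?(ltW e0)//; apply: le_powR => //; first by lra.
by rewrite mulrAC ler_pdivlMr// mulrC ltW.
Qed.

End powR_inequalities.

Section class_average.
Context {R : realType} {Omega : finType} (e : nat -> rel Omega).
Hypothesis eE : forall k, equivalence_rel (e k).
Hypothesis eS : forall k, subrel (e k.+1) (e k).
Implicit Types (a b f D : Omega -> R) (k : nat).

Definition class_const k D := forall w w', e k w w' -> D w = D w'.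

(** Conditional expectation given the partition [e k], for the counting measure on [Omega]; by [eS]
    the partitions become finer as [k] grows. *)
Definition class_avg k a w : R :=
  (\sum_(w' | e k w w') a w') / (\sum_(w' | e k w w') 1).

Lemma e_refl k : reflexive (e k).
Proof. by move=> w; have [] := eE k w w w. Qed.

Lemma e_sym k : symmetric (e k).
Proof.
move=> w w'; apply/idP/idP => h.
  by have [_ /(_ h) <-] := eE k w w' w; exact: e_refl.
by have [_ /(_ h) <-] := eE k w' w w'; exact: e_refl.
Qed.

Lemma e_class k w w' : e k w w' -> e k w =1 e k w'.
Proof. by move=> h v; have [_ /(_ h)] := eE k w w' v. Qed.

Lemma e_le i k : (i <= k)%N -> subrel (e k) (e i).
Proof.
move=> /subnK <-; elim: (k - i)%N => // d IH w w' /eS; exact: IH.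
Qed.

Lemma class_size_gt0 k w : 0 < \sum_(w' | e k w w') 1 :> R.
Proof.
rewrite (bigD1 w) ?e_refl//= ltr_wpDr// sumr_ge0// => *; exact: ler01.
Qed.

Lemma class_avg_const k a : class_const k (class_avg k a).
Proof.
move=> w w' h; rewrite /class_avg.
by rewrite (eq_bigl _ _ (e_class h)) [X in _ / X](eq_bigl _ _ (e_class h)).
Qed.

Lemma class_avg_sum k a w :
  \sum_(w' | e k w w') class_avg k a w' = \sum_(w' | e k w w') a w'.
Proof.
transitivity (\sum_(w' | e k w w') class_avg k a w * 1).
  by apply: eq_bigr => w' h; rewrite mulr1 (class_avg_const _ h).
by rewrite -mulr_sumr mulfVK// gt_eqF// class_size_gt0.
Qed.

Lemma class_avgMr k a D : class_const k D ->
  class_avg k (fun w => a w * D w) =1 (fun w => class_avg k a w * D w).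
Proof.
move=> DD w; rewrite /class_avg mulrAC; congr (_ / _); rewrite mulr_suml.
by apply: eq_bigr => w' /DD ->.
Qed.

Lemma le_class_avg_in k a b w : (forall w', e k w w' -> a w' <= b w') ->
  class_avg k a w <= class_avg k b w.
Proof.
by move=> ab; rewrite ler_pM2r ?invr_gt0 ?class_size_gt0// ler_sum.
Qed.

Lemma le_class_avg k a b : (forall w, a w <= b w) ->
  forall w, class_avg k a w <= class_avg k b w.
Proof. by move=> ab w; exact: le_class_avg_in. Qed.

Lemma class_avg_ge0 k a : (forall w, 0 <= a w) ->
  forall w, 0 <= class_avg k a w.
Proof.
by move=> a0 w; rewrite divr_ge0// ?sumr_ge0// ltW// class_size_gt0.
Qed.

Lemma class_avg_gt0 k a : (forall w, 0 < a w) ->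
  forall w, 0 < class_avg k a w.
Proof.
move=> a0 w; rewrite divr_gt0// ?class_size_gt0//.
rewrite (bigD1 w) ?e_refl//= ltr_wpDr// sumr_ge0// => *; exact: ltW.
Qed.

Lemma class_avgD k a b w :
  class_avg k (fun w => a w + b w) w = class_avg k a w + class_avg k b w.
Proof. by rewrite /class_avg big_split/= mulrDl. Qed.

Lemma class_avgZ k c a w : class_avg k (fun w => c * a w) w = c * class_avg k a w.
Proof. by rewrite /class_avg -mulr_sumr mulrA. Qed.

Lemma class_avg_cst k c w : class_avg k (fun=> c) w = c.
Proof.
rewrite /class_avg -[X in X / _](_ : c * \sum_(w' | e k w w') 1 = _).
  by rewrite mulfK// gt_eqF// class_size_gt0.
by rewrite mulr_sumr; apply: eq_bigr => *; rewrite mulr1.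
Qed.

Lemma class_avg_ge k a c w : (forall w', e k w w' -> c <= a w') -> c <= class_avg k a w.
Proof.
move=> ac; rewrite ler_pdivlMr ?class_size_gt0// mulr_sumr ler_sum// => w' h.
by rewrite mulr1 ac.
Qed.

(** The averaging kernel is symmetric: equivalent points lie in one class, hence divide by the same
    cardinality. *)
Lemma class_avg_selfadj k a b :
  \sum_w class_avg k a w * b w = \sum_w a w * class_avg k b w.
Proof.
rewrite /class_avg.
under eq_bigr do rewrite mulrAC mulr_suml mulr_suml big_mkcond /=.
rewrite exchange_big /=; apply: eq_bigr => w _.
rewrite mulrA mulr_sumr mulr_suml [RHS]big_mkcond/=.
apply: eq_bigr => w' _; rewrite e_sym; case: ifPn => // h.
by congr (_ * _ / _); apply: eq_bigl => v; rewrite (e_class h).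
Qed.

Section weighted.
Variable s : Omega -> R.
Hypothesis s0 : forall w, 0 < s w.

(** Conditional expectation for the measure of density [s]. *)
Definition wavg k f w : R := class_avg k (fun w => f w * s w) w / class_avg k s w.

Lemma wavg_const k f : class_const k (wavg k f).
Proof.
move=> w w' h; rewrite /wavg.
by rewrite (class_avg_const _ h) [X in _ / X](class_avg_const _ h).
Qed.

Lemma wavg_ge0 k f : (forall w, 0 <= f w) -> forall w, 0 <= wavg k f w.
Proof.
move=> f0 w; rewrite divr_ge0// class_avg_ge0// => v; last exact: ltW.
by rewrite mulr_ge0// ltW.
Qed.

Lemma wavg_selfadj k f D : class_const k D ->
  \sum_w wavg k f w * D w * s w = \sum_w f w * D w * s w.
Proof.
move=> DD.
transitivity (\sum_w class_avg k (fun w => f w * s w) w * (s w * (D w / class_avg k s w))).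
  by apply: eq_bigr => w _; rewrite /wavg; ring.
rewrite class_avg_selfadj; apply: eq_bigr => w _.
rewrite class_avgMr; last first.
  by move=> v v' h; rewrite (DD _ _ h) (class_avg_const _ h).
by field; rewrite gt_eqF// class_avg_gt0.
Qed.

(** Only the indices below [k] count, so the levels 0 to K require [K.+1]; the start at 0 keeps the
    value nonnegative for every [x]. *)
Fixpoint run_max (x : nat -> Omega -> R) k w : R :=
  if k is k'.+1 then Num.max (run_max x k' w) (x k' w) else 0.

Lemma run_max_ge0 x k w : 0 <= run_max x k w.
Proof. by elim: k => //= k IH; rewrite le_max IH. Qed.

Lemma le_run_max x i k w : (i < k)%N -> x i w <= run_max x k w.
Proof.
elim: k => // k IH; rewrite ltnS leq_eqVlt => /predU1P[->|/IH h] /=.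
  by rewrite le_max lexx orbT.
by rewrite le_max h.
Qed.

Lemma run_max_le x k w c : 0 <= c -> (forall i, (i < k)%N -> x i w <= c) ->
  run_max x k w <= c.
Proof.
move=> c0; elim: k => //= k IH h; rewrite ge_max IH ?h// => i ik.
by apply: h; exact: ltnW.
Qed.

Lemma run_max_const x k : (forall i, class_const i (x i)) ->
  class_const k (run_max x k.+1).
Proof.
move=> xc; elim: k => [|k IH] w w' h /=; first by rewrite (xc 0%N _ _ h).
by rewrite (xc k.+1 _ _ h); congr Num.max; have := IH _ _ (eS h).
Qed.

(** The constant left by [powR_absorb] for a = p/(p-1) and eta = 1/2, doubled because half of the
    left-hand side is absorbed. *)
Definition doob_const (p : R) : R :=
  2 * (p / (p - 1) * (p / (p - 1) / 2^-1) `^ (p - 1)).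

Lemma doob_const_ge0 p : 1 < p -> 0 <= doob_const p.
Proof.
by move=> p1; rewrite !mulr_ge0 ?powR_ge0// ?invr_ge0; lra.
Qed.

(** Doob's inequality by telescoping. Where the running maximum m increases at step k, its new value
    is the k-th average of [f], so the increment of m^p is at most p/(p-1) times this average times
    the increment of m^(p-1). The latter is constant on the classes of [e k], so the average may be
    replaced by [f], and the resulting sum of f m^(p-1) is absorbed. *)
Lemma doob p f K : 1 < p -> (forall w, 0 <= f w) ->
  \sum_w run_max (wavg ^~ f) K w `^ p * s w <= doob_const p * \sum_w f w `^ p * s w.
Proof.
move=> p1 f0; set m := run_max _.
have p0 : 0 < p by lra.
have p10 : p != 0 by rewrite gt_eqF.
have q0 : p - 1 != 0 by rewrite gt_eqF; lra.
have m0 k w : 0 <= m k w by exact: run_max_ge0.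
have key k : \sum_w m k w `^ p * s w <=
    p / (p - 1) * \sum_w f w * m k w `^ (p - 1) * s w.
  elim: k => [|k IH].
    rewrite !big1 ?mulr0// => w _ /=; rewrite powR0 ?mulr0 ?mul0r//.
  have step w : m k.+1 w `^ p * s w <= m k w `^ p * s w +
     p / (p - 1) * (wavg k f w * (m k.+1 w `^ (p - 1) - m k w `^ (p - 1)) * s w).
    rewrite [_ / _ * _]mulrA -mulrDl ler_pM2r// -lerBlDl.
    apply: le_trans (powR_sub_le_conj p1 (m0 _ _) (m0 _ _)) _.
    rewrite ler_pM2l ?divr_gt0//; last by lra.
    rewrite /m /=; set z := run_max _ k w; case: (leP z (wavg k f w)) => // _.
    by rewrite subrr !mulr0.
  apply: le_trans (ler_sum _ (fun w _ => step w)) _.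
  rewrite big_split/= -mulr_sumr wavg_selfadj; last first.
    move=> w w' h; congr (_ `^ _ - _ `^ _).
      exact: (run_max_const (fun i => @wavg_const i f) h).
    case: k {IH step} h => // k /eS h.
    exact: (run_max_const (fun i => @wavg_const i f) h).
  apply: le_trans (lerD IH (lexx _)) _.
  rewrite -mulrDr -big_split/=; apply: eq_lew; congr (_ * _).
  by apply: eq_bigr => w _; ring.
have {key} : \sum_w m K w `^ p * s w <= 2^-1 * (\sum_w m K w `^ p * s w) +
    (doob_const p / 2) * \sum_w f w `^ p * s w.
  apply: le_trans (key K) _; rewrite !mulr_sumr -big_split/=; apply: ler_sum => w _.
  rewrite !mulrA -mulrDl ler_pM2r// -mulrA.
  apply: le_trans (powR_absorb (eta := 2^-1) p1 _ _ (f0 w) (m0 _ w)) _.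
  - by rewrite divr_gt0//; lra.
  - by rewrite invr_gt0.
  by rewrite /doob_const [2 * _]mulrC mulfK.
by move=> h; lra.
Qed.

End weighted.
End class_average.

(** * Weights and the martingale maximal operator *)

Section martingale_maximal.
Context {R : realType} {Omega : finType} (e : nat -> rel Omega).
Hypothesis eE : forall k, equivalence_rel (e k).
Hypothesis eS : forall k, subrel (e k.+1) (e k).
Variable K : nat.
Implicit Types (a b f : Omega -> R) (k : nat).

Definition mart_max a : Omega -> R := run_max (class_avg e ^~ a) K.

Lemma mart_max_ge0 a w : 0 <= mart_max a w.
Proof. exact: run_max_ge0. Qed.

Lemma le_mart_max a b : (forall w, a w <= b w) -> forall w, mart_max a w <= mart_max b w.
Proof.
move=> ab w; apply: run_max_le; first exact: run_max_ge0.
move=> i iK; apply: le_trans (le_class_avg eE i ab w) _.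
exact: (le_run_max (class_avg e ^~ b)).
Qed.

Lemma mart_maxD_cst a c w : (forall w, 0 <= a w) -> 0 <= c ->
  mart_max (fun w => a w + c) w <= mart_max a w + c.
Proof.
move=> a0 c0; apply: run_max_le; first by rewrite addr_ge0// mart_max_ge0.
move=> i iK; rewrite (class_avgD _ _ a (fun=> c)) class_avg_cst// lerD2r.
exact: (le_run_max (class_avg e ^~ a)).
Qed.

(* The iteration [U 0 = G], [U m.+1 = G + T (U m) / 2C] is the partial sum of
   the Rubio de Francia series; on a finite set it is stationary up to a
   constant [eta], so no infinite sum is needed. *)
Lemma rubio_de_francia (S : (Omega -> R) -> R -> Prop) (C B1 : R) : 1 <= C ->
  (forall g B B', B <= B' -> S g B -> S g B') ->
  (forall g g' B B', S g B -> S g' B' -> S (fun w => g w + g' w) (B + B')) ->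
  (forall c g B, 0 <= c -> S g B -> S (fun w => c * g w) (c * B)) ->
  (forall g B, (forall w, 0 <= g w) -> 0 <= B -> S g B -> S (mart_max g) (C * B)) ->
  0 <= B1 -> S (fun=> 1) B1 ->
  forall G B eps, (forall w, 0 <= G w) -> 0 <= B -> S G B -> 0 < eps ->
  exists u, [/\ forall w, G w <= u w, forall w, 0 < u w,
    forall k w, (k < K)%N -> class_avg e k u w <= 3 * C * u w &
    S u (2 * B + eps)].
Proof.
move=> C1 Sle SD SZ ST B10 S1 G B eps G0 B0 SG eps0.
pose U := fix U m : Omega -> R :=
  if m is m'.+1 then fun w => G w + (2 * C)^-1 * mart_max (U m') w else G.
have C0 : 0 <= (2 * C)^-1 by rewrite invr_ge0; lra.
have C2 : (2 * C)^-1 <= 2^-1 by rewrite lef_pV2 ?posrE; lra.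
have UG m w : G w <= U m w.
  by case: m => //= m; rewrite lerDl mulr_ge0// mart_max_ge0.
have U0 m w : 0 <= U m w by exact: le_trans (UG m w).
have SU m : S (U m) (2 * B).
  elim: m => [|m IH]; first by apply: Sle SG; lra.
  have := SD _ _ _ _ SG (SZ _ _ _ C0 (ST _ _ (U0 m) _ IH)).
  have -> : B + (2 * C)^-1 * (C * (2 * B)) = 2 * B.
    by field; rewrite gt_eqF//; lra.
  by apply; lra.
(* [D] bounds the first increment of [U] at every point. Each further step halves the bound, because
   adding a constant to the argument of [mart_max] adds at most that constant, and (2C)^-1 <=
   1/2. *)
pose D := \sum_w (2 * C)^-1 * mart_max G w.
have D0 : 0 <= D by rewrite sumr_ge0// => w _; rewrite mulr_ge0 ?mart_max_ge0.
have UD m w : U m.+1 w <= U m w + D / 2 ^+ m.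
  elim: m w => [|m IH] w.
    rewrite expr0 divr1 /= lerD2l /D (bigD1 w)//= lerDl sumr_ge0// => v _.
    by rewrite mulr_ge0 ?mart_max_ge0.
  have -> : U m.+2 w = G w + (2 * C)^-1 * mart_max (U m.+1) w by [].
  have -> : U m.+1 w = G w + (2 * C)^-1 * mart_max (U m) w by [].
  rewrite -addrA lerD2l.
  have h0 : 0 <= D / 2 ^+ m by rewrite divr_ge0// exprn_ge0.
  have h : mart_max (U m.+1) w <= mart_max (U m) w + D / 2 ^+ m.
    apply: le_trans (le_mart_max IH w) _; exact: mart_maxD_cst.
  apply: le_trans (ler_wpM2l C0 h) _; rewrite mulrDr lerD2l.
  apply: le_trans (ler_wpM2r h0 C2) _; rewrite exprS invfM.
  by rewrite le_eqVlt mulrCA eqxx.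
(* Dividing by [B1 + 1] makes eta B1 <= eps; this is the only place where the bound of the constant
   function enters. *)
pose eta := eps / (B1 + 1).
have eta0 : 0 < eta by rewrite divr_gt0//; lra.
have [M hM] : exists M, D / 2 ^+ M <= eta.
  exists (Num.truncn (D / eta)).+1; rewrite ler_pdivrMr ?exprn_gt0// mulrC.
  rewrite -ler_pdivrMr//; apply: ltW; apply: lt_le_trans (truncnS_gt _) _.
  by rewrite -natrX ler_nat ltnW// ltn_expl.
have avgU k w : (k < K)%N -> class_avg e k (U M) w <= 2 * C * (U M w + eta).
  move=> kK; apply: (@le_trans _ _ (mart_max (U M) w)).
    exact: (le_run_max (class_avg e ^~ (U M))).
  have h := le_trans (UD M w) (lerD (lexx _) hM).
  apply: le_trans (ler_wpM2l _ h); last by lra.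
  have -> : U M.+1 w = G w + (2 * C)^-1 * mart_max (U M) w by [].
  rewrite mulrDr mulrA divff; last by rewrite gt_eqF//; lra.
  by rewrite mul1r lerDr mulr_ge0//; lra.
(* The added [eta] makes the weight positive. The averages of U are at most 2C (U + eta), so those
   of U + eta are at most 3C (U + eta), as C >= 1. *)
exists (fun w : Omega => U M w + eta); split.
- by move=> w; apply: le_trans (UG M w) _; rewrite lerDl ltW.
- by move=> w; rewrite ltr_wpDl.
- move=> k w kK; rewrite (class_avgD _ _ (U M) (fun=> eta)) class_avg_cst//.
  have := avgU k w kK; have := U0 M w; nra.
- have := SD _ _ _ _ (SU M) (SZ _ _ _ (ltW eta0) S1).
  rewrite (_ : (fun w => _ + _ * 1) = (fun w => U M w + eta)); last first.
    by apply/funext => w; rewrite mulr1.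
  apply: Sle; rewrite lerD2l /eta mulrAC ler_pdivrMr; last by lra.
  by rewrite ler_pM2l; lra.
Qed.

(* With [sig = u v ^ (- 1 / (q - 1))] and [W = u ^ (1 - q) v], the hypotheses
   bound [(E_k sig) ^ (q - 1) E_k W]; hence [(E_k a) ^ (q - 1)] is at most a
   constant times the [W]-weighted average of [M (a / sig) ^ (q - 1) / W], where
   [M] is the [sig]-weighted maximal function, and [doob] applies twice. *)
Lemma maximal_weighted (u v : Omega -> R) (c q : R) : 1 < q -> 0 < c ->
  (forall w, 0 < u w) -> (forall w, 0 < v w) ->
  (forall k w, (k < K)%N -> class_avg e k u w <= c * u w) ->
  (forall k w, (k < K)%N -> class_avg e k v w <= c * v w) ->
  forall a, (forall w, 0 <= a w) ->
  \sum_w mart_max a w `^ q * (u w `^ (1 - q) * v w) <=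
  (c `^ q) `^ (q / (q - 1)) * doob_const (q / (q - 1)) * doob_const q *
  \sum_w a w `^ q * (u w `^ (1 - q) * v w).
Proof.
move=> q1 c0 u0 v0 uc vc a a0.
have q0 : 0 < q by lra.
have [r r0 rE] : exists2 r, 0 < r & q = r + 1 by exists (q - 1); lra.
have -> : 1 - q = - r by lra.
have -> : q - 1 = r by lra.
set p := q / r.
have p1 : 1 < p by rewrite ltr_pdivlMr//; lra.
have p0 : 0 < p by lra.
(* The two weights are dual: sig^(-r) = W and W^(-1/r) = sig. The changes of weight after each use
   of [doob] are these identities. *)
pose sig w := u w * v w `^ (- r^-1); pose W w := u w `^ (- r) * v w.
have sig0 w : 0 < sig w by rewrite mulr_gt0// powR_gt0.
have W0 w : 0 < W w by rewrite mulr_gt0// powR_gt0.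
have avu k w : 0 < class_avg e k u w by exact: class_avg_gt0.
have avv k w : 0 < class_avg e k v w by exact: class_avg_gt0.
have avW k w : 0 < class_avg e k W w by exact: class_avg_gt0.
have avs k w : 0 < class_avg e k sig w by exact: class_avg_gt0.
(* On a class, z is at least its average divided by c, so the negative powers of z are bounded by
   those of the average. *)
have aux (z : Omega -> R) (t : R) k w w' : (forall w, 0 < z w) -> (k < K)%N ->
    (forall k w, (k < K)%N -> class_avg e k z w <= c * z w) -> 0 < t -> e k w w' ->
    z w' `^ (- t) <= (c / class_avg e k z w) `^ t.
  move=> z0 kK zc t0 ww'.
  have zk : 0 < class_avg e k z w by exact: class_avg_gt0.
  rewrite powRN -powR_inv1 ?powR_ge0// -powRrM mulrN1 powRN -[_^-1]powR_inv1 ?powR_ge0//.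
  rewrite -powRrM mulrC powRrM powR_inv1; last exact: ltW.
  apply: le_powR; rewrite ?invr_ge0; [exact: ltW|exact: ltW|].
  rewrite ler_pdivlMr// ler_pdivrMl// mulrC.
  by rewrite (class_avg_const eE _ ww') zc.
have H1 k w : (k < K)%N -> class_avg e k sig w <=
    class_avg e k u w * (c / class_avg e k v w) `^ r^-1.
  move=> kK; rewrite [leRHS]mulrC -class_avgZ.
  apply: le_class_avg_in => // w' ww'; rewrite [leRHS]mulrC ler_pM2l//.
  by apply: aux ww' => //; rewrite invr_gt0.
have H2 k w : (k < K)%N -> class_avg e k W w <=
    class_avg e k v w * (c / class_avg e k u w) `^ r.
  move=> kK; rewrite [leRHS]mulrC -class_avgZ.
  by apply: le_class_avg_in => // w' ww'; rewrite ler_pM2r// aux.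
(* The averages of u and v cancel in the product, leaving c c^r = c^q. *)
have H3 k w : (k < K)%N ->
    class_avg e k sig w `^ r * class_avg e k W w <= c `^ q.
  move=> kK.
  have h1 : class_avg e k sig w `^ r <=
      class_avg e k u w `^ r * (c / class_avg e k v w).
    have := le_powR (ltW r0) (ltW (avs k w)) (H1 k w kK).
    rewrite powRM ?powR_ge0 ?(ltW (avu _ _))// powRVK//.
    by rewrite divr_ge0// ltW.
  apply: le_trans (ler_pM (powR_ge0 _ _) (ltW (avW _ _)) h1 (H2 k w kK)) _.
  rewrite powRM ?invr_ge0 ?(ltW c0) ?(ltW (avu _ _))//.
  rewrite -[(class_avg e k u w)^-1]powR_inv1 ?(ltW (avu _ _))//.
  rewrite -powRrM mulN1r powRN rE.
  rewrite powRD ?(gt_eqF c0) ?implybT// powRr1; last exact: ltW.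
  apply: eq_lew; field.
  by rewrite !gt_eqF// powR_gt0.
pose b w := a w / sig w.
have b0 w : 0 <= b w by rewrite divr_ge0// ltW.
pose Ts := run_max (wavg e sig ^~ b) K.
have Ts0 w : 0 <= Ts w by exact: run_max_ge0.
pose g w := Ts w `^ r / W w.
have g0 w : 0 <= g w by rewrite divr_ge0 ?powR_ge0// ltW.
pose TW := run_max (wavg e W ^~ g) K.
have TW0 w : 0 <= TW w by exact: run_max_ge0.
(* The average of a is the [sig]-average of b times the average of [sig]. By [H3] its r-th power is
   at most c^q times the r-th power of the [sig]-average of b, divided by the average of W. On the
   class that power is a constant below Ts^r = g W, hence below the average of g W. *)
have H4 k w : (k < K)%N -> class_avg e k a w `^ r <= c `^ q * TW w.
  move=> kK.
  have -> : class_avg e k a w = wavg e sig k b w * class_avg e k sig w.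
    rewrite /wavg mulfVK ?gt_eqF//; congr class_avg; apply/funext => v'.
    by rewrite /b mulfVK// gt_eqF.
  have wb0 : 0 <= wavg e sig k b w by exact: wavg_ge0.
  rewrite powRM//; last exact: ltW.
  apply: (@le_trans _ _ (wavg e sig k b w `^ r * (c `^ q / class_avg e k W w))).
    by rewrite ler_wpM2l ?powR_ge0// ler_pdivlMr// H3.
  rewrite mulrCA ler_wpM2l ?powR_ge0//.
  apply: le_trans (le_run_max (wavg e W ^~ g) w kK).
  rewrite /wavg ler_pM2r ?invr_gt0//.
  apply: class_avg_ge => // w' ww'; rewrite /g mulfVK ?gt_eqF//.
  apply: le_powR => //; first exact: ltW.
  rewrite -/(wavg _ _ _ _ _) (wavg_const eE _ _ ww').
  exact: (le_run_max (wavg e sig ^~ b)).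
have H5 w : mart_max a w `^ q <= (c `^ q) `^ p * TW w `^ p.
  rewrite -powRM ?powR_ge0//.
  have -> : q = r * p by rewrite /p mulrCA divff ?mulr1// gt_eqF.
  rewrite powRrM; apply: le_powR; rewrite ?powR_ge0//; first exact: ltW.
  have cT : 0 <= c `^ (r * p) * TW w by rewrite mulr_ge0// powR_ge0.
  rewrite -[leRHS](powRVK r0 cT); apply: le_powR; [exact: ltW|exact: mart_max_ge0|].
  apply: run_max_le; first exact: powR_ge0.
  move=> i iK; rewrite -[leLHS](powRKV r0) ?class_avg_ge0//.
  apply: le_powR; rewrite ?invr_ge0 ?powR_ge0//; first exact: ltW.
  by rewrite (_ : r * p = q) ?H4// /p mulrCA divff ?mulr1// gt_eqF.
have S1 : \sum_w mart_max a w `^ q * W w <= (c `^ q) `^ p * \sum_w TW w `^ p * W w.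
  by rewrite mulr_sumr ler_sum// => w _; rewrite mulrA ler_pM2r.
apply: le_trans S1 _; rewrite -2![leRHS]mulrA ler_wpM2l ?powR_ge0//.
apply: le_trans (doob eE eS W0 K p1 g0) _; rewrite ler_wpM2l ?doob_const_ge0//.
have -> : \sum_w g w `^ p * W w = \sum_w Ts w `^ q * sig w.
  apply: eq_bigr => w _; rewrite /g powRM ?powR_ge0 ?invr_ge0 ?(ltW (W0 w))//.
  rewrite -powRrM [r * p](_ : _ = q); last by rewrite /p mulrCA divff ?mulr1// gt_eqF.
  rewrite -mulrA; congr (_ * _).
  rewrite -powR_inv1 ?(ltW (W0 w))// -powRrM mulN1r.
  rewrite -{2}(powRr1 (ltW (W0 w))) -powRD ?(gt_eqF (W0 w)) ?implybT//.
  have -> : - p + 1 = - r^-1 by rewrite /p rE; field; rewrite gt_eqF.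
  rewrite /W powRM ?powR_ge0 ?(ltW (v0 w))// -powRrM mulrNN divff ?gt_eqF//.
  by rewrite powRr1// ltW.
apply: le_trans (doob eE eS sig0 K q1 b0) _; rewrite ler_wpM2l ?doob_const_ge0//.
apply: eq_lew; apply: eq_bigr => w _.
rewrite /b powRM ?invr_ge0 ?(ltW (sig0 w))// -mulrA; congr (_ * _).
rewrite -powR_inv1 ?(ltW (sig0 w))// -powRrM mulN1r.
rewrite -{2}(powRr1 (ltW (sig0 w))) -powRD ?(gt_eqF (sig0 w)) ?implybT//.
have -> : - q + 1 = - r by lra.
rewrite /sig powRM ?powR_ge0 ?(ltW (u0 w))// -powRrM mulrNN mulVf ?gt_eqF//.
by rewrite powRr1// ltW.
Qed.

End martingale_maximal.

(** * From scalar to vector-valued bounds on a finite set *)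

Lemma powR_superadd {R : realType} (p x y : R) : 1 <= p -> 0 <= x -> 0 <= y ->
  x `^ p + y `^ p <= (x + y) `^ p.
Proof.
move=> p1 x0 y0; have p0 : 0 < p by lra.
rewrite -(mulr_powRB1 x0 p0) -(mulr_powRB1 y0 p0) -(mulr_powRB1 (addr_ge0 x0 y0) p0).
rewrite mulrDl; apply: lerD; rewrite ler_wpM2l//; apply: le_powR => //; lra.
Qed.

Section lattice_seminorm.
Context {R : realType} {Omega : finType}.
Implicit Types (N : (Omega -> R) -> R) (a b g h : Omega -> R).

Definition lattice_seminorm N :=
  [/\ forall a b, (forall w, `|a w| <= `|b w|) -> N a <= N b,
      forall a b, N (fun w => a w + b w) <= N a + N b &
      forall c a, 0 <= c -> N (fun w => c * a w) = c * N a].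

Lemma lattice_seminorm0 N : lattice_seminorm N -> N (fun=> 0) = 0.
Proof.
move=> [_ _ NZ]; rewrite -[RHS](mul0r (N (fun=> 0))) -NZ//.
by congr N; apply/funext => w; rewrite mul0r.
Qed.

Lemma lattice_seminorm_ge0 N a : lattice_seminorm N -> 0 <= N a.
Proof.
move=> NN; rewrite -(lattice_seminorm0 NN); have [Nle _ _] := NN.
by apply: Nle => w; rewrite normr0.
Qed.

(** Starting from the multiples of [a], the functional is extended by one coordinate of [Omega] at a
    time. *)
Lemma finite_hahn_banach N : lattice_seminorm N -> forall a,
  exists2 g, forall b, \sum_w b w * g w <= N b & N a <= \sum_w a w * g w.
Proof.
move=> NN a; have [Nle ND NZ] := NN.
have N0 := lattice_seminorm0 NN.
(* The functional is given on pairs [(c, b)]; that its value depends only on c a + b follows from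
   the inequality itself, so no linear subspace has to be formed. *)
suff [g Hg] : exists g, forall c b,
    c * N a + \sum_w b w * g w <= N (fun w => c * a w + b w).
  exists g.
    move=> b; have := Hg 0 b; rewrite mul0r add0r.
    by rewrite (_ : (fun w => 0 * a w + b w) = b)//; apply/funext => w; rewrite mul0r add0r.
  have := Hg 1 (fun w => - a w); rewrite mul1r.
  rewrite (_ : (fun w => 1 * a w - a w) = (fun=> 0)); last first.
    by apply/funext => w; rewrite mul1r subrr.
  by rewrite N0; under eq_bigr do rewrite mulNr; rewrite sumrN subr_le0.
suff /(_ (enum Omega) (enum_uniq _)) [g Hg] : forall s, uniq s -> exists g, forall c b,
    (forall w, w \notin s -> b w = 0) ->
    c * N a + \sum_(w <- s) b w * g w <= N (fun w => c * a w + b w).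
  exists g => c b; have := Hg c b; rewrite big_enum; apply => w.
  by rewrite mem_enum.
elim=> [_|w0 s IH /= /andP[w0s us]].
  exists (fun=> 0) => c b b0; rewrite big_nil addr0.
  have -> : (fun w => c * a w + b w) = (fun w => c * a w).
    by apply/funext => w; rewrite b0// addr0.
  have [c0|c0] := leP 0 c; first by rewrite NZ.
  apply: le_trans (lattice_seminorm_ge0 _ NN).
  by rewrite mulr_le0_ge0 ?lattice_seminorm_ge0// ltW.
have {IH us} [g Hg] := IH us.
pose dl w : R := (w == w0)%:R.
pose P b := forall w, w \notin s -> b w = 0.
(* [L] and [U] are the lower and upper bounds for the value on the new unit vector [dl]; any number
   between them, such as the supremum of the lower ones, extends the functional. *)
pose L c b := c * N a + \sum_(w <- s) b w * g w - N (fun w => c * a w + b w - dl w).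
pose U c b := N (fun w => c * a w + b w + dl w) - (c * N a + \sum_(w <- s) b w * g w).
have LU c1 b1 c2 b2 : P b1 -> P b2 -> L c1 b1 <= U c2 b2.
  move=> P1 P2; rewrite /L /U lerBrDr addrAC lerBlDl.
  apply: (@le_trans _ _ (N (fun w => (c1 + c2) * a w + (b1 w + b2 w)))).
    apply: le_trans (Hg (c1 + c2) (fun w => b1 w + b2 w) _); last first.
      by move=> w ws; rewrite P1// P2// addr0.
    under [in leRHS]eq_bigr do rewrite mulrDl.
    by rewrite big_split/=; apply: eq_lew; ring.
  have := ND (fun w => c1 * a w + b1 w - dl w) (fun w => c2 * a w + b2 w + dl w).
  by apply: le_trans; apply: Nle => w; rewrite le_eqVlt; apply/orP; left;
    apply/eqP; congr `|_|; ring.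
pose A : set R := [set x | exists c b, P b /\ x = L c b].
have P0 : P (fun=> 0) by [].
have ubA c b : P b -> ubound A (U c b).
  by move=> Pb _ [c' [b' [Pb' ->]]]; exact: LU.
have supA : has_sup A.
  by split; [exists (L 0 (fun=> 0)), 0, (fun=> 0)|exists (U 0 (fun=> 0)); exact: ubA].
pose g0 := sup A.
have g0U c b : P b -> g0 <= U c b.
  by move=> Pb; apply: ge_sup; [exact: supA.1|exact: ubA].
have Lg0 c b : P b -> L c b <= g0.
  by move=> Pb; apply: ub_le_sup; [exact: supA.2|exists c, b].
exists (fun w => if w == w0 then g0 else g w) => c b Pb.
rewrite big_cons eqxx.
have -> : \sum_(w <- s) b w * (if w == w0 then g0 else g w) = \sum_(w <- s) b w * g w.
  by apply: eq_big_seq => w ws; case: eqP => // ww0; rewrite -ww0 ws in w0s.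
pose b' w := if w == w0 then 0 else b w.
have Pb' x : P (fun w => x * b' w).
  move=> w ws; rewrite /b'; case: eqP => [|/eqP ww0]; first by rewrite mulr0.
  by rewrite Pb ?mulr0// inE negb_or ww0.
have sb' x : \sum_(w <- s) (x * b' w) * g w = x * \sum_(w <- s) b w * g w.
  rewrite mulr_sumr; apply: eq_big_seq => w ws; rewrite /b'.
  by case: eqP => [ww0|_]; [rewrite -ww0 ws in w0s|rewrite mulrA].
have bE w : b w = b' w + b w0 * dl w.
  rewrite /b' /dl; case: eqP => [->|_]; first by rewrite mulr1 add0r.
  by rewrite mulr0 addr0.
(* Scaling by the absolute value of [b w0] reduces a nonzero coefficient to -1 or 1, the cases
   covered by [L] and [U]. *)
have [t0|t0|t0] := ltgtP (b w0) 0.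
- set t := - b w0; have tp : 0 < t by rewrite oppr_gt0.
  have := Lg0 (c / t) _ (Pb' t^-1); rewrite /L sb'.
  have -> : (fun w => c * a w + b w) =
      (fun w => t * (c / t * a w + t^-1 * b' w - dl w)).
    by apply/funext => w; rewrite bE /t; field; rewrite lt_eqF.
  rewrite NZ ?(ltW tp)// lerBlDr => /(ler_wpM2l (ltW tp)).
  rewrite !mulrDr !mulrA [t * c]mulrC mulfK ?gt_eqF// divff ?gt_eqF//.
  by rewrite /t; lra.
- set t := b w0; have tp : 0 < t by [].
  have := g0U (c / t) _ (Pb' t^-1); rewrite /U sb'.
  have -> : (fun w => c * a w + b w) =
      (fun w => t * (c / t * a w + t^-1 * b' w + dl w)).
    by apply/funext => w; rewrite bE /t; field; rewrite gt_eqF.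
  rewrite NZ ?(ltW tp)// lerBrDr => /(ler_wpM2l (ltW tp)).
  rewrite !mulrDr !mulrA [t * c]mulrC mulfK ?gt_eqF// divff ?gt_eqF//.
  by rewrite /t; lra.
- rewrite t0 mul0r add0r; apply: Hg => w ws.
  have [->//|ww0] := eqVneq w w0; by rewrite Pb// inE negb_or ww0.
Qed.

(** The absolute value of a norming functional is still dominated by [N], because [N] does not see
    signs. *)
Lemma finite_lattice_duality N : lattice_seminorm N -> forall a, (forall w, 0 <= a w) ->
  exists g, [/\ forall w, 0 <= g w,
    forall h, (forall w, 0 <= h w) -> \sum_w g w * h w <= N h &
    N a <= \sum_w g w * a w].
Proof.
move=> NN a a0; have [g gN ag] := finite_hahn_banach NN a.
have [Nle _ _] := NN.
exists (fun w => `|g w|); split => [//|h h0|].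
  apply: le_trans (_ : N (fun w => h w * Num.sg (g w)) <= _); last first.
    apply: Nle => w; rewrite normrM normr_sg ler_piMr//.
    by case: (g w != 0); rewrite ?lexx ?ler01.
  apply: le_trans (gN _); apply: eq_lew.
  by apply: eq_bigr => w _; rewrite normrEsg; ring.
apply: le_trans ag _; apply: ler_sum => w _; rewrite mulrC ler_wpM2r//.
exact: ler_norm.
Qed.

End lattice_seminorm.

Section seminorm_maximal.
Context {R : realType} {Omega : finType} (e : nat -> rel Omega).
Hypothesis eE : forall k, equivalence_rel (e k).
Hypothesis eS : forall k, subrel (e k.+1) (e k).
Variable K : nat.
Implicit Types (a b f g h u v : Omega -> R) (N : (Omega -> R) -> R).

(** For nonnegative [g]: its norm in the dual of [N] is at most [B]. This is a relation because the
    dual norm may be infinite for a mere seminorm. *)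
Definition dual_bound N g (B : R) :=
  forall h, (forall w, 0 <= h w) -> \sum_w g w * h w <= B * N h.

Definition weight_const (c q : R) : R :=
  (c `^ q) `^ (q / (q - 1)) * doob_const (q / (q - 1)) * doob_const q.

Lemma weight_const_ge0 c q : 1 < q -> 0 <= weight_const c q.
Proof.
move=> q1; apply: mulr_ge0; last exact: doob_const_ge0.
apply: mulr_ge0; first exact: powR_ge0.
by apply: doob_const_ge0; rewrite ltr_pdivlMr; lra.
Qed.

(** The argument 3C is the invariance constant of [rubio_de_francia]; 6 is the product of its norm
    bounds, 3 for [v] and 2 for [u]. *)
Definition vector_const (C q : R) : R :=
  6 * (weight_const (3 * C) q + 1).

Lemma vector_const_gt0 C q : 1 < q -> 0 < vector_const C q.
Proof.
by move=> q1; rewrite /vector_const; have := weight_const_ge0 (3 * C) q1; lra.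
Qed.

Local Notation T := (mart_max e K).

(* For [g] norming [F], majorise [G] by [u] and [g] by [v], both almost fixed by
   [T]: then [F v <= ((F / u) ^ q + 1) u v], and the weight [u ^ (1 - q) v] is
   good for the maximal operator on [L^q]. *)
Lemma vector_maximal_bound N (C B1 q : R) : lattice_seminorm N -> 1 <= C -> 1 < q ->
  (forall a, (forall w, 0 <= a w) -> N (T a) <= C * N a) ->
  (forall g B, (forall w, 0 <= g w) -> 0 <= B -> dual_bound N g B ->
     dual_bound N (T g) (C * B)) ->
  0 <= B1 -> dual_bound N (fun=> 1) B1 ->
  forall m (a : 'I_m -> Omega -> R), (forall j w, 0 <= a j w) ->
  N (fun w => (\sum_j T (a j) w `^ q) `^ q^-1) <=
  vector_const C q * N (fun w => (\sum_j a j w `^ q) `^ q^-1).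
Proof.
move=> NN C1 q1 NT NT' B10 NB1 m a a0.
have [Nle ND NZ] := NN.
have N0 b : 0 <= N b by exact: lattice_seminorm_ge0.
have q0 : 0 < q by lra.
pose F w := (\sum_j T (a j) w `^ q) `^ q^-1.
pose G w := (\sum_j a j w `^ q) `^ q^-1.
suff: N F <= vector_const C q * N G by [].
have F0 w : 0 <= F w by exact: powR_ge0.
have G0 w : 0 <= G w by exact: powR_ge0.
have Fq w : F w `^ q = \sum_j T (a j) w `^ q.
  by rewrite powRVK// sumr_ge0// => j _; exact: powR_ge0.
have Gq w : G w `^ q = \sum_j a j w `^ q.
  by rewrite powRVK// sumr_ge0// => j _; exact: powR_ge0.
have [g [g0 gN Ng]] := finite_lattice_duality NN F0.
(* [g] has dual norm at most 1 and [eps] is 1 here, whence the bound 3. For [u] below, [eps] stays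
   free because [N G] may vanish. *)
have [v [gv v0 Tv Sv]] : exists v, [/\ forall w, g w <= v w, forall w, 0 < v w,
    forall k w, (k < K)%N -> class_avg e k v w <= 3 * C * v w &
    dual_bound N v (2 * 1 + 1)].
  apply: (@rubio_de_francia _ _ _ eE K (dual_bound N) C B1) => //.
  - move=> g1 B B' BB' h h1 h10; apply: le_trans (h _ h10) _.
    by rewrite ler_wpM2r.
  - move=> g1 g2 B B' h1 h2 h h0; under eq_bigr do rewrite mulrDl.
    by rewrite big_split/= mulrDl lerD ?h1 ?h2.
  - move=> c g1 B c0 h1 h h0; under eq_bigr do rewrite -mulrA.
    by rewrite -mulr_sumr -mulrA ler_wpM2l// h1.
  - by move=> h h0; rewrite mul1r gN.
set cq := weight_const (3 * C) q.
have cq0 : 0 <= cq by exact: weight_const_ge0.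
have main eps : 0 < eps -> N F <= (cq + 1) * (3 * (2 * N G + eps)).
  move=> eps0.
  have [u [Gu u0 Tu Su]] : exists u, [/\ forall w, G w <= u w, forall w, 0 < u w,
      forall k w, (k < K)%N -> class_avg e k u w <= 3 * C * u w &
      N u <= 2 * N G + eps].
    apply: (@rubio_de_francia _ _ _ eE K (fun g B => N g <= B) C (N (fun=> 1))) => //.
    - by move=> g1 B B' BB' /le_trans; apply.
    - by move=> g1 g2 B B' h1 h2; apply: le_trans (ND _ _) _; exact: lerD.
    - by move=> c g1 B c0 h1; rewrite NZ// ler_wpM2l.
    - move=> g1 B g10 B0 h; apply: le_trans (NT _ g10) _.
      by rewrite ler_wpM2l//; lra.
  apply: le_trans Ng _.
  apply: (@le_trans _ _ (\sum_w v w * F w)).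
    by apply: ler_sum => w _; rewrite ler_wpM2r.
  apply: (@le_trans _ _ ((cq + 1) * \sum_w v w * u w)); last first.
    rewrite ler_wpM2l//; first by lra.
    apply: le_trans (Sv u (fun w => ltW (u0 w))) _.
    by rewrite mulr1 [2 + 1](_ : _ = 3) ?ler_wpM2l//; lra.
  have pw w : v w * F w <= F w `^ q * (u w `^ (1 - q) * v w) + v w * u w.
    rewrite [leRHS](_ : _ = v w * u w * ((F w / u w) `^ q + 1)); last first.
      rewrite powRM ?invr_ge0 ?(ltW (u0 w))// -powR_inv1 ?(ltW (u0 w))//.
      rewrite -powRrM mulN1r [_ + 1]addrC.
      rewrite powRD ?(gt_eqF (u0 w)) ?implybT// powRr1 ?(ltW (u0 w))//; ring.
    rewrite [leLHS](_ : _ = v w * u w * (F w / u w)); last first.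
      by field; rewrite gt_eqF.
    rewrite ler_pM2l; last by rewrite mulr_gt0.
    have [h|h] := leP (F w / u w) 1; first by rewrite ler_wpDl ?powR_ge0.
    by rewrite ler_wpDr//; apply: le1r_powR; rewrite ltW.
  apply: le_trans (ler_sum _ (fun w _ => pw w)) _.
  rewrite big_split/= mulrDl mul1r lerD2r.
  under eq_bigr do rewrite Fq mulr_suml.
  rewrite exchange_big/=.
  have h j := maximal_weighted eE eS q1 (lt_le_trans ltr01 (ltac:(lra) : 1 <= 3 * C))
    u0 v0 Tu Tv (a0 j).
  apply: le_trans (ler_sum _ (fun j _ => h j)) _.
  rewrite -mulr_sumr ler_wpM2l//.
  rewrite exchange_big/=; apply: ler_sum => w _.
  rewrite -mulr_suml -Gq mulrCA mulrA mulrC ler_pM2l//.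
  (* G <= u bounds u^(1-q) G^q by u, so the weighted sum is at most the pairing of v with u. *)
  apply: (@le_trans _ _ (u w `^ (1 - q) * u w `^ q)).
    exact: ler_wpM2l (powR_ge0 _ _) _ _ (le_powR (ltW q0) (G0 w) (Gu w)).
  rewrite -powRD ?(gt_eqF (u0 w)) ?implybT// subrK powRr1//; exact: ltW.
apply/ler_addgt0Pr => eps eps0.
have h0 : 0 < 3 * (cq + 1) by lra.
apply: le_trans (main (eps / (3 * (cq + 1))) (divr_gt0 eps0 h0)) _.
rewrite /vector_const -/cq; apply: eq_lew.
by field; lra.
Qed.

End seminorm_maximal.

(** * From vector-valued to dual bounds on a finite set *)

Lemma half_absorb {R : realType} (x y : R) : x <= 2^-1 * x + y -> x <= 2 * y.
Proof. lra. Qed.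

Section selection.
Context {R : realType} {Omega : finType} (e : nat -> rel Omega).
Hypothesis eE : forall k, equivalence_rel (e k).
Hypothesis eS : forall k, subrel (e k.+1) (e k).
Variable K : nat.
Implicit Types (a b f g h : Omega -> R) (N : (Omega -> R) -> R).

Section principal.
Variable g : Omega -> R.
Hypothesis g0 : forall w, 0 <= g w.

(** Principal classes: [sel k w] is the average of [g] over the latest class around [w], among the
    levels below [k], that was selected; a class is selected when its average exceeds twice the
    value in force. *)
Fixpoint sel k w : R := if k is k'.+1 then
  (if 2 * sel k' w < class_avg e k' g w then class_avg e k' g w else sel k' w)
  else 0.

Definition selected k w : bool := 2 * sel k w < class_avg e k g w.

(** Every selection strictly raises the value, so equal values mean that no class around [w] is
    selected between the levels [k] and [K]. *)
Definition last_selected k w : bool := selected k w && (sel K w == sel k.+1 w).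

Lemma sel_ge0 k w : 0 <= sel k w.
Proof. by elim: k => //= k IH; case: ifP => // _; exact: class_avg_ge0. Qed.

Lemma selE k w : sel k.+1 w = if selected k w then class_avg e k g w else sel k w.
Proof. by []. Qed.

Lemma sel_leS k w : sel k w <= sel k.+1 w.
Proof.
rewrite selE; case: ifPn => //; rewrite /selected; have := sel_ge0 k w; lra.
Qed.

Lemma sel_le i k w : (i <= k)%N -> sel i w <= sel k w.
Proof.
move=> /subnK <-; elim: (k - i)%N => // d IH; exact: le_trans IH (sel_leS _ _).
Qed.

Lemma sel_const k : class_const e k (sel k.+1).
Proof.
have: class_const e k (sel k) -> class_const e k (sel k.+1).
  move=> sk w w' h; rewrite !selE /selected (sk _ _ h).
  by rewrite (class_avg_const eE _ h).
apply; elim: k => [|k IH] w w' h //.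
rewrite !selE /selected (IH _ _ (eS h)).
by rewrite (class_avg_const eE _ (eS h)).
Qed.

Lemma sel_const0 k : class_const e k (sel k).
Proof. by case: k => // k w w' /eS; exact: sel_const. Qed.

Lemma selected_const k w w' : e k w w' -> selected k w = selected k w'.
Proof.
by move=> h; rewrite /selected (sel_const0 h) (class_avg_const eE _ h).
Qed.

Lemma mart_max_le_sel w : mart_max e K g w <= 2 * sel K w.
Proof.
apply: run_max_le; first by rewrite mulr_ge0// sel_ge0.
move=> i iK; apply: (@le_trans _ _ (2 * sel i.+1 w)).
  rewrite selE; case: ifPn => [_|]; last by rewrite -leNgt.
  have := class_avg_ge0 e i g0 w; lra.
by rewrite ler_pM2l// sel_le.
Qed.

(** The value is 0 or one of the terms. For fixed selections the sum is linear in the averages,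
    which can then be moved to the other factor of a pairing. *)
Lemma sel_le_sum k w :
  sel k w <= \sum_(i < k) (selected i w)%:R * class_avg e i g w.
Proof.
elim: k => [|k IH]; first by rewrite big_ord0.
rewrite big_ord_recr/= -/(selected k w); case: ifPn => h.
  rewrite mul1r lerDr sumr_ge0// => i _.
  by rewrite mulr_ge0// ?class_avg_ge0.
by rewrite mul0r addr0.
Qed.

Lemma last_selected_uniq i k w :
  (i < K)%N -> (k < K)%N -> last_selected i w -> last_selected k w -> i = k.
Proof.
move=> iK kK; wlog ik : i k iK kK / (i < k)%N => [hw|].
  by move=> hi hk; case: (ltngtP i k) => // ?; [exact: hw|apply/esym/hw].
case/andP => si /eqP Ki /andP[sk /eqP Kk]; exfalso.
move: sk; rewrite /selected => sk.
have hs : sel k.+1 w = class_avg e k g w by rewrite selE /selected sk.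
have h1 : sel i.+1 w <= sel k w by exact: sel_le.
have : 0 < sel i.+1 w.
  by rewrite selE si; move: si; rewrite /selected; have := sel_ge0 i w; lra.
by rewrite -hs -Kk Ki in sk; lra.
Qed.

(* The mass of [g] on the part of a selected class covered by later selections
   exceeds twice the average there, hence that part is at most half the class. *)
Lemma half_last_selected k w : (k < K)%N -> selected k w ->
  2^-1 <= class_avg e k (fun w => (last_selected k w)%:R : R) w.
Proof.
move=> kK sw; set c := sel k.+1 w.
have cE : c = class_avg e k g w by rewrite /c selE sw.
have c0 : 0 < c.
  by rewrite cE; move: sw; rewrite /selected; have := sel_ge0 k w; lra.
have cc w' : e k w w' -> sel k.+1 w' = c by move=> /sel_const.
(* [bad m] marks the points whose value has changed since the selection at level [k]. The points
   that turn bad at one level form whole classes of that level, on which the average of [g] exceeds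
   2c. *)
pose bad m w' : R := (sel m w' != c)%:R.
have step m : (k < m)%N -> 2 * c * (\sum_(w' | e k w w') bad m w') <=
    \sum_(w' | e k w w') bad m w' * g w'.
  elim: m => // m IH; rewrite ltnS leq_eqVlt => /predU1P[<-|km].
    by rewrite !big1 ?mulr0// => w' h; rewrite /bad cc// eqxx ?mul0r.
  pose new w' : R := ((sel m w' == c) && selected m w')%:R.
  have badE w' : e k w w' -> bad m.+1 w' = bad m w' + new w'.
    move=> h; rewrite /bad /new selE; case: ifPn => sm; last first.
      by rewrite andbF addr0.
    rewrite andbT; move: sm; rewrite /selected => sm.
    have hc : c <= sel m w' by rewrite -(cc _ h) sel_le.
    have -> : class_avg e m g w' != c by rewrite gt_eqF//; lra.
    by case: eqP => _; rewrite ?add0r ?addr0.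
  have newc : class_const e m new.
    by move=> v v' h; rewrite /new (sel_const0 h) (selected_const h).
  have hnew : 2 * c * (\sum_(w' | e k w w') new w') <= \sum_(w' | e k w w') new w' * g w'.
    (* As k < m, the class of level k is a union of classes of level m, so its indicator, like
       [new], passes through the average of level m. *)
    pose inQ w' : R := (e k w w')%:R.
    have inQc : class_const e m inQ.
      move=> v v' h; rewrite /inQ; congr (_%:R); congr (nat_of_bool _).
      have h' : e k v v' by apply: (e_le eS (ltnW km)).
      by rewrite e_sym// [RHS]e_sym// (e_class eE h').
    have -> : \sum_(w' | e k w w') new w' * g w' = \sum_w' g w' * (new w' * inQ w').
      rewrite big_mkcond/=; apply: eq_bigr => w' _; rewrite /inQ.
      by case: (e k w w'); rewrite ?mulr1 ?mulr0// mulrC.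
    have -> : \sum_(w' | e k w w') new w' = \sum_w' new w' * inQ w'.
      rewrite big_mkcond/=; apply: eq_bigr => w' _; rewrite /inQ.
      by case: (e k w w'); rewrite ?mulr1 ?mulr0.
    have -> : \sum_w' g w' * (new w' * inQ w') =
        \sum_w' class_avg e m g w' * (new w' * inQ w').
      rewrite class_avg_selfadj//; apply: eq_bigr => w' _; congr (_ * _).
      pose D v := new v * inQ v.
      have Dc : class_const e m D by move=> v v' h; rewrite /D (newc _ _ h) (inQc _ _ h).
      rewrite -[LHS]mul1r -[RHS](_ : class_avg e m (fun v => 1 * D v) w' = _).
        by rewrite class_avgMr// class_avg_cst.
      by congr class_avg; apply/funext => v; rewrite mul1r.
    rewrite mulr_sumr; apply: ler_sum => w' _.
    rewrite /new; case: eqP => [h|_]; last by rewrite !mul0r !mulr0.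
    case sm: (selected m w'); last by rewrite !mul0r !mulr0.
    rewrite ler_wpM2r ?mulr_ge0//.
    by move: sm; rewrite /selected h => /ltW.
  rewrite (eq_bigr _ badE) big_split/= mulrDr.
  rewrite [leRHS](_ : _ = \sum_(w' | e k w w') bad m w' * g w' +
                          \sum_(w' | e k w w') new w' * g w'); first exact: lerD (IH km) hnew.
  by rewrite -big_split/=; apply: eq_bigr => w' h; rewrite badE// mulrDl.
(* 2c times the size of the bad part is at most the sum of [g] over the class, which is c times the
   size of the class. *)
have hb : \sum_(w' | e k w w') bad K w' <= 2^-1 * \sum_(w' | e k w w') 1.
  rewrite -(ler_pM2l (_ : 0 < 2 * c)); last by rewrite mulr_gt0.
  apply: le_trans (step K kK) _.
  apply: (@le_trans _ _ (\sum_(w' | e k w w') g w')).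
    by apply: ler_sum => w' _; rewrite ler_piMl// /bad; case: (_ != _).
  rewrite -(class_avg_sum eE) mulrACA divff// mul1r mulr_sumr.
  by apply: ler_sum => w' h; rewrite mulr1 cE (class_avg_const eE _ h).
rewrite ler_pdivlMr ?class_size_gt0//.
have -> : \sum_(w' | e k w w') (last_selected k w')%:R =
    \sum_(w' | e k w w') 1 - \sum_(w' | e k w w') bad K w' :> R.
  rewrite -sumrB; apply: eq_bigr => w' h.
  rewrite /last_selected -(selected_const h) sw andTb /bad (cc _ h).
  by case: eqP; rewrite ?subrr ?subr0.
by move: hb; set x := \sum_(_ | _) bad K _; set y := \sum_(_ | _) 1; lra.
Qed.

End principal.

Definition absorb_const (eta q : R) : R :=
  (q * (q / eta `^ q) `^ (q - 1)) `^ q^-1.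

(** [powR_absorb] with eta^q in place of eta; superadditivity of the q-th power then allows the root
    to be taken term by term. *)
Lemma powR_absorb_root q eta x y : 1 < q -> 0 < eta -> 0 <= x -> 0 <= y ->
  (q * (x * y `^ (q - 1))) `^ q^-1 <= eta * y + absorb_const eta q * x.
Proof.
move=> q1 e0 x0 y0; have q0 : 0 < q by lra.
have s0 : 0 <= eta * y + absorb_const eta q * x.
  by rewrite addr_ge0// mulr_ge0 ?powR_ge0// ltW.
rewrite -[leRHS](powRKV q0 s0); apply: le_powR.
- by rewrite invr_ge0 ltW.
- by rewrite !mulr_ge0 ?powR_ge0// ltW.
apply: le_trans (powR_absorb q1 q0 (powR_gt0 q e0) x0 y0) _.
have c0 : 0 <= q * (q / eta `^ q) `^ (q - 1) by rewrite mulr_ge0 ?powR_ge0// ltW.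
rewrite -{1}(powRVK q0 c0) -powRM ?(ltW e0)// -powRM ?powR_ge0//.
apply: powR_superadd; first exact: ltW.
  by rewrite mulr_ge0// ltW.
by rewrite mulr_ge0// powR_ge0.
Qed.

(** The outer 2 comes from T g <= 2 sel; the rest bounds [N (A K)] by [N f], where the absorption
    has doubled 2C (mu C). *)
Definition dual_const (C q : R) : R :=
  2 * (2 * (2 * C * (absorb_const (4 * C)^-1 q * C))).

(* [mart_max g] is dominated by the sum over the selected classes of the averages
   of [g], whose adjoint applied to [f] is [A]. The increments [b k] of [A ^ q]
   are constant on the classes of [e k]; carrying them to the disjoint sets
   [last_selected k] is what the vector-valued hypothesis allows, and there they
   add up to at most [q (T f) A ^ (q - 1)], which is absorbed. *)
Lemma dual_maximal_bound N (C q : R) : lattice_seminorm N -> 0 < C -> 1 < q ->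
  (forall f, (forall w, 0 <= f w) -> N (mart_max e K f) <= C * N f) ->
  (forall phi : 'I_K -> Omega -> R, (forall k w, 0 <= phi k w) ->
     N (fun w => (\sum_(k < K) class_avg e k (phi k) w `^ q) `^ q^-1) <=
     C * N (fun w => (\sum_k phi k w `^ q) `^ q^-1)) ->
  forall g B, (forall w, 0 <= g w) -> 0 <= B -> dual_bound N g B ->
  dual_bound N (mart_max e K g) (dual_const C q * B).
Proof.
move=> NN C0 q1 NT NV g B g0 B0 gB f f0.
have [Nle ND NZ] := NN.
have q0 : 0 < q by lra.
pose A k w := \sum_(i < k) (selected g i w)%:R * class_avg e i f w.
have At i w : 0 <= (selected g i w)%:R * class_avg e i f w.
  by rewrite mulr_ge0 ?class_avg_ge0.
have A0 k w : 0 <= A k w by rewrite sumr_ge0.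
have AS k w : A k.+1 w = A k w + (selected g k w)%:R * class_avg e k f w.
  by rewrite /A big_ord_recr.
have Ac k : class_const e k (A k.+1).
  move=> w w' h; apply: eq_bigr => i _.
  have h' : e i w w' by apply: (e_le eS _ h); rewrite -ltnS.
  by rewrite (selected_const g h') (class_avg_const eE _ h').
have Amono i k w : (i <= k)%N -> A i w <= A k w.
  move=> /subnK <-; elim: (k - i)%N => // d IH; apply: le_trans IH _.
  by rewrite addSn AS lerDl.
(* By [powR_sub_le], [b k] dominates the increment of A^q at step k. *)
pose b k w := (selected g k w)%:R * (q * (class_avg e k f w * A k.+1 w `^ (q - 1))).
have b0 k w : 0 <= b k w.
  rewrite mulr_ge0// mulr_ge0 ?(ltW q0)// mulr_ge0 ?powR_ge0// class_avg_ge0//.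
have bc k : class_const e k (b k).
  move=> w w' h; rewrite /b (selected_const g h) (class_avg_const eE _ h).
  by rewrite (Ac _ _ _ h).
have Ab k w : A k w `^ q <= \sum_(i < k) b i w.
  elim: k => [|k IH]; first by rewrite /A !big_ord0 powR0// gt_eqF.
  rewrite big_ord_recr/= -lerBlDl; apply: le_trans (lerB (lexx _) IH) _.
  apply: le_trans (powR_sub_le q1 (A0 _ _) (A0 _ _)) _.
  rewrite {2}AS addrAC subrr add0r /b; apply: eq_lew; ring.
pose phi (k : 'I_K) w := b k w `^ q^-1 * (last_selected g k w)%:R.
have phi0 k w : 0 <= phi k w by rewrite mulr_ge0 ?powR_ge0.
(* [b k] is constant on classes, so the average of [phi k] is its root times the share of the class
   where this selection is the last one, which is at least one half. *)
have Ephi (k : 'I_K) w : b k w `^ q^-1 <= 2 * class_avg e k (phi k) w.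
  have -> : class_avg e k (phi k) w =
      class_avg e k (fun w => (last_selected g k w)%:R) w * b k w `^ q^-1.
    have bqc : class_const e k (fun w => b k w `^ q^-1).
      by move=> v v' h; rewrite (bc _ _ _ h).
    rewrite -(class_avgMr _ bqc).
    by congr class_avg; apply/funext => v; rewrite /phi mulrC.
  have [sk|sk] := boolP (selected g k w); last first.
    by rewrite /b (negbTE sk) mul0r powR0 ?invr_eq0 ?gt_eqF// !mulr0.
  have := half_last_selected g0 (ltn_ord k) sk.
  move=> /(ler_wpM2r (powR_ge0 (b k w) q^-1)); lra.
pose F w := (\sum_(k < K) class_avg e k (phi k) w `^ q) `^ q^-1.
have AF w : A K w <= 2 * F w.
  have F0 : 0 <= 2 * F w by rewrite mulr_ge0// powR_ge0.
  rewrite -(powRKV q0 (A0 K w)) -(powRKV q0 F0); apply: le_powR.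
  - by rewrite invr_ge0 ltW.
  - exact: powR_ge0.
  apply: le_trans (Ab _ _) _; rewrite powRM ?powR_ge0// powRVK//; last first.
    by rewrite sumr_ge0// => k _; exact: powR_ge0.
  rewrite mulr_sumr; apply: ler_sum => k _.
  rewrite -powRM ?class_avg_ge0// -(powRVK q0 (b0 k w)); apply: le_powR.
  - exact: ltW.
  - exact: powR_ge0.
  - exact: Ephi.
pose G w := (\sum_k phi k w `^ q) `^ q^-1.
pose mu := absorb_const (4 * C)^-1 q.
pose mf := mart_max e K f.
(* The factor 2C in front of [N G] turns this [eta] into 1/2, so that half of [N (A K)] remains to
   be absorbed. *)
have eta0 : 0 < (4 * C)^-1 by rewrite invr_gt0; lra.
have GA w : G w <= (4 * C)^-1 * A K w + mu * mf w.
  have mf0 : 0 <= mf w by exact: mart_max_ge0.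
  apply: le_trans (powR_absorb_root q1 eta0 mf0 (A0 K w)).
  apply: le_powR; rewrite ?invr_ge0 ?(ltW q0)//.
    by rewrite sumr_ge0// => k _; exact: powR_ge0.
  have phiq k : phi k w `^ q = b k w * (last_selected g k w)%:R.
    rewrite /phi powRM ?powR_ge0// powRVK//; congr (_ * _).
    by case: (last_selected _ _ _); rewrite ?powR1 ?powR0// gt_eqF.
  (* At a given point at most one [phi k] is nonzero, so G^q is there a single [b k] or 0. *)
  have [[k0 lk]|nk] := pselect (exists k : 'I_K, last_selected g k w); last first.
    rewrite big1 ?mulr_ge0 ?powR_ge0 ?(ltW q0)// => k _; rewrite phiq.
    by case lk: (last_selected g k w); rewrite ?mulr0//; case: nk; exists k.
  rewrite (bigD1 k0)//= big1 ?addr0; last first.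
    move=> k kk0; rewrite phiq; case lk': (last_selected g k w); rewrite ?mulr0//.
    by case/eqP: kk0; apply/val_inj/(last_selected_uniq g0 _ _ lk' lk).
  rewrite phiq lk mulr1 /b; case/andP: lk => -> _; rewrite mul1r.
  rewrite ler_pM2l//; apply: ler_pM; rewrite ?powR_ge0 ?class_avg_ge0//.
    exact: (le_run_max (class_avg e ^~ f)).
  apply: le_powR => //; first by lra.
  exact: Amono.
have NA : N (A K) <= 2 * (2 * C * (mu * C)) * N f.
  have h1 : N (A K) <= 2 * N F.
    rewrite -NZ//; apply: Nle => w.
    by rewrite !ger0_norm// mulr_ge0// powR_ge0.
  have h2 : N F <= C * N G by exact: NV.
  have h3 : N G <= (4 * C)^-1 * N (A K) + mu * (C * N f).
    apply: (@le_trans _ _ (N (fun w => (4 * C)^-1 * A K w + mu * mf w))).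
      apply: Nle => w; rewrite !ger0_norm ?powR_ge0//.
      by apply: le_trans (GA w); exact: powR_ge0.
    apply: le_trans (ND _ _) _; rewrite !NZ ?powR_ge0 ?(ltW eta0)//.
    by rewrite lerD2l ler_wpM2l ?powR_ge0// NT.
  have : N (A K) <= 2 * (C * ((4 * C)^-1 * N (A K) + mu * (C * N f))).
    apply: le_trans h1 _; rewrite ler_pM2l//; apply: le_trans h2 _.
    by rewrite ler_pM2l.
  have -> : 2 * (C * ((4 * C)^-1 * N (A K) + mu * (C * N f))) =
      2^-1 * N (A K) + 2 * C * (mu * C) * N f.
    by field; rewrite gt_eqF.
  by rewrite -[2 * _ * N f]mulrA; exact: half_absorb.
have h1 : \sum_w mart_max e K g w * f w <= 2 * \sum_w g w * A K w.
  apply: (@le_trans _ _ (\sum_w 2 * (f w *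
      \sum_(i < K) (selected g i w)%:R * class_avg e i g w))).
    apply: ler_sum => w _; rewrite mulrCA mulrC ler_wpM2l//.
    apply: le_trans (mart_max_le_sel g0 w) _.
    by rewrite ler_pM2l//; exact: sel_le_sum.
  rewrite -mulr_sumr ler_pM2l//.
  under eq_bigr do rewrite mulr_sumr.
  under [leRHS]eq_bigr do rewrite mulr_sumr.
  rewrite exchange_big [leRHS]exchange_big/=; apply: ler_sum => k _.
  have sc : class_const e k (fun w => (selected g k w)%:R : R).
    by move=> w w' h; rewrite (selected_const g h).
  apply: eq_lew.
  transitivity (\sum_w class_avg e k g w * (f w * (selected g k w)%:R)).
    by apply: eq_bigr => w _; ring.
  rewrite class_avg_selfadj//; apply: eq_bigr => w _.
  by rewrite (class_avgMr f sc); ring.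
apply: le_trans h1 _; rewrite /dual_const -!mulrA ler_pM2l//.
apply: le_trans (gB _ (A0 K)) _.
apply: le_trans (ler_wpM2l B0 NA) _.
by apply: eq_lew; rewrite /mu; ring.
Qed.

End selection.

(** * Cubes and the local maximal function *)

Section cubes.
Context {R : realType} {n : nat}.
Local Notation Rn := (n.-tuple R).
Local Notation mu := (lebesgue_Rn R n).

Definition box (A : 'I_n -> set R) : set Rn := [set x | forall i, A i (tnth x i)].

Lemma measurable_box A : (forall i, measurable (A i)) -> measurable (box A).
Proof.
move=> mA; have -> : box A =
    \bigcap_(i in [set: 'I_n]) (fun x => tnth x i) @^-1` A i.
  by apply/seteqP; split=> x Bx i; [move=> _; exact: (Bx i)|exact: (Bx i I)].
apply: fin_bigcap_measurable => // i _.
rewrite -[X in measurable X]setTI; exact: measurable_tnth.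
Qed.

Lemma lebesgue_box A (l : 'I_n -> R) : (forall i, measurable (A i)) ->
  (forall i, lebesgue_measure (A i) = (l i)%:E) -> mu (box A) = (\prod_i l i)%:E.
Proof.
move=> mA lA; rewrite /box lebesgue_Rn_box//.
by elim/big_rec2: _ => // i x y _ ->; rewrite lA EFinM.
Qed.

Lemma cubeE (a : Rn) l : cube a l = box (fun i => `]tnth a i, tnth a i + l[%classic).
Proof.
by apply/seteqP; split => x h i; have := h i; rewrite /= in_itv/=.
Qed.

Lemma measurable_cube (a : Rn) l : measurable (cube a l).
Proof. by rewrite cubeE; apply: measurable_box => i; exact: measurable_itv. Qed.

Lemma lebesgue_cube (a : Rn) l : 0 < l -> mu (cube a l) = (l ^+ n)%:E.
Proof.
move=> l0; rewrite cubeE (@lebesgue_box _ (fun=> l)); first by rewrite prodr_const card_ord.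
  by move=> i; exact: measurable_itv.
by move=> i; rewrite lebesgue_measure_itv/= lte_fin ltrDl l0 -EFinB addrAC subrr add0r.
Qed.

Lemma integral_cover (I : finType) (F : I -> set Rn) (D : set Rn) (f : Rn -> \bar R) :
  (forall i, measurable (F i)) -> measurable D -> measurable_fun [set: Rn] f ->
  (forall x, 0 <= f x)%E -> (forall x, D x -> exists i, F i x) ->
  (\int[mu]_(x in D) f x <= \sum_i \int[mu]_(x in F i) f x)%E.
Proof.
move=> mF mD mf f0 DF; rewrite integral_mkcond.
have mr A : measurable A -> measurable_fun [set: Rn] (f \_ A).
  by move=> mA; exact: (measurable_restrictT f mA).1 (measurable_funTS mf).
have r0 A x : (0 <= (f \_ A) x)%E by rewrite patchE; case: ifP.
rewrite (eq_bigr (fun i => \int[mu]_x (f \_ (F i)) x)%E); last first.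
  by move=> i _; rewrite integral_mkcond.
rewrite -ge0_integral_sum//; last by move=> i; exact: mr.
apply: ge0_le_integral => //; [exact: mr| |].
  by apply: emeasurable_sum => i; exact: mr.
move=> x _; rewrite {1}/patch; case: ifPn => [|_]; last exact: sume_ge0.
rewrite inE => /DF[i Fi]; rewrite (bigD1 i)//= patchE mem_set//.
by rewrite leeDl// sume_ge0.
Qed.

End cubes.

Section local_maximal_function.
Context {R : realType} {n : nat}.
Local Notation Rn := (n.-tuple R).
Local Notation mu := (lebesgue_Rn R n).
Implicit Types (rho l : R) (f g : Rn -> R) (a b x y : Rn).

Lemma inv_lebesgue_cube a l : 0 < l ->
  ((mu (cube a l))^-1 = ((l ^+ n)^-1)%:E)%E.
Proof. by move=> l0; rewrite lebesgue_cube// inver gt_eqF// exprn_gt0. Qed.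

Lemma local_maximal_ge rho f x a l : 0 < l <= rho -> cube a l x ->
  (((l ^+ n)^-1)%:E * \int[mu]_(y in cube a l) `|f y|%:E <= local_maximal rho f x)%E.
Proof.
move=> l0 ax; apply: ereal_sup_ubound; exists a, l; split => //.
by rewrite inv_lebesgue_cube//; case/andP: l0.
Qed.

Lemma local_maximal_le rho f x (M : \bar R) :
  (forall a l, 0 < l <= rho -> cube a l x ->
   (((l ^+ n)^-1)%:E * \int[mu]_(y in cube a l) `|f y|%:E <= M)%E) ->
  (local_maximal rho f x <= M)%E.
Proof.
move=> h; apply: ge_ereal_sup => _ [a [l [l0 ax ->]]].
by rewrite inv_lebesgue_cube ?h//; case/andP: l0.
Qed.

Lemma cube_center x l : 0 < l ->
  cube [tuple tnth x i - l / 2 | i < n] l x.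
Proof. by move=> l0 i; rewrite tnth_mktuple; lra. Qed.

Lemma local_maximal_ge0 rho f x : 0 < rho -> (0 <= local_maximal rho f x)%E.
Proof.
move=> r0; apply: le_trans (local_maximal_ge f _ (cube_center x r0)).
  by apply: mule_ge0; rewrite ?lee_fin ?invr_ge0 ?exprn_ge0 ?(ltW r0)// integral_ge0.
by rewrite r0 lexx.
Qed.

Lemma le_local_maximal rho f g : measurable_fun [set: Rn] f -> measurable_fun [set: Rn] g ->
  {ae mu, forall x, `|f x| <= `|g x|} ->
  forall x, (local_maximal rho f x <= local_maximal rho g x)%E.
Proof.
move=> mf mg fg x; apply: local_maximal_le => a l l0 ax.
apply: le_trans (local_maximal_ge g l0 ax).
have [l1 _] := andP l0.
apply: lee_wpmul2l; first by rewrite lee_fin invr_ge0 exprn_ge0// ltW.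
apply: ae_ge0_le_integral => //.
- exact: measurable_cube.
- by apply/measurable_EFinP; apply: measurable_funTS; exact: measurableT_comp.
- by apply/measurable_EFinP; apply: measurable_funTS; exact: measurableT_comp.
by apply: filterS fg => y fgy _; rewrite lee_fin.
Qed.

Lemma local_maximal0 rho x : 0 < rho -> local_maximal rho (fun=> 0) x = 0%E.
Proof.
move=> r0; apply/eqP; rewrite eq_le local_maximal_ge0// andbT.
apply: local_maximal_le => a l _ _; rewrite integral0_eq ?mule0// => y _.
by rewrite normr0.
Qed.

(** An admissible cube with average above [r] is open and lies in the superlevel set, which is
    therefore a union of boxes with rational corners, and these are countably many. *)
Lemma measurable_local_maximal rho f : measurable_fun [set: Rn] (local_maximal rho f).
Proof.
apply: (measurability _ (ErealGenOInfty.measurableE R)) => //.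
move=> _ [_ [r ->] <-]; rewrite setTI; set U := _ @^-1` _.
pose rbox (p : n.-tuple rat * n.-tuple rat) : set Rn :=
  box (fun i => `]ratr (tnth p.1 i), ratr (tnth p.2 i)[%classic).
have -> : U = \bigcup_p (if `[< rbox p `<=` U >] then rbox p else set0).
  apply/seteqP; split; last by move=> x [p _]; case: asboolP => // pU; exact: pU.
  move=> x; rewrite {1}/U /= in_itv/= andbT => /ereal_sup_gt[_ [a [l [l0 ax ->]]] rl].
  have q1 i : {q : rat | tnth a i < ratr q < tnth x i}.
    have /andP[h _] := ax i; apply: cid.
    by have [q] := rat_in_itvoo h; rewrite in_itv/=; exists q.
  have q2 i : {q : rat | tnth x i < ratr q < tnth a i + l}.
    have /andP[_ h] := ax i; apply: cid.
    by have [q] := rat_in_itvoo h; rewrite in_itv/=; exists q.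
  exists ([tuple sval (q1 i) | i < n], [tuple sval (q2 i) | i < n]) => //.
  case: asboolP => [_ i /=|nU].
    rewrite !tnth_mktuple in_itv/=.
    by case: (q1 i) (q2 i) => q /= /andP[_ ->] [q' /= /andP[->]].
  exfalso; apply: nU => y /= yb; rewrite /U /= in_itv/= andbT.
  apply: lt_le_trans rl _; apply: ereal_sup_ubound; exists a, l; split => // i.
  have := yb i; rewrite /= !tnth_mktuple in_itv/=.
  case: (q1 i) (q2 i) => q /= /andP[h1 _] [q' /= /andP[_ h2]] /andP[h3 h4].
  by rewrite (lt_trans h1 h3) (lt_trans h4 h2).
apply: countable_bigcupT_measurable; first exact: countableP.
move=> p; case: ifP => // _; apply: measurable_box => i; exact: measurable_itv.
Qed.

Lemma local_maximal_ge_cst rho g b c l' l (al : \bar R) x :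
  0 < l' -> 0 < l <= rho -> cube b l' `<=` cube c l -> cube c l x ->
  measurable_fun [set: Rn] g -> (0 <= al)%E ->
  {ae mu, forall y, cube b l' y -> (al <= `|g y|%:E)%E} ->
  (((l' / l) ^+ n)%:E * al <= local_maximal rho g x)%E.
Proof.
move=> l'0 lrho bc cx mg al0 alg.
have [l0 _] := andP lrho.
have mG A : measurable A -> measurable_fun A (fun y => `|g y|%:E).
  by move=> mA; apply/measurable_EFinP; apply: measurable_funTS; exact: measurableT_comp.
apply: le_trans (local_maximal_ge g lrho cx).
apply: (@le_trans _ _ (((l ^+ n)^-1)%:E * \int[mu]_(y in cube b l') `|g y|%:E)%E); last first.
  apply: lee_wpmul2l; first by rewrite lee_fin invr_ge0 exprn_ge0// ltW.
  apply: ge0_subset_integral => //; try exact: measurable_cube.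
  exact: (mG _ (measurable_cube _ _)).
apply: (@le_trans _ _ (((l ^+ n)^-1)%:E * \int[mu]_(y in cube b l') cst al y)%E).
  rewrite integral_cst; last exact: measurable_cube.
  rewrite [X in (al * X)%E](lebesgue_cube b l'0) [(al * _)%E]muleC muleA -EFinM.
  by rewrite expr_div_n [(l ^+ n)^-1 * _]mulrC.
apply: lee_wpmul2l; first by rewrite lee_fin invr_ge0 exprn_ge0// ltW.
apply: ae_ge0_le_integral => //; first exact: measurable_cube.
exact: (mG _ (measurable_cube _ _)).
Qed.

(* The cube of side [2 l] is covered by the [3 ^ n] cubes [cube (c s) l]; each
   meets the central one [cube w l] in a set containing [cube (b s) (l / 2)], so
   the average over one of them is first carried to the central cube and then
   to any other. *)
Lemma local_maximal_double rho f g1 g2 x : 0 < rho ->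
  measurable_fun [set: Rn] f -> measurable_fun [set: Rn] g1 -> measurable_fun [set: Rn] g2 ->
  {ae mu, forall y, (g1 y)%:E = local_maximal rho f y} ->
  {ae mu, forall y, (g2 y)%:E = local_maximal rho g1 y} ->
  (local_maximal (2 * rho) f x <= (6 ^+ n)%:E * local_maximal rho g2 x)%E.
Proof.
move=> r0 mf mg1 mg2 g1E g2E; apply: local_maximal_le => a L /andP[L0 Lr] aLx.
have [l l0 LE] : exists2 l, 0 < l & L = 2 * l by exists (L / 2); lra.
have lr : 0 < l <= rho by lra.
subst L.
pose c (s : {ffun 'I_n -> 'I_3}) := [tuple tnth a i + (s i)%:R * (l / 2) | i < n].
pose b (s : {ffun 'I_n -> 'I_3}) :=
  [tuple tnth a i + (if (s i : nat) == 2%N then 2 else 1) * (l / 2) | i < n].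
pose w := [tuple tnth a i + l / 2 | i < n].
pose al s : \bar R := (((l ^+ n)^-1)%:E * \int[mu]_(y in cube (c s) l) `|f y|%:E)%E.
have al0 s : (0 <= al s)%E.
  by apply: mule_ge0; rewrite ?lee_fin ?invr_ge0 ?exprn_ge0 ?(ltW l0)// integral_ge0.
have s012 (s : 'I_3) : (s : nat) = 0%N \/ (s : nat) = 1%N \/ (s : nat) = 2%N.
  by case: s => -[|[|[]]] //= _; tauto.
have bc s : cube (b s) (l / 2) `<=` cube (c s) l.
  move=> y h i; have := h i; rewrite !tnth_mktuple.
  by have [->|[->|->]] := s012 (s i); rewrite /= => /andP[? ?]; apply/andP; split; lra.
have bw s : cube (b s) (l / 2) `<=` cube w l.
  move=> y h i; have := h i; rewrite !tnth_mktuple.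
  by have [->|[->|->]] := s012 (s i); rewrite /= => /andP[? ?]; apply/andP; split; lra.
have half : (l / 2) / l = 2^-1 by field; rewrite gt_eqF.
have h1 s z : cube w l z -> ((2^-1 ^+ n)%:E * al s <= local_maximal rho g1 z)%E.
  move=> wz; rewrite -half; apply: (local_maximal_ge_cst (b := b s) (c := w)) => //.
  - by rewrite divr_gt0.
  - apply: filterS g1E => y gy /bc cy.
    apply: le_trans (local_maximal_ge f lr cy) _; rewrite -gy lee_fin.
    exact: ler_norm.
have h2 s s' : cube (c s') l x ->
    ((2^-1 ^+ n)%:E * ((2^-1 ^+ n)%:E * al s) <= local_maximal rho g2 x)%E.
  move=> cx; rewrite -{1}half; apply: (local_maximal_ge_cst (b := b s') (c := c s')) => //.
  - by rewrite divr_gt0.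
  - by apply: mule_ge0 => //; rewrite lee_fin exprn_ge0.
  - apply: filterS g2E => y gy /bw wy.
    apply: le_trans (h1 s y wy) _; rewrite -gy lee_fin; exact: ler_norm.
have cover y : cube a (2 * l) y -> exists s, cube (c s) l y.
  move=> ay; exists [ffun i => if tnth y i < tnth a i + l then inord 0
    else if tnth y i < tnth a i + 3 * (l / 2) then inord 1 else inord 2].
  move=> i; have /andP[y1 y2] := ay i; rewrite tnth_mktuple ffunE.
  case: (ltP (tnth y i) (tnth a i + l)) => y3; first by rewrite inordK//; lra.
  by case: (ltP (tnth y i) (tnth a i + 3 * (l / 2))) => y4; rewrite inordK//; lra.
have [s' cx] := cover x aLx.
have h3 s : (\int[mu]_(y in cube (c s) l) `|f y|%:E <=
    ((4 * l) ^+ n)%:E * local_maximal rho g2 x)%E.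
  have -> : (\int[mu]_(y in cube (c s) l) `|f y|%:E =
      ((4 * l) ^+ n)%:E * ((2^-1 ^+ n)%:E * ((2^-1 ^+ n)%:E * al s)))%E.
    rewrite /al !muleA -!EFinM -!exprVn -!exprMn.
    by rewrite (_ : 4 * l * 2^-1 * 2^-1 * l^-1 = 1) ?expr1n ?mul1e//; field; rewrite gt_eqF.
  apply: lee_wpmul2l; last exact: h2 cx.
  by rewrite lee_fin exprn_ge0//; lra.
(* Each of the two transfers costs 2^n, and the 3^n cubes of side l are averaged over a volume 2^n
   times theirs: 3^n 4^n / 2^n = 6^n. *)
apply: (@le_trans _ _ ((((2 * l) ^+ n)^-1)%:E *
    (\sum_(s : {ffun 'I_n -> 'I_3}) ((4 * l) ^+ n)%:E * local_maximal rho g2 x))%E).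
  apply: lee_wpmul2l; first by rewrite lee_fin invr_ge0 exprn_ge0// ltW.
  apply: le_trans (lee_sum _ (fun s _ => h3 s)).
  apply: integral_cover => //; try by move=> *; exact: measurable_cube.
  by apply/measurable_EFinP; exact: measurableT_comp.
have lm0 := local_maximal_ge0 g2 x r0.
rewrite -ge0_sume_distrl; last first.
  by move=> s _; rewrite lee_fin exprn_ge0//; lra.
rewrite sumEFin sumr_const card_ffun !card_ord muleA -EFinM.
rewrite -[_ ^+ n *+ _]mulr_natl natrX mulrA -exprVn -!exprMn.
by rewrite (_ : (2 * l)^-1 * 3%:R * (4 * l) = 6)//; field; rewrite gt_eqF.
Qed.

End local_maximal_function.

(** * Function spaces and doubling of the scale *)

Section lq_functions.
Context {R : realType}.
Implicit Types (x y : \bar R) (q : R).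

Lemma le_poweR q x y : 0 <= q -> (0 <= x)%E -> (x <= y)%E -> (x `^ q <= y `^ q)%E.
Proof.
move=> q0 x0 xy; apply: gt0_ler_poweR => //; rewrite in_itv/= leey andbT//.
exact: le_trans xy.
Qed.

Lemma poweRVK q x : 0 < q -> (0 <= x)%E -> ((x `^ q^-1) `^ q = x)%E.
Proof. by move=> q0 x0; rewrite -poweRrM mulVf ?gt_eqF// poweRe1. Qed.

Lemma poweRKV q x : 0 < q -> (0 <= x)%E -> ((x `^ q) `^ q^-1 = x)%E.
Proof. by move=> q0 x0; rewrite -poweRrM divff ?gt_eqF// poweRe1. Qed.

Context {n : nat}.
Local Notation Rn := (n.-tuple R).
Variable (N : nat).
Implicit Types (F G : 'I_N -> Rn -> \bar R).

Lemma lq_fin_ge0 q F z : (0 <= lq_fin q F z)%E.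
Proof. exact: poweR_ge0. Qed.

Lemma lq_sum_ge0 q F z : (0 <= \sum_j F j z `^ q)%E.
Proof. by apply: sume_ge0 => j _; exact: poweR_ge0. Qed.

Lemma measurable_lq_fin q F : (forall j, measurable_fun [set: Rn] (F j)) ->
  measurable_fun [set: Rn] (lq_fin q F).
Proof.
move=> mF; apply: (measurableT_comp (measurable_poweR q^-1)).
apply: emeasurable_sum => j; exact: (measurableT_comp (measurable_poweR q)).
Qed.

Lemma le_lq_fin q F G z : 0 < q -> (forall j, 0 <= F j z)%E ->
  (forall j, F j z <= G j z)%E -> (lq_fin q F z <= lq_fin q G z)%E.
Proof.
move=> q0 F0 FG; apply: le_poweR; rewrite ?invr_ge0 ?(ltW q0) ?lq_sum_ge0//.
by apply: lee_sum => j _; apply: le_poweR; rewrite ?(ltW q0).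
Qed.

Lemma le_lq_fin_coord q F z j : 0 < q -> (forall j, 0 <= F j z)%E ->
  (F j z <= lq_fin q F z)%E.
Proof.
move=> q0 F0; rewrite -[leLHS](poweRKV q0)//; apply: le_poweR.
- by rewrite invr_ge0 ltW.
- exact: poweR_ge0.
rewrite (bigD1 j)//= leeDl// sume_ge0// => i _; exact: poweR_ge0.
Qed.

Lemma lq_finZ q (c : R) F z : 0 < q -> 0 <= c -> (forall j, 0 <= F j z)%E ->
  (lq_fin q (fun j z => c%:E * F j z) z = c%:E * lq_fin q F z)%E.
Proof.
move=> q0 c0 F0; rewrite /lq_fin.
rewrite (eq_bigr (fun j => (c%:E `^ q) * (F j z `^ q))%E); last first.
  by move=> j _; rewrite poweRM.
rewrite -ge0_sume_distrr; last by move=> j _; exact: poweR_ge0.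
by rewrite poweRM ?poweR_ge0 ?lq_sum_ge0// poweRKV.
Qed.

Lemma lq_fin_EFin q (f : 'I_N -> R) :
  ((\sum_j (f j)%:E `^ q) `^ q^-1)%E = ((\sum_j f j `^ q) `^ q^-1)%:E.
Proof. by rewrite (eq_bigr (fun j => (f j `^ q)%:E))// sumEFin poweR_EFin. Qed.

End lq_functions.

Lemma lq_fin1 {R : realType} {n} q (F : 'I_1 -> n.-tuple R -> \bar R) z :
  0 < q -> (0 <= F ord0 z)%E -> lq_fin q F z = F ord0 z.
Proof. by move=> q0 F0; rewrite /lq_fin big_ord1 poweRKV. Qed.

Section ideal_spaces.
Context {R : realType} {n : nat}.
Local Notation Rn := (n.-tuple R).
Local Notation mu := (lebesgue_Rn R n).
Implicit Types (Z : fspace R n) (F G : Rn -> \bar R) (f g : Rn -> R).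

(** What [X] and its associate share, and enough to compare norms; it spares proving that the
    associate is a ball Banach function space. *)
Definition ideal_space Z :=
  [/\ forall f, Z f -> measurable_fun [set: Rn] f, ideal_property Z,
      forall c f, 0 < c -> Z f ->
        Z (fun x => c * f x) /\ fnorm Z (fun x => c * f x) <= c * fnorm Z f &
      forall f, Z f -> 0 <= fnorm Z f].

Lemma quasi_normed_ideal_space K Z : quasi_normed K Z -> ideal_property Z -> ideal_space Z.
Proof.
move=> [ms _ _ hZ n0 _ nZ _] iZ; split => // c f c0 Zf.
by split; [exact: hZ|rewrite nZ// gtr0_norm].
Qed.

Lemma ideal_ae_eq Z f g : ideal_space Z -> Z f -> measurable_fun [set: Rn] g ->
  {ae mu, forall x, g x = f x} -> Z g /\ fnorm Z g = fnorm Z f.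
Proof.
move=> [ms iZ _ _] Zf mg gf.
have [Zg gle] : Z g /\ fnorm Z g <= fnorm Z f.
  by apply: iZ => //; apply: filterS gf => x ->.
split => //; apply/eqP; rewrite eq_le gle/=.
by apply: (iZ g f Zg (ms f Zf) _).2; apply: filterS gf => x ->.
Qed.

Lemma enormE Z F f : ideal_space Z -> Z f -> {ae mu, forall x, F x = (f x)%:E} ->
  enorm Z F = (fnorm Z f)%:E.
Proof.
move=> iZ Zf Ff; rewrite /enorm -[RHS]ereal_inf1; congr ereal_inf.
apply/seteqP; split=> [_ [g [Zg Fg] <-]|_ ->]; last by exists f.
have [ms _ _ _] := iZ.
congr EFin; apply: (ideal_ae_eq iZ Zf (ms g Zg) _).2.
by apply: filterS2 Ff Fg => x -> [].
Qed.

Lemma enorm_EFin Z f : ideal_space Z -> Z f -> enorm Z (EFin \o f) = (fnorm Z f)%:E.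
Proof. by move=> iZ Zf; apply: enormE => //; exact: aeW. Qed.

Lemma enorm_mem Z F : (enorm Z F < +oo)%E -> mem_fspace Z F.
Proof.
by move=> /ereal_inf_lt[_ [f [Zf Ff] _] _]; exists f.
Qed.

Lemma enorm_ge0 Z F : ideal_space Z -> (0 <= enorm Z F)%E.
Proof.
move=> [_ _ _ n0]; apply: le_ereal_inf_tmp => _ [f [Zf _] <-].
by rewrite lee_fin n0.
Qed.

Lemma enorm_ae_eq Z F G : {ae mu, forall x, F x = G x} -> enorm Z F = enorm Z G.
Proof.
move=> FG; congr ereal_inf; apply/seteqP; split=> _ [f [Zf Ff] <-];
  exists f => //; split => //.
  by apply: filterS2 FG Ff => x ->.
by apply: filterS2 FG Ff => x <-.
Qed.

Lemma le_enorm Z F G : ideal_space Z -> measurable_fun [set: Rn] F ->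
  (forall x, 0 <= F x)%E -> {ae mu, forall x, F x <= G x}%E ->
  (enorm Z F <= enorm Z G)%E.
Proof.
move=> iZ mF F0 FG; have [->|] := eqVneq (enorm Z G) +oo%E; first exact: leey.
rewrite -ltey => /enorm_mem[g Zg Gg].
rewrite (enormE iZ Zg Gg).
pose f := fine \o F.
have mf : measurable_fun [set: Rn] f by exact: measurableT_comp.
have Ff : {ae mu, forall x, F x = (f x)%:E}.
  apply: filterS2 FG Gg => x + Gx; rewrite Gx => Fx.
  by rewrite /f /= fineK// ge0_fin_numE// (le_lt_trans Fx)// ltry.
have [Zf fg] : Z f /\ fnorm Z f <= fnorm Z g.
  have [_ iZ' _ _] := iZ; apply: iZ' => //.
  near=> x; have Fx : F x = (f x)%:E by near: x.
  have Gx : G x = (g x)%:E by near: x.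
  have : (F x <= G x)%E by near: x.
  rewrite Fx Gx lee_fin ger0_norm; last by rewrite -lee_fin -Fx.
  by move=> /le_trans; apply; exact: ler_norm.
by rewrite (enormE iZ Zf Ff) lee_fin.
Unshelve. all: by end_near. Qed.

Lemma enormZ_le Z (c : R) F : ideal_space Z -> 0 < c ->
  (enorm Z (fun x => c%:E * F x) <= c%:E * enorm Z F)%E.
Proof.
move=> iZ c0; have [->|] := eqVneq (enorm Z F) +oo%E.
  by rewrite gt0_muley ?leey// lte_fin.
rewrite -ltey => /enorm_mem[f Zf Ff].
have [_ _ hZ _] := iZ; have [Zcf cf] := hZ c f c0 Zf.
rewrite (enormE iZ Zf Ff) (enormE iZ Zcf) ?lee_fin//.
by apply: filterS Ff => x ->; rewrite EFinM.
Qed.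

Lemma absE_measurable f : measurable_fun [set: Rn] f -> measurable_fun [set: Rn] (absE f).
Proof. by move=> mf; apply/measurable_EFinP; exact: measurableT_comp. Qed.

Lemma ideal_absE Z f : ideal_space Z -> measurable_fun [set: Rn] f ->
  (enorm Z (absE f) < +oo)%E -> Z f.
Proof.
move=> iZ mf /enorm_mem[g Zg fg]; have [_ iZ' _ _] := iZ.
apply: (iZ' g f Zg mf _).1; apply: filterS fg => x [->]; exact: ler_norm.
Qed.

Lemma enorm_absE Z f : ideal_space Z -> Z f -> enorm Z (absE f) = enorm Z (EFin \o f).
Proof.
move=> iZ Zf; have [ms iZ' _ _] := iZ; have mf := ms f Zf.
rewrite (enorm_EFin iZ Zf).
have maf : measurable_fun [set: Rn] (fun x => `|f x|) by exact: measurableT_comp.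
have [Zaf le1] : Z (fun x => `|f x|) /\ fnorm Z (fun x => `|f x|) <= fnorm Z f.
  by apply: iZ' => //; apply: aeW => x; rewrite normr_id.
rewrite (enormE iZ Zaf); last exact: aeW.
congr EFin; apply/eqP; rewrite eq_le le1/=.
by apply: (iZ' _ _ Zaf mf _).2; apply: aeW => x; rewrite normr_id.
Qed.

Lemma fatou_enorm Z (F : nat -> Rn -> \bar R) (B : R) : ideal_space Z -> fatou_property Z ->
  (forall k, measurable_fun [set: Rn] (F k)) -> (forall k x, 0 <= F k x)%E ->
  (forall k x, F k x <= F k.+1 x)%E -> (forall k, enorm Z (F k) <= B%:E)%E ->
  (enorm Z (fun x => ereal_sup (range (F ^~ x))) <= B%:E)%E.
Proof.
move=> iZ fZ mF F0 Fnd FB.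
pose f k := fine \o F k.
have Fm k : mem_fspace Z (F k) by apply: enorm_mem; exact: le_lt_trans (FB k) (ltry _).
have Ff k : {ae mu, forall x, F k x = (f k x)%:E}.
  by have [h _ Fh] := Fm k; apply: filterS Fh => x Fx; rewrite /f /= Fx.
have Zf k : Z (f k).
  have [h Zh Fh] := Fm k.
  apply: (ideal_ae_eq iZ Zh _ _).1; first exact: measurableT_comp.
  by apply: filterS Fh => x Fx; rewrite /f /= Fx.
have nf k : (fnorm Z (f k))%:E = enorm Z (F k) by rewrite (enormE iZ (Zf k) (Ff k)).
have supB : (ereal_sup (range (fun k => (fnorm Z (f k))%:E)) <= B%:E)%E.
  by apply: ge_ereal_sup => _ [k _ <-]; rewrite nf.
have [] := fZ f (fun x => ereal_sup (range (F ^~ x))) Zf _ (le_lt_trans supB (ltry _)).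
  apply: filterS (ae_foralln Ff) => x Fx; split.
  - by move=> k; rewrite -lee_fin -Fx.
  - by move=> k; rewrite -lee_fin -!Fx.
  - rewrite [X in X @ _ --> _](_ : _ = F ^~ x); last by apply/funext => k; rewrite Fx.
    apply: ereal_nondecreasing_cvgn; apply/nondecreasing_seqP => k; exact: Fnd.
by move=> _ ->.
Qed.

End ideal_spaces.

Section doubling.
Context {R : realType} {n : nat}.
Local Notation Rn := (n.-tuple R).
Local Notation mu := (lebesgue_Rn R n).
Implicit Types (Z : fspace R n) (rho q C : R).

(** With the number of functions fixed, N = 1 is the scalar bound, so one doubling lemma serves
    scalar and vector-valued bounds. *)
Definition vv_fixed Z rho q C N :=
  forall f : 'I_N -> Rn -> R, (forall j, measurable_fun [set: Rn] (f j)) ->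
  (enorm Z (lq_fin q (fun j => absE (f j))) < +oo)%E -> vv_ineq Z rho q C f.

Lemma absE_ge0 (f : Rn -> R) x : (0 <= absE f x)%E.
Proof. by rewrite lee_fin. Qed.

(** The operator takes real functions: a finite norm makes the maximal functions finite almost
    everywhere, which yields the representatives needed to iterate it. *)
Lemma vv_fixed_step Z rho q C N (f : 'I_N -> Rn -> R) :
  ideal_space Z -> 0 < rho -> 0 < q -> 0 <= C -> vv_fixed Z rho q C N ->
  (forall j, measurable_fun [set: Rn] (f j)) ->
  (enorm Z (lq_fin q (fun j => absE (f j))) < +oo)%E ->
  exists g : 'I_N -> Rn -> R, [/\ forall j, measurable_fun [set: Rn] (g j),
    forall j, {ae mu, forall x, (g j x)%:E = local_maximal rho (f j) x} &
    (enorm Z (lq_fin q (fun j => absE (g j))) <=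
     C%:E * enorm Z (lq_fin q (fun j => absE (f j))))%E].
Proof.
move=> iZ r0 q0 C0 vv mf ff; have := vv f mf ff; rewrite /vv_ineq => h.
have hlt : (enorm Z (lq_fin q (fun j => local_maximal rho (f j))) < +oo)%E.
  by apply: le_lt_trans h _; apply: lte_mul_pinfty.
have [k Zk Fk] := enorm_mem hlt.
exists (fun j => fine \o local_maximal rho (f j)); split.
- move=> j; apply: measurableT_comp => //; exact: measurable_local_maximal.
- move=> j; apply: filterS Fk => x Fx; rewrite /= fineK//.
  rewrite ge0_fin_numE ?local_maximal_ge0//.
  apply: le_lt_trans (le_lq_fin_coord (F := fun j => local_maximal rho (f j)) j q0 _) _.
    by move=> i; exact: local_maximal_ge0.
  by rewrite Fx ltry.
rewrite (@enorm_ae_eq _ _ _ _ (lq_fin q (fun j => local_maximal rho (f j))))//.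
apply: filterS Fk => x Fx; rewrite /lq_fin; congr (_ `^ _)%E; apply: eq_bigr => j _.
congr (_ `^ _)%E; rewrite /absE /=.
have l0 := local_maximal_ge0 (f j) x r0.
rewrite ger0_norm ?fine_ge0// fineK// ge0_fin_numE//.
apply: le_lt_trans (le_lq_fin_coord (F := fun j => local_maximal rho (f j)) j q0 _) _.
  by move=> i; exact: local_maximal_ge0.
by rewrite Fx ltry.
Qed.

(** [local_maximal_double] bounds the operator of scale 2 rho by 6^n times three successive ones of
    scale rho, whence the cube of [C]. *)
Lemma vv_fixed_double Z rho q C N : ideal_space Z -> 0 < rho -> 0 < q -> 0 <= C ->
  vv_fixed Z rho q C N -> vv_fixed Z (2 * rho) q (6 ^+ n * (C * (C * C))) N.
Proof.
move=> iZ r0 q0 C0 vv f mf ff.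
have [g1 [mg1 g1E n1]] := vv_fixed_step iZ r0 q0 C0 vv mf ff.
have ltC x : (x < +oo -> C%:E * x < +oo)%E.
  by move=> x0; apply: lte_mul_pinfty.
have f1 := le_lt_trans n1 (ltC _ ff).
have [g2 [mg2 g2E n2]] := vv_fixed_step iZ r0 q0 C0 vv mg1 f1.
have f2 := le_lt_trans n2 (ltC _ f1).
have n3 := vv g2 mg2 f2.
have l0 (g : 'I_N -> Rn -> R) x j : (0 <= local_maximal rho (g j) x)%E.
  exact: local_maximal_ge0.
have six0 : 0 < 6 ^+ n :> R by rewrite exprn_gt0.
apply: (@le_trans _ _ (enorm Z (fun x => (6 ^+ n)%:E *
    lq_fin q (fun j => local_maximal rho (g2 j)) x))%E).
  apply: le_enorm => //.
  - apply: measurable_lq_fin => j; exact: measurable_local_maximal.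
  - by move=> x; exact: lq_fin_ge0.
  apply: aeW => x; rewrite -lq_finZ ?(ltW six0)//.
  apply: le_lq_fin => // j; first by apply: local_maximal_ge0; rewrite mulr_gt0.
  exact: (local_maximal_double x r0 (mf j) (mg1 j) (mg2 j) (g1E j) (g2E j)).
apply: le_trans (enormZ_le _ iZ six0) _.
rewrite EFinM -muleA; apply: lee_wpmul2l; first by rewrite lee_fin ltW.
rewrite !EFinM -!muleA.
apply: le_trans n3 _; apply: lee_wpmul2l => //.
by apply: le_trans n2 _; apply: lee_wpmul2l.
Qed.

Lemma scalar_bound_vv_fixed Z rho q C : ideal_space Z -> 0 < rho -> 0 < q ->
  scalar_bound Z rho C -> vv_fixed Z rho q C 1.
Proof.
move=> iZ r0 q0 sb f mf; rewrite /vv_ineq.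
have -> : lq_fin q (fun j => absE (f j)) = absE (f ord0).
  by apply/funext => x; rewrite lq_fin1// absE_ge0.
have -> : lq_fin q (fun j => local_maximal rho (f j)) = local_maximal rho (f ord0).
  by apply/funext => x; rewrite lq_fin1// local_maximal_ge0.
move=> ff; have Zf := ideal_absE iZ (mf ord0) ff.
by rewrite enorm_absE//; exact: sb.
Qed.

Lemma vv_fixed_scalar_bound Z rho q C : ideal_space Z -> 0 < rho -> 0 < q ->
  vv_fixed Z rho q C 1 -> scalar_bound Z rho C.
Proof.
move=> iZ r0 q0 vv f Zf; have [ms _ _ _] := iZ.
have := vv (fun=> f) (fun=> ms f Zf); rewrite /vv_ineq.
have -> : lq_fin q (fun j : 'I_1 => absE f) = absE f.
  by apply/funext => x; rewrite lq_fin1// absE_ge0.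
have -> : lq_fin q (fun j : 'I_1 => local_maximal rho f) = local_maximal rho f.
  by apply/funext => x; rewrite lq_fin1// local_maximal_ge0.
by rewrite enorm_absE// => ->//; rewrite enorm_EFin// ltry.
Qed.

Lemma scalar_bound_double Z rho C : ideal_space Z -> 0 < rho -> 0 <= C ->
  scalar_bound Z rho C -> scalar_bound Z (2 * rho) (6 ^+ n * (C * (C * C))).
Proof.
move=> iZ r0 C0 /(scalar_bound_vv_fixed iZ r0 ltr01)/(vv_fixed_double iZ r0 ltr01 C0).
by apply: vv_fixed_scalar_bound; rewrite ?mulr_gt0.
Qed.

Lemma scalar_bound_le Z rho C C' : ideal_space Z -> C <= C' ->
  scalar_bound Z rho C -> scalar_bound Z rho C'.
Proof.
move=> iZ CC sb f Zf; apply: le_trans (sb f Zf) _.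
by apply: lee_wpmul2r; [exact: enorm_ge0|rewrite lee_fin].
Qed.

End doubling.

(** * Sequences and suprema *)

Section sequences_of_functions.
Context {R : realType} {n : nat}.
Local Notation Rn := (n.-tuple R).
Local Notation mu := (lebesgue_Rn R n).
Implicit Types (X : fspace R n) (rho q C : R).

Lemma nneseries_sup (u : nat -> \bar R) : (forall k, 0 <= u k)%E ->
  (\sum_(0 <= j <oo) u j = ereal_sup (range (fun k => \sum_(j < k) u j)))%E.
Proof.
move=> u0; under [in RHS]eq_fun do rewrite -(big_mkord xpredT).
apply/cvg_lim => //; apply: ereal_nondecreasing_cvgn.
by apply/nondecreasing_seqP => k; rewrite big_nat_recr//= leeDl.
Qed.

Lemma lq_seq_sup q (F : nat -> Rn -> \bar R) x : 0 < q -> (forall k, 0 <= F k x)%E ->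
  (lq_seq q F x = ereal_sup (range (fun k => lq_fin q (fun j : 'I_k => F j) x)))%E.
Proof.
move=> q0 F0; have p0 k : (0 <= F k x `^ q)%E by exact: poweR_ge0.
rewrite /lq_seq nneseries_sup//; set S := ereal_sup _.
set T := ereal_sup _.
have S0 : (0 <= S)%E.
  by apply: ereal_sup_ubound; exists 0%N => //; rewrite big_ord0.
apply/eqP; rewrite eq_le; apply/andP; split; last first.
  apply: ge_ereal_sup => _ [k _ <-]; apply: le_poweR.
  - by rewrite invr_ge0 ltW.
  - exact: sume_ge0.
  - by apply: ereal_sup_ubound; exists k.
have T0 : (0 <= T)%E.
  apply: le_ereal_sup_tmp; exists (lq_fin q (fun j : 'I_0 => F j) x); first by exists 0%N.
  exact: lq_fin_ge0.
rewrite -[leRHS](poweRKV q0)//; apply: le_poweR; rewrite ?invr_ge0 ?(ltW q0)//.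
apply: ge_ereal_sup => _ [k _ <-].
rewrite -[leLHS](poweRVK q0) ?sume_ge0//; apply: le_poweR.
- exact: ltW.
- exact: poweR_ge0.
- by apply: ereal_sup_ubound; exists k.
Qed.

Definition extend0 N (f : 'I_N -> Rn -> R) (j : nat) : Rn -> R :=
  if insub j is Some i then f i else fun=> 0.

Lemma extend0E N (f : 'I_N -> Rn -> R) (i : 'I_N) : extend0 f i = f i.
Proof. by rewrite /extend0 valK. Qed.

Lemma extend0_out N (f : 'I_N -> Rn -> R) j : (N <= j)%N -> extend0 f j = fun=> 0.
Proof. by move=> Nj; rewrite /extend0 insubN// -leqNgt. Qed.

Lemma measurable_extend0 N (f : 'I_N -> Rn -> R) :
  (forall j, measurable_fun [set: Rn] (f j)) ->
  forall j, measurable_fun [set: Rn] (extend0 f j).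
Proof. by move=> mf j; rewrite /extend0; case: insubP. Qed.

Lemma lq_seq_extend0 q N (f : 'I_N -> Rn -> R) (T : (Rn -> R) -> Rn -> \bar R) x :
  0 < q -> T (fun=> 0) x = 0%E ->
  lq_seq q (fun j => T (extend0 f j)) x = lq_fin q (fun j => T (f j)) x.
Proof.
move=> q0 T0; rewrite /lq_seq /lq_fin; congr (_ `^ _)%E.
apply: lim_near_cst => //; near=> k.
have Nk : (N <= k)%N by near: k; exists N.
rewrite (big_cat_nat _ Nk)//= [X in (_ + X)%E]big1_seq ?adde0; last first.
  move=> j /andP[_]; rewrite mem_index_iota => /andP[Nj _].
  by rewrite extend0_out// T0 poweR0r// gt_eqF.
by rewrite big_mkord; apply: eq_bigr => j _; rewrite extend0E.
Unshelve. all: by end_near. Qed.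

Lemma sup_seq_extend0 N (f : 'I_N -> Rn -> R) (T : (Rn -> R) -> Rn -> \bar R) x :
  (forall f, 0 <= T f x)%E -> T (fun=> 0) x = 0%E ->
  sup_seq (fun j => T (extend0 f j)) x = max_fin (fun j => T (f j)) x.
Proof.
move=> Tge0 T0; rewrite /sup_seq /max_fin; apply/eqP; rewrite eq_le; apply/andP; split.
  apply: ge_ereal_sup => _ [j _ <-]; have [Nj|jN] := leqP N j.
    rewrite extend0_out// T0; elim/big_ind: _ => // y z y0 z0.
    by rewrite le_max y0.
  have -> : extend0 f j = f (Ordinal jN) by rewrite -[RHS]extend0E.
  exact: (le_bigmax_cond _ (fun j => T (f j) x)).
elim/big_ind: _ => [|y z yS zS|j _].
- apply: le_ereal_sup_tmp; exists (T (extend0 f N) x); first by exists N.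
  exact: Tge0.
- by rewrite ge_max yS.
- by apply: ereal_sup_ubound; exists j => //=; rewrite extend0E.
Qed.

Lemma vv_finite_sequence X rho q C : ideal_space X -> fatou_property X ->
  0 < rho -> 0 < q -> 0 <= C -> vv_finite X rho q C -> vv_sequence X rho q C.
Proof.
move=> iX fX r0 q0 C0 vv f mf Gm.
have [g Xg Gg] := Gm.
have EG := enormE iX Xg Gg; rewrite EG -EFinM.
set F := fun j => local_maximal rho (f j).
have F0 j x : (0 <= F j x)%E by exact: local_maximal_ge0.
have -> : lq_seq q F = fun x => ereal_sup (range (fun k => lq_fin q (fun j : 'I_k => F j) x)).
  by apply/funext => x; rewrite lq_seq_sup.
apply: (fatou_enorm (F := fun k => lq_fin q (fun j : 'I_k => F j))) => //.
- move=> k; apply: measurable_lq_fin => j; exact: measurable_local_maximal.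
- by move=> k x; exact: lq_fin_ge0.
- move=> k x; apply: le_poweR.
  + by rewrite invr_ge0 ltW.
  + by apply: sume_ge0 => j _; exact: poweR_ge0.
  + by rewrite big_ord_recr/= leeDl// poweR_ge0.
move=> k.
have le1 : (enorm X (lq_fin q (fun j : 'I_k => absE (f j))) <= (fnorm X g)%:E)%E.
  rewrite -EG; apply: le_enorm => //.
  - by apply: measurable_lq_fin => j; exact: absE_measurable.
  - by move=> x; exact: lq_fin_ge0.
  - apply: aeW => x; rewrite lq_seq_sup//; last by move=> j; exact: absE_ge0.
    by apply: ereal_sup_ubound; exists k.
apply: le_trans (vv k (fun j => f j) (fun j => mf j) (le_lt_trans le1 (ltry _))) _.
by rewrite EFinM; apply: lee_wpmul2l.
Qed.

Lemma vv_sequence_finite X rho q C : 0 < rho -> 0 < q ->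
  vv_sequence X rho q C -> vv_finite X rho q C.
Proof.
move=> r0 q0 vv N f mf ff; rewrite /vv_ineq.
have := vv (extend0 f) (measurable_extend0 mf).
have -> : lq_seq q (fun j => absE (extend0 f j)) = lq_fin q (fun j => absE (f j)).
  apply/funext => x; apply: (@lq_seq_extend0 q N f absE x) => //.
  by rewrite /absE normr0.
have -> : lq_seq q (fun j => local_maximal rho (extend0 f j)) =
    lq_fin q (fun j => local_maximal rho (f j)).
  apply/funext => x; apply: (@lq_seq_extend0 q N f (local_maximal rho) x) => //.
  exact: local_maximal0.
by apply; exact: enorm_mem.
Qed.

Lemma measurable_sup_seq (F : nat -> Rn -> \bar R) :
  (forall k, measurable_fun [set: Rn] (F k)) -> measurable_fun [set: Rn] (sup_seq F).
Proof.
move=> mF; have := measurable_fun_esups mF 0%N; congr (measurable_fun _ _).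
apply/funext => x; congr ereal_sup; apply/seteqP.
by split=> [_ [k _ <-]|_ [k _ <-]]; exists k.
Qed.

Lemma scalar_sup_bound X rho C : ideal_space X -> 0 < rho ->
  scalar_bound X rho C -> sup_bound X rho C.
Proof.
move=> iX r0 sb f mf [h Xh Fh].
have [ms _ _ _] := iX.
rewrite (enorm_ae_eq X Fh); apply: le_trans (sb h Xh).
apply: le_enorm => //.
- by apply: measurable_sup_seq => k; exact: measurable_local_maximal.
- move=> x; apply: le_ereal_sup_tmp; exists (local_maximal rho (f 0%N) x).
    by exists 0%N.
  exact: local_maximal_ge0.
apply: aeW => x; apply: ge_ereal_sup => _ [k _ <-].
apply: le_local_maximal => //; first exact: ms.
apply: filterS Fh => y Fy; rewrite -lee_fin.
apply: (@le_trans _ _ (h y)%:E); last by rewrite lee_fin ler_norm.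
by rewrite -Fy; apply: ereal_sup_ubound; exists k.
Qed.

Lemma sup_max_bound X rho C : 0 < rho -> sup_bound X rho C -> max_bound X rho C.
Proof.
move=> r0 sb N f mf; have := sb (extend0 f) (measurable_extend0 mf).
have -> : sup_seq (fun j => absE (extend0 f j)) = max_fin (fun j => absE (f j)).
  apply/funext => x; apply: (sup_seq_extend0 f (T := absE)).
    by move=> g; exact: absE_ge0.
  by rewrite /absE normr0.
have -> : sup_seq (fun j => local_maximal rho (extend0 f j)) =
    max_fin (fun j => local_maximal rho (f j)).
  apply/funext => x; apply: (sup_seq_extend0 f (T := local_maximal rho)).
    by move=> g; exact: local_maximal_ge0.
  exact: local_maximal0.
by [].
Qed.

Lemma max_scalar_bound X rho C : ideal_space X -> 0 < rho ->
  max_bound X rho C -> scalar_bound X rho C.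
Proof.
move=> iX r0 mb f Xf; have [ms _ _ _] := iX.
have := mb 1%N (fun=> f) (fun=> ms f Xf).
have -> : max_fin (fun _ : 'I_1 => absE f) = absE f.
  apply/funext => x; rewrite /max_fin big_ord_recl big_ord0 max_l//.
  exact: absE_ge0.
have -> : max_fin (fun _ : 'I_1 => local_maximal rho f) = local_maximal rho f.
  apply/funext => x; rewrite /max_fin big_ord_recl big_ord0 max_l//.
  exact: local_maximal_ge0.
rewrite enorm_absE//; apply; exists (fun x => `|f x|); last exact: aeW.
have [_ iX' _ _] := iX; apply: (iX' f _ Xf _ _).1.
  by apply: measurableT_comp => //; exact: ms.
by apply: aeW => x; rewrite normr_id.
Qed.

End sequences_of_functions.

(** * Exponents at most one *)

Section slabs.
Context {R : realType} {n : nat} (hn : (0 < n)%N).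
Local Notation Rn := (n.-tuple R).
Local Notation mu := (lebesgue_Rn R n).
Variables (s : R) (N : nat).
Hypotheses (s0 : 0 < s) (N0 : (0 < N)%N).

Local Notation i0 := (Ordinal hn).
Let d : R := s / N%:R.
Let NR : 0 < N%:R :> R. Proof. by rewrite ltr0n. Qed.
Let d0 : 0 < d. Proof. by rewrite divr_gt0. Qed.
Let dN : d * N%:R = s. Proof. by rewrite mulfVK// gt_eqF. Qed.

(* The maximal function of the [m]-th slab is at least [1 / (m - i + 2)] on the
   [i]-th strip, [i <= m], so that these functions have a divergent sum, whereas
   the indicators of the slabs add up to at most [1]. *)
Definition slab (k : nat) : set Rn :=
  box (fun i => if i == i0 then `[d * k%:R, d * k.+1%:R[%classic
                else `]- s, 2 * s[%classic).

Definition strip (k : nat) : set Rn :=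
  box (fun i => if i == i0 then `[d * k%:R, d * k.+1%:R[%classic
                else `]0, s[%classic).

Lemma measurable_slab k : measurable (slab k).
Proof. by apply: measurable_box => i; case: ifP. Qed.

Lemma measurable_strip k : measurable (strip k).
Proof. by apply: measurable_box => i; case: ifP. Qed.

Lemma lebesgue_d k : lebesgue_measure (`[d * k%:R, d * k.+1%:R[%classic : set R) = d%:E.
Proof.
have dk : d * k.+1%:R = d * k%:R + d by rewrite -natr1; ring.
by rewrite lebesgue_measure_itv/= lte_fin dk ltrDl d0 -EFinB addrAC subrr add0r.
Qed.

Lemma lebesgue_slab k : mu (slab k) = (d * \prod_(i | i != i0) (3 * s))%:E.
Proof.
rewrite (@lebesgue_box _ _ _ (fun i => if i == i0 then d else 3 * s)).
- rewrite (bigD1 i0)//=; congr (_ * _)%:E.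
  by apply: eq_bigr => i /negbTE ->.
- by move=> i; case: ifP.
- move=> i; case: ifP => _; first exact: lebesgue_d.
  have h : - s < 2 * s by move: s0; lra.
  by rewrite lebesgue_measure_itv/= lte_fin h -EFinB; congr EFin; lra.
Qed.

Lemma lebesgue_strip k : mu (strip k) = (d * \prod_(i | i != i0) s)%:E.
Proof.
rewrite (@lebesgue_box _ _ _ (fun i => if i == i0 then d else s)).
- rewrite (bigD1 i0)//=; congr (_ * _)%:E.
  by apply: eq_bigr => i /negbTE ->.
- by move=> i; case: ifP.
- move=> i; case: ifP => _; first exact: lebesgue_d.
  by rewrite lebesgue_measure_itv/= lte_fin s0 -EFinB subr0.
Qed.

Lemma itv_d_inj (y : R) j k : d * j%:R <= y < d * j.+1%:R ->
  d * k%:R <= y < d * k.+1%:R -> j = k.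
Proof.
move=> /andP[j1 j2] /andP[k1 k2]; apply/eqP; rewrite eqn_leq -(ltnS j k) -(ltnS k j).
rewrite -!(ltr_nat R) -(ltr_pM2l d0) (le_lt_trans j1 k2)/=.
by rewrite -(ltr_pM2l d0) (le_lt_trans k1 j2).
Qed.

Lemma slab_inj x j k : slab j x -> slab k x -> j = k.
Proof.
move=> /(_ i0); rewrite eqxx /= in_itv/= => hj /(_ i0); rewrite eqxx /= in_itv/=.
exact: itv_d_inj.
Qed.

Lemma strip_inj x j k : strip j x -> strip k x -> j = k.
Proof.
move=> /(_ i0); rewrite eqxx /= in_itv/= => hj /(_ i0); rewrite eqxx /= in_itv/=.
exact: itv_d_inj.
Qed.

Lemma local_maximal_slab x i m : strip i x -> (i <= m)%N -> (m - i < N)%N ->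
  (((m - i).+2%:R^-1)%:E <= local_maximal (2 * s) (\1_(slab m) : Rn -> R) x)%E.
Proof.
move=> sx im miN; have s1 := s0; have d1 := d0.
pose t := (m - i)%N; have mE : m = (i + t)%N by rewrite subnKC.
have mR : m%:R = i%:R + t%:R :> R by rewrite mE natrD.
pose l := d * t.+2%:R.
have tR : t.+2%:R = t%:R + 2 :> R by rewrite -2!natr1; ring.
have t0 : 0 <= t%:R :> R by [].
have dt : 0 <= d * t%:R by rewrite mulr_ge0// ltW.
have tN : t%:R + 1 <= N%:R :> R by rewrite natr1 ler_nat.
have N1 : 1 <= N%:R :> R by rewrite ler1n.
have l0 : 0 < l by rewrite mulr_gt0.
have ls : l <= 2 * s by rewrite /l tR -dN mulrCA ler_pM2l//; lra.
have x0 := sx i0; rewrite eqxx /= in_itv/= -natr1 in x0.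
have xj j : j != i0 -> 0 < tnth x j < s.
  by move=> /negbTE ji; have := sx j; rewrite ji /= in_itv.
(* In direction [i0] the cube runs from d (i - 1) to d (m + 1). It starts one step early so that
   [x], whose coordinate may be d i, is interior, and it contains the full thickness of the slab. In
   the other directions it stays in ]-s, 2s[ because l <= 2s. The slab thus fills the fraction d / l
   of it. *)
pose a : Rn := [tuple if j == i0 then d * (i%:R - 1) else tnth x j - l / 2 | j < n].
have ax : cube a l x.
  move=> j; rewrite tnth_mktuple; case: eqP => [->|_]; last by lra.
  by rewrite /l tR; move: x0 => /andP[? ?]; apply/andP; split; lra.
have lr : 0 < l <= 2 * s by rewrite l0.
apply: le_trans (local_maximal_ge (\1_(slab m)) lr ax).
pose B := fun j => if j == i0 then `]d * m%:R, d * m%:R + d[%classic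
  else `]tnth x j - l / 2, tnth x j + l / 2[%classic.
have mB : measurable (box B) by apply: measurable_box => j; rewrite /B; case: ifP.
have muB : mu (box B) = (d * \prod_(j | j != i0) l)%:E.
  rewrite (@lebesgue_box _ _ _ (fun j => if j == i0 then d else l)).
  - rewrite (bigD1 i0)//=; congr (_ * _)%:E.
    by apply: eq_bigr => j /negbTE ->.
  - by move=> j; rewrite /B; case: ifP.
  - move=> j; rewrite /B; case: ifP => _; rewrite lebesgue_measure_itv/= lte_fin.
      by rewrite ltrDl d0 -EFinB addrAC subrr add0r.
    have -> : tnth x j - l / 2 < tnth x j + l / 2 by lra.
    by rewrite -EFinB; congr EFin; lra.
have Bs : box B `<=` slab m `&` cube a l.
  move=> y By; split=> j; have := By j; rewrite /B.
    case: eqP => [_|/eqP ji] /=; rewrite !in_itv/=.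
      by rewrite -natr1 mulrDr mulr1 => /andP[/ltW -> ->].
    by have := xj j ji; lra.
  rewrite tnth_mktuple; case: eqP => [_|_] /=; rewrite in_itv/=; last by lra.
  by rewrite /l tR mR; move=> /andP[? ?]; apply/andP; split; lra.
have -> : (t.+2%:R^-1)%:E = (((l ^+ n)^-1)%:E * mu (box B))%E.
  rewrite muB -EFinM; congr EFin.
  have -> : l ^+ n = l * \prod_(j < n | j != i0) l.
    have -> : l ^+ n = \prod_(j < n) l by rewrite prodr_const card_ord.
    by rewrite (bigD1 i0).
  have p0 : \prod_(j < n | j != i0) l != 0 by rewrite gt_eqF// prodr_gt0.
  move: (\prod_(j < n | j != i0) l) p0 => Q Q0.
  have t2 : t%:R + 2 != 0 :> R by rewrite gt_eqF//; lra.
  by rewrite /l tR; field; rewrite Q0 t2 gt_eqF.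
apply: lee_wpmul2l; first by rewrite lee_fin invr_ge0 exprn_ge0// ltW.
under eq_integral do rewrite ger0_norm//.
rewrite integral_indic; [|exact: measurable_cube|exact: measurable_slab].
apply: le_measure => //; rewrite inE//.
by apply: measurableI; [exact: measurable_slab|exact: measurable_cube].
Qed.

End slabs.

(** These are the partial sums of the harmonic series without its first term. *)
Lemma harmonic_unbounded {R : realType} (M : R) :
  exists2 N, (0 < N)%N & M < \sum_(k < N) k.+2%:R^-1.
Proof.
apply: contrapT => h; apply: (@dvg_harmonic R).
apply: nondecreasing_is_cvgn.
  by apply: nondecreasing_series => i _ _; rewrite harmonic_ge0.
have M0 : 0 <= M.
  rewrite leNgt; apply/negP => M0; apply: h; exists 1%N => //.
  by apply: lt_le_trans M0 _; rewrite sumr_ge0// => i _; rewrite invr_ge0.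
exists (M + 1) => _ [[|m] _ <-].
  by rewrite /series/= big_geq//; lra.
rewrite /series/= big_mkord big_ord_recl/= invr1 addrC lerD2r.
case: m => [|m]; first by rewrite big_ord0.
by rewrite leNgt; apply/negP => hM; apply: h; exists m.+1.
Qed.

Section no_bound_below_one.
Context {R : realType} {n : nat}.
Local Notation Rn := (n.-tuple R).
Local Notation mu := (lebesgue_Rn R n).

Lemma ball_bounded (r : R) (x : Rn) : 0 < r -> (forall i, `|tnth x i| < r) ->
  Rn_ball [tuple 0 | i < n] (r * n.+1%:R) x.
Proof.
move=> r0 xr; rewrite /Rn_ball /= exprMn.
apply: (@le_lt_trans _ _ (\sum_(i < n) r ^+ 2)).
  apply: ler_sum => i _; rewrite tnth_mktuple subr0 -real_normK ?num_real//.
  by rewrite ler_sqr ?nnegrE ?(ltW r0)// ltW// xr.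
rewrite sumr_const card_ord -[ltLHS]mulr_natr ltr_pM2l ?exprn_gt0//.
rewrite -natrX ltr_nat; nia.
Qed.

Lemma vv_finite_gt1 (hn : (0 < n)%N) (rho q : R) (Y : fspace R n) : 0 < rho ->
  0 < q <= 1 -> ball_quasi_Banach Y -> ~ exists C : R, vv_finite Y rho q C.
Proof.
move=> r0 /andP[q0 q1] [[K qY] _ iY _ bY] [C' vv'].
have iZ := quasi_normed_ideal_space qY iY.
have [C C0 vv] : exists2 C, 0 <= C & vv_finite Y rho q C.
  exists (Num.max 0 C'); first by rewrite le_max lexx.
  move=> N f mf ff; apply: le_trans (vv' N f mf ff) _.
  by apply: lee_wpmul2r; rewrite ?enorm_ge0// lee_fin le_max lexx orbT.
clear C' vv'.
have [s s0 rs] : exists2 s, 0 < s & rho = 2 * s by exists (rho / 2); lra.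
subst rho.
pose i0 := Ordinal hn.
pose Z : set Rn := box (fun i => if i == i0 then `[0, s[%classic else `]0, s[%classic).
pose P : set Rn := Rn_ball [tuple 0 | i < n] (3 * s * n.+1%:R).
have YP : Y \1_P by apply: bY; rewrite !mulr_gt0.
have mZ : measurable Z by apply: measurable_box => i; case: ifP.
have ZP : Z `<=` P.
  move=> x Zx; apply: ball_bounded; first by rewrite mulr_gt0.
  move=> i; have := Zx i; rewrite ltr_norml.
  by case: ifP => _ /=; rewrite in_itv/=; lra.
have mIZ : measurable_fun [set: Rn] (\1_Z : Rn -> R) by exact: measurable_indic.
have [YZ _] : Y \1_Z /\ fnorm Y \1_Z <= fnorm Y \1_P.
  apply: iY => //; apply: aeW => x; rewrite !ger0_norm// !indicE.
  have [xZ|_] := boolP (x \in Z); last by case: (x \in P).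
  by rewrite mem_set//; apply: ZP; rewrite inE in xZ.
have Z0 : 0 < fnorm Y \1_Z.
  rewrite lt_neqAle (qn_norm_ge0 qY YZ) andbT eq_sym; apply/eqP => /(qn_norm_eq0 qY YZ).
  move=> [E [mE E0 EZ]].
  have : (mu Z <= mu E)%E.
    apply: le_measure; rewrite ?inE// => x Zx; apply: EZ => /=.
    by rewrite indicE mem_set// => /eqP; rewrite oner_eq0.
  rewrite E0 /Z (@lebesgue_box _ _ _ (fun=> s)).
  - by rewrite lee_fin prodr_const leNgt exprn_gt0.
  - by move=> i; case: ifP.
  - by move=> i; case: ifP => _; rewrite lebesgue_measure_itv/= lte_fin s0 -EFinB subr0.
(* The 1 guarantees c^q <= c for q <= 1; the other bound contradicts the inequality in the end. *)
have [N N0 hN] := harmonic_unbounded (Num.max 1 (C * fnorm Y \1_P / fnorm Y \1_Z)).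
set c := \sum_(_ < N) _ in hN.
have c1 : 1 <= c by rewrite ltW// (le_lt_trans _ hN)// le_max lexx.
have cP : C * fnorm Y \1_P < c * fnorm Y \1_Z.
  by rewrite -ltr_pdivrMr// (le_lt_trans _ hN)// le_max lexx orbT.
(* With twice as many slabs as strips over [Z], the strip of index k sees N slabs, those of indices
   k to k + N - 1. *)
pose f (j : 'I_(N + N)) : Rn -> R := \1_(slab hn s N j).
have mf j : measurable_fun [set: Rn] (f j).
  by apply: measurable_indic; exact: measurable_slab.
have NR : 0 < N%:R :> R by rewrite ltr0n.
have slabP (j : 'I_(N + N)) : slab hn s N j `<=` P.
  move=> x sx; apply: ball_bounded; first by rewrite mulr_gt0.
  move=> i; have := sx i; rewrite ltr_norml; case: ifP => _ /=; rewrite in_itv/=; last by lra.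
  move=> /andP[x1 x2].
  have h1 : 0 <= s / N%:R * j%:R by rewrite mulr_ge0// divr_ge0// ltW.
  have h2 : s / N%:R * j.+1%:R <= 2 * s.
    rewrite mulrAC ler_pdivrMr// [2 * s]mulrC -mulrA ler_pM2l//.
    by rewrite -natrM ler_nat mul2n -addnn.
  by lra.
have GP : (enorm Y (lq_fin q (fun j => absE (f j))) <= (fnorm Y \1_P)%:E)%E.
  rewrite -(enorm_EFin iZ YP); apply: le_enorm => //.
  - by apply: measurable_lq_fin => j; exact: absE_measurable.
  - by move=> x; exact: lq_fin_ge0.
  apply: aeW => x; have [[j sx]|nsx] := pselect (exists j : 'I_(N + N), slab hn s N j x).
    rewrite /lq_fin (bigD1 j)//= big1 ?adde0.
      rewrite /absE /f !indicE !mem_set//; last exact: slabP sx.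
      by rewrite normr1 powR1 poweR1r.
    move=> k kj; rewrite /f indicE memNset ?normr0 ?powR0 ?gt_eqF// => sk.
    by case/eqP: kj; apply/val_inj; exact: slab_inj sk sx.
  rewrite /lq_fin big1 ?poweR0r ?gt_eqF ?invr_gt0 ?lee_fin//.
  move=> k _; rewrite /absE /f indicE memNset ?normr0 ?poweR0r ?gt_eqF// => sk.
  by apply: nsx; exists k.
have := vv _ f mf (le_lt_trans GP (ltry _)); rewrite /vv_ineq => hv.
have lm0 (g : Rn -> R) x : (0 <= local_maximal (2 * s) g x)%E.
  by apply: local_maximal_ge0.
have low x : (c%:E * (\1_Z x)%:E <= lq_fin q (fun j => local_maximal (2 * s) (f j)) x)%E.
  rewrite indicE; have [|_] := boolP (x \in Z); last by rewrite mule0 lq_fin_ge0.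
  rewrite inE mule1 => Zx; rewrite /lq_fin.
  have := Zx i0; rewrite eqxx /= in_itv/= => /andP[x1 x2].
  pose k := Num.truncn (tnth x i0 * N%:R / s).
  have y0 : 0 <= tnth x i0 * N%:R / s by rewrite divr_ge0 ?mulr_ge0// ltW.
  have /andP[k1 k2] := truncn_itv y0; rewrite -/k in k1 k2.
  rewrite ler_pdivlMr// in k1; rewrite ltr_pdivrMr// in k2.
  have kN : (k < N)%N.
    by rewrite -(ltr_nat R) -(ltr_pM2r s0) (le_lt_trans k1)// mulrC ltr_pM2l.
  have sx : strip hn s N k x.
    move=> i; have := Zx i; rewrite -/i0; case: eqP => [->|//] _ /=.
    rewrite in_itv/=; apply/andP; split.
      by rewrite mulrAC ler_pdivrMr// mulrC.
    by rewrite mulrAC ltr_pdivlMr// [s * _]mulrC.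
  have -> : (c%:E = (c%:E `^ q) `^ q^-1)%E by rewrite poweRKV// lee_fin; lra.
  apply: le_poweR; [by rewrite invr_ge0 ltW|exact: poweR_ge0|].
  apply: (@le_trans _ _ c%:E).
    by rewrite poweR_EFin lee_fin; apply: ler1_powR.
  rewrite /c -sumEFin.
  pose sh (t : 'I_N) : 'I_(N + N) := Ordinal (leq_add kN (ltnW (ltn_ord t)) : (k + t < N + N)%N).
  apply: (@le_trans _ _ (\sum_(t < N) local_maximal (2 * s) (f (sh t)) x `^ q)%E).
    apply: lee_sum => t _.
    have : ((t.+2%:R^-1)%:E <= local_maximal (2 * s) (f (sh t)) x)%E.
      have := @local_maximal_slab _ _ hn s N s0 N0 x k (k + t) sx (leq_addr _ _).
      by rewrite addKn => /(_ (ltn_ord t)).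
    move=> /(le_poweR (ltW q0)); rewrite lee_fin invr_ge0 ler0n => /(_ isT).
    apply: le_trans; rewrite poweR_EFin lee_fin; apply: ger1_powR => //.
    by rewrite invr_gt0 ltr0n/= invf_le1 ?ltr0n// ler1n.
  rewrite -(big_map sh xpredT (fun j => local_maximal (2 * s) (f j) x `^ q)%E)/=.
  have shi : injective sh by move=> t t' /(congr1 val)/= /addnI; exact: val_inj.
  rewrite (_ : (\sum_(j < N + N) _)%E =
    (\sum_(j <- enum 'I_(N + N)) local_maximal (2 * s) (f j) x `^ q)%E); last first.
    by rewrite big_enum.
  rewrite big_uniq ?map_inj_uniq ?index_enum_uniq//= [leRHS]big_enum/= [leLHS]big_mkcond/=.
  by apply: lee_sum => j _; case: ifP => // _; exact: poweR_ge0.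
have : (enorm Y (EFin \o (fun x : Rn => (c * \1_Z x)%R)) <= C%:E * (fnorm Y \1_P)%:E)%E.
  apply: le_trans (_ : _ <= enorm Y (lq_fin q (fun j => local_maximal (2 * s) (f j))))%E _.
    apply: le_enorm => //.
    - by apply/measurable_EFinP; exact: measurable_funM.
    - by move=> x; rewrite lee_fin mulr_ge0//; lra.
    - by apply: aeW => x; rewrite /= EFinM; exact: low.
  by apply: le_trans hv _; apply: lee_wpmul2l; rewrite ?lee_fin.
rewrite (enorm_EFin iZ (qn_memZ qY c YZ)) (qn_normZ qY c YZ) ger0_norm; last by lra.
by rewrite -EFinM lee_fin leNgt cP.
Qed.

End no_bound_below_one.

(** * Associate spaces and the space of bounded functions *)

Section kothe_space.
Context {R : realType} {n : nat}.
Local Notation Rn := (n.-tuple R).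
Local Notation mu := (lebesgue_Rn R n).
Implicit Types (X : fspace R n).

Lemma kothe_norm_ge0 K X g : quasi_normed K X -> (0 <= kothe_norm X g)%E.
Proof.
move=> qX; apply: le_ereal_sup_tmp; exists 0%E => //; exists (cst 0).
  split; first exact: qn_mem0 qX.
  have /(qn_norm_eq0 qX (qn_mem0 qX)) -> // : {ae mu, forall x, cst 0 x = 0 :> R}.
  exact: aeW.
by rewrite integral0_eq// => x _; rewrite mul0r normr0.
Qed.

Lemma kothe_ideal_space K X : quasi_normed K X -> ideal_space (kothe X).
Proof.
move=> qX; have k0 g := kothe_norm_ge0 g qX.
have mle (f g : Rn -> R) : measurable_fun [set: Rn] f -> measurable_fun [set: Rn] g ->
    {ae mu, forall x, `|g x| <= `|f x|} -> (kothe_norm X g <= kothe_norm X f)%E.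
  move=> mf mg gf; apply: ge_ereal_sup => _ [h [Xh h1] <-].
  have mh := qn_measurable qX Xh.
  apply: (@le_trans _ _ (\int[mu]_x `|h x * f x|%:E)%E); last first.
    by apply: ereal_sup_ubound; exists h.
  apply: ae_ge0_le_integral => //; try by apply/measurable_EFinP;
    apply: measurableT_comp => //; exact: measurable_funM.
  by apply: filterS gf => x gx _; rewrite lee_fin !normrM ler_wpM2l.
split.
- by move=> f [].
- move=> f g [mf kf] mg gf; have le1 := mle f g mf mg gf.
  have kg := le_lt_trans le1 kf.
  by split; [split|apply: fine_le => //; rewrite ge0_fin_numE].
- move=> c f c0 [mf kf].
  have mcf : measurable_fun [set: Rn] (fun x => c * f x) by exact: measurable_funM.
  have le1 : (kothe_norm X (fun x => (c * f x)%R) <= c%:E * kothe_norm X f)%E.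
    apply: ge_ereal_sup => _ [h [Xh h1] <-].
    have mh := qn_measurable qX Xh.
    have mhf : measurable_fun [set: Rn] (fun x => `|h x * f x|%:E).
      by apply/measurable_EFinP; apply: measurableT_comp => //; exact: measurable_funM.
    rewrite (eq_integral (fun x => c%:E * `|h x * f x|%:E)%E); last first.
      by move=> x _; rewrite mulrCA normrM gtr0_norm// EFinM.
    rewrite ge0_integralZl//; last by rewrite lee_fin ltW.
    apply: lee_wpmul2l; first by rewrite lee_fin ltW.
    by apply: ereal_sup_ubound; exists h.
  have fin : (c%:E * kothe_norm X f < +oo)%E.
    by apply: lte_mul_pinfty => //; rewrite lee_fin ltW.
  split; first by split => //; exact: le_lt_trans le1 fin.
  rewrite -lee_fin EFinM /= !fineK// ge0_fin_numE//.
  exact: le_lt_trans le1 fin.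
- by move=> f [mf kf]; exact: fine_ge0.
Qed.

End kothe_space.

Section Linfty.
Context {R : realType} {n : nat}.
Local Notation Rn := (n.-tuple R).
Local Notation mu := (lebesgue_Rn R n).
Implicit Types (f g : Rn -> R) (M : R).

Definition Linf : fspace R n := FSpace
  (fun f => measurable_fun [set: Rn] f /\ exists M, {ae mu, forall x, `|f x| <= M})
  (fun f => inf [set M | 0 <= M /\ {ae mu, forall x, `|f x| <= M}]).

Lemma Linf_set_lbound f : has_lbound [set M | 0 <= M /\ {ae mu, forall x, `|f x| <= M}].
Proof. by exists 0 => M []. Qed.

Lemma Linf_norm_le f M : 0 <= M -> {ae mu, forall x, `|f x| <= M} -> fnorm Linf f <= M.
Proof. by move=> M0 fM; apply: ge_inf; [exact: Linf_set_lbound|split]. Qed.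

Lemma Linf_has_inf f : Linf f -> has_inf [set M | 0 <= M /\ {ae mu, forall x, `|f x| <= M}].
Proof.
move=> [_ [M fM]]; split; last exact: Linf_set_lbound.
exists `|M|; split => //; apply: filterS fM => x /le_trans; apply; exact: ler_norm.
Qed.

Lemma Linf_norm_ge0 f : Linf f -> 0 <= fnorm Linf f.
Proof. by move=> /Linf_has_inf[h _]; apply: lb_le_inf => // M []. Qed.

Lemma Linf_ae f : Linf f -> {ae mu, forall x, `|f x| <= fnorm Linf f}.
Proof.
move=> Lf; have hi := Linf_has_inf Lf.
have h k : {ae mu, forall x, `|f x| <= fnorm Linf f + k.+1%:R^-1}.
  have k0 : 0 < k.+1%:R^-1 :> R by rewrite invr_gt0.
  have [M [M0 fM] Mlt] := inf_adherent k0 hi.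
  by apply: filterS fM => x /le_trans; apply; exact: ltW.
apply: filterS (ae_foralln h) => x fx; apply/ler_addgt0Pr => eps eps0.
apply: le_trans (fx (Num.truncn eps^-1)) _; rewrite lerD2l.
by rewrite -[leRHS]invrK lef_pV2 ?posrE ?invr_gt0// ltW// truncnS_gt.
Qed.

Lemma Linf_intro f M : measurable_fun [set: Rn] f -> 0 <= M ->
  {ae mu, forall x, `|f x| <= M} -> Linf f /\ fnorm Linf f <= M.
Proof. by move=> mf M0 fM; split; [split => //; exists M|exact: Linf_norm_le]. Qed.

Lemma Linf_quasi_normed : quasi_normed 1 Linf.
Proof.
have LZ c f : Linf f -> Linf (fun x => c * f x) /\
    fnorm Linf (fun x => c * f x) <= `|c| * fnorm Linf f.
  move=> Lf; apply: Linf_intro.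
  - by case: Lf => mf _; exact: measurable_funM.
  - by rewrite mulr_ge0// Linf_norm_ge0.
  - by apply: filterS (Linf_ae Lf) => x fx; rewrite normrM ler_wpM2l.
have LD f g : Linf f -> Linf g -> Linf (f \+ g) /\
    fnorm Linf (f \+ g) <= fnorm Linf f + fnorm Linf g.
  move=> Lf Lg; apply: Linf_intro.
  - by case: Lf Lg => mf _ [mg _]; exact: measurable_funD.
  - by rewrite addr_ge0 ?Linf_norm_ge0.
  - apply: filterS2 (Linf_ae Lf) (Linf_ae Lg) => x fx gx.
    by apply: le_trans (ler_normD _ _) _; exact: lerD.
split.
- by move=> f [].
- apply: (Linf_intro (M := 0) _ _ _).1 => //.
  by apply: aeW => x; rewrite normr0.
- by move=> f g Lf Lg; exact: (LD f g Lf Lg).1.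
- by move=> c f Lf; exact: (LZ c f Lf).1.
- exact: Linf_norm_ge0.
- move=> f Lf; split => [f0|f0].
    by apply: filterS (Linf_ae Lf) => x; rewrite f0 normr_le0 => /eqP.
  apply/eqP; rewrite eq_le Linf_norm_ge0// andbT; apply: Linf_norm_le => //.
  by apply: filterS f0 => x ->; rewrite normr0.
- move=> c f Lf; apply/eqP; rewrite eq_le (LZ c f Lf).2/=.
  have [->|c0] := eqVneq c 0.
    by rewrite normr0 mul0r Linf_norm_ge0//; exact: (LZ 0 f Lf).1.
  have := (LZ c^-1 _ (LZ c f Lf).1).2.
  rewrite (_ : (fun x => c^-1 * (c * f x)) = f); last first.
    by apply/funext => x; rewrite mulKf.
  by rewrite normfV mulrC ler_pdivlMr ?normr_gt0// mulrC.
- by move=> f g Lf Lg; rewrite mul1r; exact: (LD f g Lf Lg).2.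
Qed.

Lemma Linf_ideal : ideal_property Linf.
Proof.
move=> f g Lf mg gf; apply: Linf_intro => //; first exact: Linf_norm_ge0.
by apply: filterS2 (Linf_ae Lf) gf => x fx /le_trans; apply.
Qed.

Lemma Linf_ideal_space : ideal_space Linf.
Proof. exact: quasi_normed_ideal_space Linf_quasi_normed Linf_ideal. Qed.

Lemma Linf_complete : complete_fspace Linf.
Proof.
move=> u Lu cauchy; have qL := Linf_quasi_normed.
have Lsub k l : Linf (u k \- u l).
  have -> : u k \- u l = u k \+ (fun x => -1 * u l x).
    by apply/funext => x /=; rewrite mulN1r.
  exact: (qn_memD qL (Lu k) (qn_memZ qL _ (Lu l))).
pose N (m : nat) : nat := projT1 (cid (cauchy m.+1%:R^-1 (ltac:(by rewrite invr_gt0) : 0 < m.+1%:R^-1))).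
have hN m k l : (N m <= k)%N -> (N m <= l)%N -> fnorm Linf (u k \- u l) < m.+1%:R^-1.
  by move=> mk ml; rewrite /N in mk ml *; case: cid mk ml => /= N' h mk ml; exact: h.
have small (e : R) : 0 < e -> exists m, m.+1%:R^-1 <= e.
  move=> e0; exists (Num.truncn e^-1).
  by rewrite -[leRHS]invrK lef_pV2 ?posrE ?invr_gt0// ltW// truncnS_gt.
(* The upper limit is measurable, and it is the pointwise limit wherever the Cauchy estimates hold;
   elsewhere the value given by [fine] is irrelevant. *)
pose F x := limn_esup (fun k => (u k x)%:E).
pose f := fine \o F.
have mf : measurable_fun [set: Rn] f.
  apply: measurableT_comp => //; apply: measurable_fun_limn_esup => k.
  by apply/measurable_EFinP; case: (Lu k).
have ub : {ae mu, forall x, forall k l, `|(u k \- u l) x| <= fnorm Linf (u k \- u l)}.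
  by apply: ae_foralln => k; apply: ae_foralln => l; exact: Linf_ae.
have key : {ae mu, forall x, forall m k, (N m <= k)%N -> `|u k x - f x| <= m.+1%:R^-1}.
  apply: filterS ub => x ux.
  have cx m k l : (N m <= k)%N -> (N m <= l)%N -> `|u k x - u l x| <= m.+1%:R^-1.
    by move=> mk ml; apply: le_trans (ux k l) (ltW (hN m k l mk ml)).
  move=> m k mk.
  pose v l := (u l x)%:E.
  have v_le : (F x <= (u k x + m.+1%:R^-1)%:E)%E.
    rewrite /F limn_esup_lim; apply: lime_le; first exact: is_cvg_esups.
    exists (N m) => // i /= mi; apply: ge_ereal_sup => _ [l /= il <-].
    rewrite lee_fin; have := cx m l k (leq_trans mi il) mk.
    by rewrite ler_norml => /andP[h1 h2]; move: m.+1%:R^-1 h1 h2 => dl h1 h2; lra.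
  have v_ge : ((u k x - m.+1%:R^-1)%:E <= F x)%E.
    rewrite /F limn_esup_lim; apply: lime_ge; first exact: is_cvg_esups.
    exists (N m) => // i /= mi; apply: le_ereal_sup_tmp.
    exists (u i x)%:E; first by exists i => /=.
    rewrite lee_fin; have := cx m i k mi mk.
    by rewrite ler_norml => /andP[h1 h2]; move: m.+1%:R^-1 h1 h2 => dl h1 h2; lra.
  have Ffin : F x \is a fin_num.
    by rewrite fin_numElt (lt_le_trans _ v_ge) ?ltNyr// (le_lt_trans v_le) ?ltry.
  move: v_le v_ge; rewrite -(fineK Ffin) !lee_fin ler_norml.
  rewrite -[fine (F x)]/(f x); move: (f x) (u k x) m.+1%:R^-1 => y z dl h1 h2.
  by apply/andP; split; lra.
have Lk k m : (N m <= k)%N -> Linf (u k \- f) /\ fnorm Linf (u k \- f) <= m.+1%:R^-1.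
  move=> mk; apply: Linf_intro => //.
  - by apply: measurable_funB => //; case: (Lu k).
  - by apply: filterS key => x; apply.
have Lf : Linf f.
  have -> : f = u (N 0%N) \+ (fun x => -1 * (u (N 0%N) \- f) x).
    by apply/funext => x /=; rewrite mulN1r opprB addrC subrK.
  apply: (qn_memD qL) => //; apply: (qn_memZ qL).
  exact: (Lk _ 0%N (leqnn _)).1.
exists f => //; apply/cvgrPdist_le => e e0; have [m me] := small e e0.
exists (N m) => // k /= mk; have [L1 L2] := Lk k m mk.
by rewrite sub0r normrN ger0_norm ?Linf_norm_ge0// (le_trans L2).
Qed.

Lemma Linf_fatou : fatou_property Linf.
Proof.
move=> f F Lf fF; set S := ereal_sup _ => Soo.
have S0 : (0 <= S)%E.
  apply: le_ereal_sup_tmp; exists (fnorm Linf (f 0%N))%:E; first by exists 0%N.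
  by rewrite lee_fin Linf_norm_ge0.
have Sfin : S \is a fin_num by rewrite ge0_fin_numE.
(* [F] is only known almost everywhere; the supremum [G] is a measurable version of it. *)
pose G x := ereal_sup (range (fun k => (f k x)%:E)).
have FG : {ae mu, forall x, F x = G x}.
  apply: filterS fF => x [f0 fnd fx].
  have /(cvg_unique _ fx) -> // : (f k x)%:E @[k --> \oo] --> G x.
  by apply: ereal_nondecreasing_cvgn; apply/nondecreasing_seqP => k; rewrite lee_fin.
have GS : {ae mu, forall x, (0 <= G x <= S)%E}.
  apply: filterS2 fF (ae_foralln (fun k => Linf_ae (Lf k))) => x [f0 _ _] fx.
  apply/andP; split.
    apply: le_ereal_sup_tmp; exists (f 0%N x)%:E; first by exists 0%N.
    by rewrite lee_fin.
  apply: ge_ereal_sup => _ [k _ <-].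
  apply: (@le_trans _ _ (fnorm Linf (f k))%:E); last by apply: ereal_sup_ubound; exists k.
  by rewrite lee_fin (le_trans _ (fx k))// ler_norm.
pose g := fine \o G.
have mg : measurable_fun [set: Rn] g.
  apply: measurableT_comp => //.
  apply: (@measurable_sup_seq _ _ (fun k x => (f k x)%:E)) => k.
  by apply/measurable_EFinP; case: (Lf k).
have Gg : {ae mu, forall x, G x = (g x)%:E}.
  apply: filterS GS => x /andP[G0 GS]; rewrite /g /= fineK// ge0_fin_numE//.
  exact: le_lt_trans GS Soo.
have [Lg gS] : Linf g /\ fnorm Linf g <= fine S.
  apply: Linf_intro => //; first exact: fine_ge0.
  apply: filterS2 GS Gg => x /andP[G0 GS] Gx.
  by rewrite -lee_fin fineK// ger0_norm -?Gx// -lee_fin -Gx.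
have Fg : {ae mu, forall x, F x = (g x)%:E}.
  by apply: filterS2 FG Gg => x -> ->.
split; first by exists g.
rewrite (enormE Linf_ideal_space Lg Fg); apply/eqP; rewrite eq_le; apply/andP; split.
  by rewrite -[leRHS]fineK// lee_fin.
apply: ge_ereal_sup => _ [k _ <-]; rewrite lee_fin.
apply: (Linf_ideal Lg _ _).2; first by case: (Lf k).
apply: filterS2 fF Gg => x [f0 _ _] Gx.
rewrite !ger0_norm//; last first.
  by rewrite -lee_fin -Gx (le_trans (_ : _ <= (f 0%N x)%:E)%E) ?lee_fin//;
    apply: ereal_sup_ubound; exists 0%N.
by rewrite -lee_fin -Gx; apply: ereal_sup_ubound; exists k.
Qed.

Lemma measurable_Rn_ball (c : Rn) r : measurable (Rn_ball c r).
Proof.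
have mg : measurable_fun [set: Rn] (fun x : Rn => \sum_(i < n) (tnth x i - tnth c i) ^+ 2).
  apply: measurable_sum => i; apply: measurable_funX.
  by apply: measurable_funB => //; exact: measurable_tnth.
have := mg measurableT _ (measurable_itv `]-oo, r ^+ 2[).
by rewrite setTI; congr measurable; apply/seteqP; split=> x /=; rewrite in_itv.
Qed.

Lemma Rn_ball_sub_cube (c : Rn) r : 0 < r ->
  Rn_ball c r `<=` cube [tuple tnth c i - r | i < n] (2 * r).
Proof.
move=> r0 x; rewrite /Rn_ball /= => h i; rewrite tnth_mktuple.
have : (tnth x i - tnth c i) ^+ 2 < r ^+ 2.
  apply: le_lt_trans h; rewrite (bigD1 i)//= lerDl sumr_ge0// => j _; exact: sqr_ge0.
rewrite -real_normK ?num_real// ltr_sqr ?nnegrE ?(ltW r0)// ltr_norml; lra.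
Qed.

Lemma lebesgue_Rn_ball_lty (c : Rn) r : 0 < r -> (mu (Rn_ball c r) < +oo)%E.
Proof.
move=> r0; apply: (@le_lt_trans _ _ (mu (cube [tuple tnth c i - r | i < n] (2 * r)))).
  apply: le_measure; rewrite ?inE; [exact: measurable_Rn_ball|exact: measurable_cube|].
  exact: Rn_ball_sub_cube.
by rewrite lebesgue_cube ?ltry// mulr_gt0.
Qed.

Lemma Linf_ball_Banach : ball_Banach Linf.
Proof.
split; [exact: Linf_quasi_normed|exact: Linf_complete|exact: Linf_ideal|exact: Linf_fatou|].
split=> [c r r0|c r r0].
  apply: (Linf_intro (M := 1) _ _ _).1 => //.
  - by apply: measurable_indic; exact: measurable_Rn_ball.
  - by apply: aeW => x; rewrite indicE; case: (_ \in _); rewrite ?normr1 ?normr0.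
exists (fine (mu (Rn_ball c r))) => f Lf.
have fin : mu (Rn_ball c r) \is a fin_num by rewrite ge0_fin_numE// lebesgue_Rn_ball_lty.
rewrite EFinM fineK// muleC -integral_cst; last exact: measurable_Rn_ball.
apply: ae_ge0_le_integral => //.
- exact: measurable_Rn_ball.
- apply/measurable_EFinP; apply: measurable_funTS; apply: measurableT_comp => //.
  by case: Lf.
- by move=> x _; rewrite lee_fin Linf_norm_ge0.
- by apply: filterS (Linf_ae Lf) => x fx _; rewrite lee_fin.
Qed.

Lemma Linf_scalar_bound rho : 0 < rho -> scalar_bound Linf rho 1.
Proof.
move=> r0 f Lf; have iL := Linf_ideal_space.
have f0 := Linf_norm_ge0 Lf.
rewrite mul1e (enorm_EFin iL Lf).
have [Lc nc] : Linf (cst (fnorm Linf f)) /\ fnorm Linf (cst (fnorm Linf f)) <= fnorm Linf f.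
  by apply: Linf_intro => //; apply: aeW => x; rewrite ger0_norm.
apply: (@le_trans _ _ (enorm Linf (EFin \o cst (fnorm Linf f)))); last first.
  by rewrite (enorm_EFin iL Lc) lee_fin.
apply: le_enorm => //; first exact: measurable_local_maximal.
  by move=> x; exact: local_maximal_ge0.
apply: aeW => x; apply: local_maximal_le => a l /andP[l0 _] ax.
have ln : 0 < l ^+ n by rewrite exprn_gt0.
rewrite lee_pdivrMl// -(lebesgue_cube a l0) muleC -integral_cst; last exact: measurable_cube.
apply: ae_ge0_le_integral => //.
- exact: measurable_cube.
- apply/measurable_EFinP; apply: measurable_funTS; apply: measurableT_comp => //.
  by case: Lf.
- by apply: filterS (Linf_ae Lf) => y fy _; rewrite lee_fin.
Qed.

(* On [L^1 = (L^infty)'], a single slab of vanishing thickness is enough. *)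
Lemma Linf_kothe_unbounded (hn : (0 < n)%N) rho : 0 < rho ->
  ~ bounded_on (local_maximal rho) (kothe Linf).
Proof.
move=> r0 [C bC].
have [s s0 rs] : exists2 s, 0 < s & rho = 2 * s by exists (rho / 2); lra.
subst rho; pose i0 := Ordinal hn.
pose A := \prod_(i < n | i != i0) (3 * s); pose B := \prod_(i < n | i != i0) s.
have B0 : 0 < B by rewrite prodr_gt0.
have A0 : 0 <= A by rewrite prodr_ge0// => i _; rewrite mulr_ge0// ltW.
(* The slab has norm at most d A, whereas its maximal function has integral at least d B times the
   harmonic sum; the thickness d cancels. *)
have [N N0 hN] := harmonic_unbounded (Num.max 0 C * A / B).
pose d := s / N%:R.
have d0 : 0 < d by rewrite divr_gt0// ltr0n.
pose f : Rn -> R := \1_(slab hn s N N.-1).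
have mS := measurable_slab hn s N N.-1.
have mf : measurable_fun [set: Rn] f by exact: measurable_indic.
have f0 x : 0 <= f x by [].
have nf : (kothe_norm Linf f <= (d * A)%:E)%E.
  apply: ge_ereal_sup => _ [g [Lg g1] <-].
  have -> : (d * A)%:E = (\int[mu]_x (f x)%:E)%E.
    by rewrite integral_indic// setIT; apply/esym; exact: lebesgue_slab.
  have [mg _] := Lg.
  apply: ae_ge0_le_integral => //.
  - apply/measurable_EFinP; apply: measurableT_comp => //; exact: measurable_funM.
  - by move=> x _; rewrite lee_fin.
  - exact/measurable_EFinP.
  - apply: filterS (Linf_ae Lg) => x gx _; rewrite lee_fin normrM.
    by rewrite [X in _ * X]ger0_norm// ler_piMl// (le_trans gx).
have kI := kothe_ideal_space Linf_quasi_normed.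
have kf : kothe Linf f by split => //; exact: le_lt_trans nf (ltry _).
have fk : fnorm (kothe Linf) f <= d * A.
  rewrite -lee_fin /= fineK// ge0_fin_numE ?(kothe_norm_ge0 _ Linf_quasi_normed)//.
  exact: le_lt_trans nf (ltry _).
have := bC f kf; rewrite (enorm_EFin kI kf) => up.
have lm0 x : (0 <= local_maximal (2 * s) f x)%E by exact: local_maximal_ge0.
have mst k := measurable_strip hn s N k.
(* The strip of index N - 1 - k lies k steps before the last slab, so the maximal function is at
   least 1 / (k + 2) on it. *)
have low : ((d * B * \sum_(k < N) k.+2%:R^-1)%:E <=
    \int[mu]_x local_maximal (2 * s) f x)%E.
  have -> : (d * B * \sum_(k < N) k.+2%:R^-1)%:E =
      (\int[mu]_x (\sum_(k < N) (k.+2%:R^-1)%:E * (\1_(strip hn s N (N.-1 - k)) x)%:E))%E.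
    rewrite ge0_integral_sum//; last first.
      move=> k; apply: emeasurable_funM => //; apply/measurable_EFinP.
      exact: measurable_indic.
    rewrite mulr_sumr -sumEFin; apply: eq_bigr => k _.
    rewrite ge0_integralZl//; last first.
      by apply/measurable_EFinP; exact: measurable_indic.
    by rewrite integral_indic// setIT [X in (_ * X)%E](lebesgue_strip hn s0 N0) -EFinM mulrC.
  apply: ge0_le_integral => //.
  - by move=> x _; apply: sume_ge0.
  - apply: emeasurable_sum => k; apply: emeasurable_funM => //; apply/measurable_EFinP.
    exact: measurable_indic.
  - exact: measurable_local_maximal.
  move=> x _; have [[k sk]|nk] := pselect (exists k : 'I_N, strip hn s N (N.-1 - k) x); last first.
    rewrite big1// => k _; rewrite indicE memNset ?mule0// => sk.
    by apply: nk; exists k.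
  have kN := ltn_ord k.
  rewrite (bigD1 k)//= big1 ?adde0; last first.
    move=> j jk; rewrite indicE memNset ?mule0// => sj.
    case/eqP: jk; apply/val_inj => /=; have := strip_inj s0 N0 sj sk.
    have := ltn_ord j; lia.
  rewrite indicE mem_set// mule1.
  have := local_maximal_slab s0 N0 sk (leq_subr k N.-1).
  have -> : (N.-1 - (N.-1 - k) = k)%N by lia.
  by apply.
have hlow : ((d * B * \sum_(k < N) k.+2%:R^-1)%:E <=
    enorm (kothe Linf) (local_maximal (2 * s) f))%E.
  apply: le_ereal_inf_tmp => _ [h [[mh kh] Fh] <-].
  rewrite /= fineK; last by rewrite ge0_fin_numE// (kothe_norm_ge0 _ Linf_quasi_normed).
  apply: le_trans low _; apply: le_ereal_sup_tmp.
  exists (\int[mu]_x `|(cst 1 x) * h x|%:E)%E.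
    exists (cst 1) => //; apply: Linf_intro => //.
    by apply: aeW => x; rewrite normr1.
  apply: ae_ge0_le_integral => //.
  - exact: measurable_local_maximal.
  - apply/measurable_EFinP; apply: measurableT_comp => //; exact: measurable_funM.
  - by apply: filterS Fh => x -> _; rewrite lee_fin mul1r ler_norm.
have := le_trans hlow up; rewrite -EFinM lee_fin leNgt => /negP; apply.
apply: le_lt_trans (_ : _ <= Num.max 0 C * (d * A)) _.
  apply: (@le_trans _ _ (Num.max 0 C * fnorm (kothe Linf) f)).
    apply: ler_wpM2r; last by rewrite le_max lexx orbT.
    by have [_ _ _ n0] := kI; exact: n0.
  by rewrite ler_wpM2l// le_max lexx.
rewrite mulrCA -[ltRHS]mulrA ltr_pM2l// [ltRHS]mulrC -ltr_pdivrMr//.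
Qed.

End Linfty.

(** * Grids *)

Section grid.
Context {R : realType} {n : nat}.
Local Notation Rn := (n.-tuple R).
Local Notation mu := (lebesgue_Rn R n).
Variables (o : 'I_n -> R) (d : R) (K L : nat).

Local Notation Omega := {ffun 'I_n -> 'I_(L * 2 ^ K)}.

(** Cells are indexed by integer coordinates, and level [k] groups them into dyadic blocks of
    2^(K-k) cells per direction. Level 0 is the coarsest, with [L] blocks per direction; by
    truncated subtraction all levels from [K] on are equality. *)
Definition grid_rel k : rel Omega :=
  fun w w' => [forall i, (w i %/ 2 ^ (K - k))%N == (w' i %/ 2 ^ (K - k))%N].

Lemma grid_relP k (w w' : Omega) :
  reflect (forall i, (w i %/ 2 ^ (K - k) = w' i %/ 2 ^ (K - k))%N) (grid_rel k w w').
Proof. by apply: (iffP forallP) => h i; apply/eqP. Qed.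

Lemma grid_rel_equivalence k : equivalence_rel (grid_rel k).
Proof.
move=> x y z; split; first by apply/grid_relP.
move=> /grid_relP xy; apply/grid_relP/grid_relP => h i; first by rewrite -xy h.
by rewrite xy h.
Qed.

Lemma grid_rel_refine k : subrel (grid_rel k.+1) (grid_rel k).
Proof.
move=> w w' /grid_relP h; apply/grid_relP => i.
have [Kk|kK] := leqP K k.
  have := h i; have /eqP -> : (K - k.+1 == 0)%N by rewrite subn_eq0 (leq_trans Kk).
  by have /eqP -> : (K - k == 0)%N by rewrite subn_eq0.
by rewrite -subSS (subSn kK) expnSr !divnMA h.
Qed.

Definition gbox (delta : R) (P : 'I_n -> nat) : set Rn :=
  box (fun i => `[o i + (P i)%:R * delta, o i + (P i).+1%:R * delta[%classic).

Lemma gboxP delta P x : gbox delta P x <->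
  forall i, o i + (P i)%:R * delta <= tnth x i < o i + (P i).+1%:R * delta.
Proof. by split=> h i; have := h i; rewrite /= in_itv. Qed.

Lemma measurable_gbox delta P : measurable (gbox delta P).
Proof. by apply: measurable_box. Qed.

Lemma lebesgue_gbox delta P : 0 < delta -> mu (gbox delta P) = (delta ^+ n)%:E.
Proof.
move=> d0; rewrite (@lebesgue_box _ _ _ (fun=> delta)) ?prodr_const ?card_ord// => i.
rewrite lebesgue_measure_itv/= lte_fin ltrD2l ltr_pM2r// ltr_nat leqnn.
by rewrite -EFinB -natr1; congr EFin; ring.
Qed.

Definition cell (w : Omega) : set Rn := gbox d (fun i => w i).

Definition coarse k (w : Omega) : set Rn :=
  gbox (2 ^+ (K - k) * d) (fun i => w i %/ 2 ^ (K - k))%N.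

Lemma cell_inj x (w w' : Omega) : 0 < d -> cell w x -> cell w' x -> w = w'.
Proof.
move=> d0 /gboxP wx /gboxP w'x; apply/ffunP => i; apply/val_inj => /=; apply/eqP.
rewrite eqn_leq -(ltnS (w i)) -(ltnS (w' i)); apply/andP; split.
  rewrite -(ltr_nat R) -(ltr_pM2r d0) -(ltrD2l (o i)).
  by have /andP[h1 _] := wx i; have /andP[_ h2] := w'x i; exact: le_lt_trans h1 h2.
rewrite -(ltr_nat R) -(ltr_pM2r d0) -(ltrD2l (o i)).
by have /andP[h1 _] := w'x i; have /andP[_ h2] := wx i; exact: le_lt_trans h1 h2.
Qed.

Lemma cell_coarse k w x : 0 < d -> cell w x -> coarse k w x.
Proof.
move=> d0 /gboxP wx; apply/gboxP => i; have /andP[h1 h2] := wx i.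
set j := (K - k)%N; apply/andP; split.
  apply: le_trans h1; rewrite lerD2l mulrA ler_pM2r// -natrX -natrM ler_nat.
  exact: leq_trunc_div.
apply: lt_le_trans h2 _; rewrite lerD2l mulrA ler_pM2r// -natrX -natrM ler_nat.
by rewrite ltn_ceil// expn_gt0.
Qed.

Lemma gbox_cell k (P : 'I_n -> nat) x : 0 < d -> (k <= K)%N ->
  (forall i, (P i < L * 2 ^ k)%N) -> gbox (2 ^+ (K - k) * d) P x ->
  exists2 w : Omega, cell w x & forall i, (w i %/ 2 ^ (K - k) = P i)%N.
Proof.
move=> d0 kK PL /gboxP Px; set j := (K - k)%N in Px *.
pose m i := Num.truncn ((tnth x i - o i) / d).
have t0 i : 0 <= (tnth x i - o i) / d.
  rewrite divr_ge0 ?(ltW d0)// subr_ge0; have /andP[h _] := Px i.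
  by apply: le_trans h; rewrite lerDl mulr_ge0// mulr_ge0 ?exprn_ge0// ltW.
have m1 i : (m i)%:R <= (tnth x i - o i) / d by have /andP[] := truncn_itv (t0 i).
have m2 i : (tnth x i - o i) / d < (m i).+1%:R by have /andP[] := truncn_itv (t0 i).
have p1 i : (P i * 2 ^ j <= m i)%N.
  rewrite -ltnS -(ltr_nat R); apply: le_lt_trans (m2 i).
  rewrite ler_pdivlMr// natrM natrX lerBrDl -mulrA.
  by have /andP[] := Px i.
have p2 i : (m i < (P i).+1 * 2 ^ j)%N.
  rewrite -(ltr_nat R); apply: le_lt_trans (m1 i) _.
  rewrite ltr_pdivrMr// natrM natrX ltrBlDl -mulrA.
  by have /andP[] := Px i.
have mL i : (m i < L * 2 ^ K)%N.
  apply: leq_trans (p2 i) _; rewrite -(subnKC kK) expnD mulnA leq_mul2r.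
  by rewrite PL orbT.
exists [ffun i => Ordinal (mL i)].
  apply/gboxP => i; rewrite ffunE /=; have := m1 i; have := m2 i.
  by rewrite ler_pdivlMr// ltr_pdivrMr// lerBrDl ltrBlDl => -> ->.
move=> i; rewrite ffunE /=; apply/eqP; rewrite eqn_leq.
by rewrite -ltnS ltn_divLR ?expn_gt0// leq_divRL ?expn_gt0// p2 p1.
Qed.

Lemma integral_coarse k w (g : Rn -> \bar R) : 0 < d -> (k <= K)%N ->
  measurable_fun [set: Rn] g -> (forall x, 0 <= g x)%E ->
  (\int[mu]_(x in coarse k w) g x =
   \sum_(w' | grid_rel k w w') \int[mu]_(x in cell w') g x)%E.
Proof.
move=> d0 kK mg g0.
have -> : coarse k w = \big[setU/set0]_(w' <- enum (grid_rel k w)) cell w'.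
  rewrite -bigcup_seq; apply/seteqP; split=> x.
    move=> wx; have wL i : (w i %/ 2 ^ (K - k) < L * 2 ^ k)%N.
      rewrite ltn_divLR ?expn_gt0// -mulnA -expnD subnKC//; exact: ltn_ord.
    have [w' w'x w'E] := gbox_cell d0 kK wL wx.
    exists w' => //=; rewrite mem_enum; apply/grid_relP => i; by rewrite w'E.
  move=> [w' /=]; rewrite mem_enum => /grid_relP ww' /(cell_coarse k d0).
  by rewrite /coarse; congr gbox; apply/funext => i; rewrite ww'.
rewrite ge0_integral_bigsetU//.
- by rewrite big_enum.
- move=> w'; exact: measurable_gbox.
- exact: enum_uniq.
- by apply/trivIsetP => w1 w2 _ _ w12; apply/seteqP; split=> // x [x1 x2];
    case/eqP: w12; exact: cell_inj x1 x2.
- exact: measurable_funTS.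
Qed.

Definition step_fun (a : Omega -> R) (x : Rn) : R := \sum_w a w * \1_(cell w) x.

Lemma step_funE a w x : 0 < d -> cell w x -> step_fun a x = a w.
Proof.
move=> d0 wx; rewrite /step_fun (bigD1 w)//= indicE mem_set// mulr1 big1 ?addr0//.
move=> w' ww'; rewrite indicE memNset ?mulr0// => w'x.
by case/eqP: ww'; exact: cell_inj w'x wx.
Qed.

Lemma step_fun_out a x : (forall w, ~ cell w x) -> step_fun a x = 0.
Proof. by move=> nx; rewrite /step_fun big1// => w _; rewrite indicE memNset ?mulr0. Qed.

Lemma step_funP x : (exists w, cell w x) \/ forall w, ~ cell w x.
Proof.
have [h|h] := pselect (exists w, cell w x); [by left|right => w wx].
by apply: h; exists w.
Qed.

Lemma measurable_step_fun a : measurable_fun [set: Rn] (step_fun a).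
Proof.
apply: measurable_sum => w; apply: measurable_funM => //.
by apply: measurable_indic; exact: measurable_gbox.
Qed.

Lemma step_fun_ge0 a x : (forall w, 0 <= a w) -> 0 <= step_fun a x.
Proof. by move=> a0; apply: sumr_ge0 => w _; rewrite mulr_ge0. Qed.

(** [fine] sends an infinite integral to 0, hence the condition [cell_integrable] wherever the value
    matters. *)
Definition cell_avg (f : Rn -> R) (w : Omega) : R :=
  fine (\int[mu]_(x in cell w) `|f x|%:E)%E / d ^+ n.

Definition cell_integrable (f : Rn -> R) :=
  forall w : Omega, (\int[mu]_(x in cell w) `|f x|%:E < +oo)%E.

Lemma cell_avg_ge0 f w : 0 < d -> 0 <= cell_avg f w.
Proof.
move=> d0; rewrite divr_ge0 ?exprn_ge0 ?(ltW d0)//.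
by apply: fine_ge0; exact: integral_ge0.
Qed.

Lemma cell_avgE f w : 0 < d -> cell_integrable f ->
  (\int[mu]_(x in cell w) `|f x|%:E = (cell_avg f w * d ^+ n)%:E)%E.
Proof.
move=> d0 fi; rewrite /cell_avg mulfVK ?gt_eqF ?exprn_gt0// fineK//.
by rewrite ge0_fin_numE ?fi// integral_ge0.
Qed.

Lemma cell_avg_step_fun a w : 0 < d -> (forall w, 0 <= a w) -> cell_avg (step_fun a) w = a w.
Proof.
move=> d0 a0; rewrite /cell_avg.
have -> : (\int[mu]_(x in cell w) `|step_fun a x|%:E = (a w * d ^+ n)%:E)%E.
  rewrite (eq_integral (cst (a w)%:E)); last first.
    by move=> x; rewrite inE => wx; rewrite (step_funE _ d0 wx) ger0_norm.
  rewrite integral_cst; last exact: measurable_gbox.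
  by rewrite [X in (_ * X)%E](lebesgue_gbox _ d0).
by rewrite mulfK// gt_eqF// exprn_gt0.
Qed.

Lemma cell_integrable_step_fun a : 0 < d -> (forall w, 0 <= a w) -> cell_integrable (step_fun a).
Proof.
move=> d0 a0 w; rewrite (eq_integral (cst (a w)%:E)); last first.
  by move=> x; rewrite inE => wx; rewrite (step_funE _ d0 wx) ger0_norm.
rewrite integral_cst; last exact: measurable_gbox.
by rewrite [X in (_ * X)%E](lebesgue_gbox _ d0) -EFinM ltry.
Qed.

Lemma integral_mul_step_fun f a : 0 < d -> measurable_fun [set: Rn] f ->
  cell_integrable f -> (forall w, 0 <= a w) ->
  (\int[mu]_x `|f x * step_fun a x|%:E = (d ^+ n * \sum_w a w * cell_avg f w)%:E)%E.
Proof.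
move=> d0 mf fi a0.
have mif w : measurable_fun [set: Rn] (fun x => `|f x|%:E * (\1_(cell w) x)%:E)%E.
  apply: emeasurable_funM.
    by apply/measurable_EFinP; exact: measurableT_comp.
  by apply/measurable_EFinP; apply: measurable_indic; exact: measurable_gbox.
transitivity (\int[mu]_x (\sum_w (a w)%:E * (`|f x|%:E * (\1_(cell w) x)%:E)))%E.
  apply: eq_integral => x _.
  rewrite (eq_bigr (fun w => (a w * (`|f x| * \1_(cell w) x))%:E))//.
  rewrite sumEFin normrM [`|step_fun a x|]ger0_norm ?step_fun_ge0// /step_fun mulr_sumr.
  by congr EFin; apply: eq_bigr => w _; rewrite mulrCA.
rewrite ge0_integral_sum//; last 2 first.
- by move=> w; apply: emeasurable_funM.
- by move=> w x _; rewrite mule_ge0 ?lee_fin// mule_ge0 ?lee_fin.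
rewrite mulr_sumr -sumEFin; apply: eq_bigr => w _.
have aw0 : (0 <= (a w)%:E)%E by rewrite lee_fin.
rewrite ge0_integralZl//.
have -> : (\int[mu]_x (`|f x|%:E * (\1_(cell w) x)%:E) =
           \int[mu]_(x in cell w) `|f x|%:E)%E.
  rewrite [RHS]integral_mkcond; apply: eq_integral => x _.
  rewrite patchE indicE; case: ifPn => _; rewrite ?mule1 ?mule0//.
by rewrite cell_avgE// -EFinM; congr EFin; ring.
Qed.

Lemma class_avg_cell_avg f k w : 0 < d -> (k <= K)%N -> measurable_fun [set: Rn] f ->
  cell_integrable f ->
  ((class_avg grid_rel k (cell_avg f) w)%:E =
   (((2 ^+ (K - k) * d) ^+ n)^-1)%:E * \int[mu]_(x in coarse k w) `|f x|%:E)%E.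
Proof.
move=> d0 kK mf fi.
have dn : 0 < d ^+ n by rewrite exprn_gt0.
have c0 : 0 < 2 ^+ (K - k) * d by rewrite mulr_gt0// exprn_gt0.
rewrite integral_coarse//; last first.
  by apply/measurable_EFinP; exact: measurableT_comp.
under eq_bigr do rewrite cell_avgE//.
have -> : (2 ^+ (K - k) * d) ^+ n = (\sum_(w' | grid_rel k w w') 1) * d ^+ n.
  apply: EFin_inj; rewrite -(@lebesgue_gbox _ (fun i => w i %/ 2 ^ (K - k))%N c0).
  have := integral_coarse w d0 kK (@measurable_cst _ _ _ _ _ 1%E) (fun=> lee01).
  rewrite integral_cst; last exact: measurable_gbox.
  rewrite mul1e => ->; rewrite mulr_suml -sumEFin; apply: eq_bigr => w' _.
  rewrite integral_cst; last exact: measurable_gbox.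
  by rewrite mul1e mul1r; exact: lebesgue_gbox.
rewrite sumEFin -EFinM -mulr_suml /class_avg; congr EFin.
have s0 := class_size_gt0 (R := R) grid_rel_equivalence k w.
by field; rewrite !gt_eqF.
Qed.

Lemma class_avg_le_local_maximal rho f k w x : 0 < d -> (k <= K)%N ->
  measurable_fun [set: Rn] f -> cell_integrable f ->
  2 * (2 ^+ (K - k) * d) <= rho -> coarse k w x ->
  ((class_avg grid_rel k (cell_avg f) w)%:E <= (2 ^+ n)%:E * local_maximal rho f x)%E.
Proof.
move=> d0 kK mf fi dr wx; rewrite class_avg_cell_avg//.
set c := 2 ^+ (K - k) * d in dr *.
have c0 : 0 < c by rewrite mulr_gt0// exprn_gt0.
(* The half-open cell is placed in the middle of an open cube of twice its side, at the cost of
   2^n. *)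
pose a : Rn := [tuple o i + (w i %/ 2 ^ (K - k))%:R * c - c / 2 | i < n].
have sub : coarse k w `<=` cube a (2 * c).
  move=> y /gboxP yw i; rewrite tnth_mktuple; have := yw i.
  by rewrite -/c -natr1 mulrDl mul1r => /andP[? ?]; apply/andP; split; lra.
have cr : 0 < 2 * c <= rho by rewrite dr andbT mulr_gt0.
have h := local_maximal_ge f cr (sub x wx).
have mF : measurable_fun [set: Rn] (fun y => `|f y|%:E).
  by apply/measurable_EFinP; exact: measurableT_comp.
apply: (@le_trans _ _ ((2 ^+ n)%:E * ((((2 * c) ^+ n)^-1)%:E *
    \int[mu]_(y in cube a (2 * c)) `|f y|%:E))%E); last first.
  by apply: lee_wpmul2l => //; rewrite lee_fin exprn_ge0.
rewrite muleA -EFinM.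
have -> : 2 ^+ n * ((2 * c) ^+ n)^-1 = (c ^+ n)^-1.
  by rewrite exprMn; field; rewrite !gt_eqF ?exprn_gt0.
apply: lee_wpmul2l; first by rewrite lee_fin invr_ge0 exprn_ge0// ltW.
apply: ge0_subset_integral => //; try exact: measurable_cube; try exact: measurable_gbox.
exact: measurable_funTS.
Qed.

Local Notation T := (mart_max grid_rel K.+1).

Lemma mart_max_le_local_maximal rho f w x : 0 < d -> 0 < rho ->
  measurable_fun [set: Rn] f -> cell_integrable f ->
  2 * (2 ^+ K * d) <= rho -> cell w x ->
  ((T (cell_avg f) w)%:E <= (2 ^+ n)%:E * local_maximal rho f x)%E.
Proof.
move=> d0 r0 mf fi dr wx.
have lm0 := local_maximal_ge0 f x r0.
suff H k : (k <= K.+1)%N -> ((run_max (class_avg grid_rel ^~ (cell_avg f)) k w)%:E <=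
    (2 ^+ n)%:E * local_maximal rho f x)%E by exact: H.
elim: k => [_|k IH kK] /=.
  by apply: mule_ge0 => //; rewrite lee_fin exprn_ge0.
rewrite EFin_max ge_max (IH (ltnW kK))/=.
rewrite ltnS in kK; apply: class_avg_le_local_maximal => //; last exact: cell_coarse.
apply: le_trans dr; rewrite ler_pM2l// ler_pM2r// ler_eXn2l ?ltr1n//.
exact: leq_subr.
Qed.

Lemma step_fun_mart_max_le rho f x : 0 < d -> 0 < rho ->
  measurable_fun [set: Rn] f -> cell_integrable f ->
  2 * (2 ^+ K * d) <= rho ->
  ((step_fun (T (cell_avg f)) x)%:E <= (2 ^+ n)%:E * local_maximal rho f x)%E.
Proof.
move=> d0 r0 mf fi dr; have [[w wx]|nx] := step_funP x.
  by rewrite (step_funE _ d0 wx); exact: mart_max_le_local_maximal.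
rewrite step_fun_out//; apply: mule_ge0; first by rewrite lee_fin exprn_ge0.
exact: local_maximal_ge0.
Qed.

(** The cube lies in one coarse cell of side at most 6l, and the ratio of the volumes gives 6^n. *)
Lemma local_average_le_step_fun f k P a l x : 0 < d -> (k <= K)%N ->
  measurable_fun [set: Rn] f -> cell_integrable f ->
  (forall i, (P i < L * 2 ^ k)%N) -> 0 < l -> 2 ^+ (K - k) * d <= 6 * l ->
  cube a l `<=` gbox (2 ^+ (K - k) * d) P -> cube a l x ->
  (((l ^+ n)^-1)%:E * \int[mu]_(y in cube a l) `|f y|%:E <=
   (6 ^+ n * step_fun (T (cell_avg f)) x)%:E)%E.
Proof.
move=> d0 kK mf fi PL l0 dl sub ax.
have [w wx wP] := gbox_cell d0 kK PL (sub x ax).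
have cE : gbox (2 ^+ (K - k) * d) P = coarse k w.
  by congr gbox; apply/funext => i; rewrite wP.
rewrite cE in sub.
have c0 : 0 < 2 ^+ (K - k) * d by rewrite mulr_gt0// exprn_gt0.
have mF : measurable_fun [set: Rn] (fun y => `|f y|%:E).
  by apply/measurable_EFinP; exact: measurableT_comp.
rewrite (step_funE _ d0 wx).
apply: (@le_trans _ _ (6 ^+ n * class_avg grid_rel k (cell_avg f) w)%:E); last first.
  rewrite lee_fin ler_pM2l ?exprn_gt0//.
  by apply: (le_run_max (class_avg grid_rel ^~ (cell_avg f))); rewrite ltnS.
rewrite EFinM class_avg_cell_avg// muleA -EFinM.
apply: lee_pmul.
- by rewrite lee_fin invr_ge0 exprn_ge0// ltW.
- exact: integral_ge0.
- rewrite lee_fin ler_pdivlMr ?exprn_gt0// ler_pdivrMl ?exprn_gt0// -exprMn.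
  apply: lerXn2r; rewrite ?nnegrE; [exact: ltW|by rewrite mulr_ge0// ltW|].
  by rewrite [l * 6]mulrC.
- apply: ge0_subset_integral => //; try exact: measurable_cube; try exact: measurable_gbox.
  exact: measurable_funTS.
Qed.

End grid.

(** * Duality and lower limits *)

Section kothe_duality.
Context {R : realType} {n : nat}.
Local Notation Rn := (n.-tuple R).
Local Notation mu := (lebesgue_Rn R n).
Variable X : fspace R n.
Hypothesis hX : ball_Banach X.

Lemma ball_Banach_normed : quasi_normed 1 X. Proof. by case: hX. Qed.

Lemma ball_Banach_ideal : ideal_space X.
Proof. by case: hX => qX _ iX _ _; exact: quasi_normed_ideal_space qX iX. Qed.

Lemma kothe_hoelder f (G : Rn -> \bar R) (B : R) : X f ->
  measurable_fun [set: Rn] G -> (forall x, 0 <= G x)%E ->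
  (enorm (kothe X) G <= B%:E)%E ->
  (\int[mu]_x (`|f x|%:E * G x) <= (B * fnorm X f)%:E)%E.
Proof.
move=> Xf mG G0 GB.
have qX := ball_Banach_normed; have kI := kothe_ideal_space qX.
have mf := qn_measurable qX Xf.
have [g [mg kg] Gg] := enorm_mem (le_lt_trans GB (ltry B)).
have gB : (kothe_norm X g <= B%:E)%E.
  move: GB; rewrite (@enormE _ _ _ _ g kI _ Gg)//= fineK//.
  by rewrite ge0_fin_numE// (kothe_norm_ge0 _ qX).
have -> : (\int[mu]_x (`|f x|%:E * G x) = \int[mu]_x `|f x * g x|%:E)%E.
  apply: ge0_ae_eq_integral => //.
  - by apply: emeasurable_funM => //; apply/measurable_EFinP; exact: measurableT_comp.
  - by apply/measurable_EFinP; apply: measurableT_comp => //; exact: measurable_funM.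
  - by move=> x _; rewrite mule_ge0// lee_fin.
  - apply: filterS Gg => x Gx _.
    by rewrite normrM EFinM Gx -{1}(ger0_norm (_ : 0 <= g x)) // -lee_fin -Gx.
(* A function of norm 0 cannot be normalised, but it vanishes almost everywhere. *)
have [f0|f0] := eqVneq (fnorm X f) 0.
  rewrite f0 mulr0 (ge0_ae_eq_integral (g := fun=> 0%E)) ?integral0//.
  - by apply/measurable_EFinP; apply: measurableT_comp => //; exact: measurable_funM.
  - by apply: filterS ((qn_norm_eq0 qX Xf).1 f0) => x -> _; rewrite mul0r normr0.
have fp : 0 < fnorm X f by rewrite lt_neqAle eq_sym f0 (qn_norm_ge0 qX Xf).
pose c := (fnorm X f)^-1.
have c0 : 0 < c by rewrite invr_gt0.
have : (\int[mu]_x `|(c * f x) * g x|%:E <= B%:E)%E.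
  apply: le_trans gB; apply: ereal_sup_ubound; exists (fun x => c * f x) => //.
  split; first exact: (qn_memZ qX c Xf).
  by rewrite (qn_normZ qX c Xf) gtr0_norm// /c mulVf// gt_eqF.
rewrite (eq_integral (fun x => c%:E * `|f x * g x|%:E)%E); last first.
  by move=> x _; rewrite -mulrA normrM gtr0_norm// EFinM.
rewrite ge0_integralZl//; first 1 last.
- by apply/measurable_EFinP; apply: measurableT_comp => //; exact: measurable_funM.
- by rewrite lee_fin ltW.
by rewrite /c lee_pdivrMl// -EFinM mulrC.
Qed.

(** Membership is part of the conclusion: tested on indicators of balls, [G] is integrable on every
    ball, hence finite almost everywhere. *)
Lemma kothe_enorm_le (G : Rn -> \bar R) (B : R) : 0 <= B ->
  measurable_fun [set: Rn] G -> (forall x, 0 <= G x)%E ->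
  (forall f, X f -> \int[mu]_x (`|f x|%:E * G x) <= (B * fnorm X f)%:E)%E ->
  (enorm (kothe X) G <= B%:E)%E.
Proof.
move=> B0 mG G0 hG.
have qX := ball_Banach_normed; have kI := kothe_ideal_space qX.
have [_ _ _ _ [bX _]] := hX.
pose D (k : nat) : set Rn := Rn_ball [tuple 0 | i < n] k.+1%:R.
have mD k : measurable (D k) by exact: measurable_Rn_ball.
have Gfin k : {ae mu, forall x, D k x -> G x \is a fin_num}.
  apply: integrable_ae => //; apply/integrableP; split; first exact: measurable_funTS.
  have XD : X \1_(D k) by apply: bX.
  apply: le_lt_trans (ltry (B * fnorm X \1_(D k))); apply: le_trans (hG _ XD).
  rewrite integral_mkcond; apply: ge0_le_integral => //.
  - by move=> x _; rewrite patchE; case: ifP.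
  - have mA : measurable_fun [set: Rn] (fun x => `|G x|)%E by exact: measurableT_comp.
    exact: (measurable_restrictT (fun x => `|G x|)%E (mD k)).1 (measurable_funTS mA).
  - apply: emeasurable_funM => //; apply/measurable_EFinP; exact: measurableT_comp.
  - move=> x _; rewrite patchE indicE; case: ifPn => _; rewrite ?normr1 ?normr0 ?mul0e//.
    by rewrite mul1e gee0_abs.
have Gf : {ae mu, forall x, G x = (fine (G x))%:E}.
  apply: filterS (ae_foralln Gfin) => x Gx; rewrite fineK//.
  pose S := \sum_(i < n) tnth x i ^+ 2.
  have S0 : 0 <= S by apply: sumr_ge0 => i _; exact: sqr_ge0.
  apply: (Gx (Num.truncn S)); rewrite /D /Rn_ball /=.
  under eq_bigr do rewrite tnth_mktuple subr0.
  apply: lt_le_trans (truncnS_gt S) _.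
  by rewrite -natrX ler_nat expnS expn1 leq_pmulr.
pose g := fine \o G.
have mg : measurable_fun [set: Rn] g by exact: measurableT_comp.
have kgB : (kothe_norm X g <= B%:E)%E.
  apply: ge_ereal_sup => _ [f [Xf f1] <-].
  have mf := qn_measurable qX Xf.
  apply: le_trans (_ : _ <= (B * fnorm X f)%:E)%E _; last first.
    by rewrite lee_fin ler_piMr.
  apply: le_trans (hG f Xf); apply: eq_lew.
  apply: ge0_ae_eq_integral => //.
  - by apply/measurable_EFinP; apply: measurableT_comp => //; exact: measurable_funM.
  - by apply: emeasurable_funM => //; apply/measurable_EFinP; exact: measurableT_comp.
  - by move=> x _; rewrite mule_ge0// lee_fin.
  - apply: filterS Gf => x Gx _.
    by rewrite normrM EFinM Gx [`|g x|]ger0_norm// fine_ge0.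
have kg : kothe X g by split => //; exact: le_lt_trans kgB (ltry _).
rewrite (enormE kI kg Gf) /= fineK//.
rewrite ge0_fin_numE ?(kothe_norm_ge0 _ qX)//; exact: le_lt_trans kgB (ltry _).
Qed.

(** The Fatou property of the associate space, by monotone convergence in each pairing with an
    element of [X]. *)
Lemma kothe_fatou_enorm (F : nat -> Rn -> \bar R) (B : R) :
  (forall k, measurable_fun [set: Rn] (F k)) -> (forall k x, 0 <= F k x)%E ->
  (forall k x, F k x <= F k.+1 x)%E -> (forall k, enorm (kothe X) (F k) <= B%:E)%E ->
  (enorm (kothe X) (fun x => ereal_sup (range (F ^~ x))) <= B%:E)%E.
Proof.
move=> mF F0 Fnd FB.
have kI := kothe_ideal_space ball_Banach_normed.
have B0 : 0 <= B by rewrite -lee_fin; apply: le_trans (enorm_ge0 (F 0%N) kI) (FB 0%N).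
apply: kothe_enorm_le => //; first exact: measurable_sup_seq.
  move=> x; apply: le_ereal_sup_tmp; exists (F 0%N x) => //; by exists 0%N.
move=> f Xf; have mf := qn_measurable ball_Banach_normed Xf.
have mFf k : measurable_fun [set: Rn] (fun x => `|f x|%:E * F k x)%E.
  by apply: emeasurable_funM => //; apply/measurable_EFinP; exact: measurableT_comp.
have nd x : nondecreasing_seq (F ^~ x) by apply/nondecreasing_seqP => k; exact: Fnd.
have ndf x : nondecreasing_seq (fun k => `|f x|%:E * F k x)%E.
  by move=> i k ik; apply: lee_wpmul2l; rewrite ?lee_fin//; exact: nd.
rewrite (eq_integral (fun x => limn (fun k => `|f x|%:E * F k x)%E)); last first.
  move=> x _; apply/esym/cvg_lim => //; apply: cvgeZl => //.
  exact: ereal_nondecreasing_cvgn.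
rewrite monotone_convergence//; last by move=> k x _; rewrite mule_ge0// lee_fin.
apply: lime_le.
  apply: ereal_nondecreasing_is_cvgn => i k ik; apply: ge0_le_integral => //.
  - by move=> x _; rewrite mule_ge0// lee_fin.
  - by move=> x _; exact: ndf.
by apply: nearW => k; exact: kothe_hoelder.
Qed.

End kothe_duality.

Section liminf.
Context {R : realType} {n : nat}.
Local Notation Rn := (n.-tuple R).
Local Notation mu := (lebesgue_Rn R n).

Definition liminfE (S : nat -> Rn -> R) (x : Rn) : \bar R :=
  ereal_sup (range (fun k => einfs (fun m => (S m x)%:E) k)).

Lemma liminfE_ge (S : nat -> Rn -> R) x (z : \bar R) m0 :
  (forall m, (m0 <= m)%N -> (z <= (S m x)%:E)%E) -> (z <= liminfE S x)%E.
Proof.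
move=> h; apply: le_ereal_sup_tmp; exists (einfs (fun m => (S m x)%:E) m0).
  by exists m0.
by apply: le_ereal_inf_tmp => _ [m /= mm <-]; exact: h.
Qed.

(** Fatou's property is an argument because it has different sources for [X] and for its associate.
    With a lower limit it is enough that the grid functions dominate from some stage on, so
    successive grids are never compared. *)
Lemma enorm_liminf (Z : fspace R n) (S : nat -> Rn -> R) (F : Rn -> \bar R) (B : R) :
  ideal_space Z ->
  (forall (F : nat -> Rn -> \bar R) (B : R),
    (forall k, measurable_fun [set: Rn] (F k)) -> (forall k x, 0 <= F k x)%E ->
    (forall k x, F k x <= F k.+1 x)%E -> (forall k, enorm Z (F k) <= B%:E)%E ->
    (enorm Z (fun x => ereal_sup (range (F ^~ x))) <= B%:E)%E) ->
  (forall m, measurable_fun [set: Rn] (S m)) -> (forall m x, 0 <= S m x) ->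
  (forall m, enorm Z (EFin \o S m) <= B%:E)%E ->
  measurable_fun [set: Rn] F -> (forall x, 0 <= F x)%E ->
  {ae mu, forall x, (F x <= liminfE S x)%E} -> (enorm Z F <= B%:E)%E.
Proof.
move=> iZ fZ mS S0 SB mF F0 FS.
apply: le_trans (le_enorm iZ mF F0 FS) _.
have mE k : measurable_fun [set: Rn] (fun x => einfs (fun m => (S m x)%:E) k).
  by apply: measurable_fun_einfs => m; apply/measurable_EFinP.
have E0 k x : (0 <= einfs (fun m => (S m x)%:E) k)%E.
  by apply: le_ereal_inf_tmp => _ [m /= _ <-]; rewrite lee_fin.
apply: (fZ (fun k x => einfs (fun m => (S m x)%:E) k)) => //.
- by move=> k x; apply: nondecreasing_einfs.
- move=> k; apply: le_trans (SB k); apply: le_enorm => //; apply: aeW => x.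
  by apply: ereal_inf_lbound; exists k => /=.
Qed.

End liminf.

(** * Grid norms *)

Section grid_norm.
Context {R : realType} {n : nat}.
Local Notation Rn := (n.-tuple R).
Local Notation mu := (lebesgue_Rn R n).
Variable X : fspace R n.
Hypothesis hX : ball_Banach X.
Variables (o : 'I_n -> R) (d : R) (K L : nat).
Hypothesis d0 : 0 < d.

Local Notation Omega := {ffun 'I_n -> 'I_(L * 2 ^ K)}.
Local Notation e := (@grid_rel n K L).
Local Notation T := (mart_max e K.+1).
Local Notation step_fun := (@step_fun R n o d K L).
Local Notation cell := (@cell R n o d K L).
Local Notation avg := (@cell_avg R n o d K L).
Local Notation integrable := (@cell_integrable R n o d K L).

Definition grid_norm (a : Omega -> R) : R := fnorm X (step_fun a).

Local Notation N := grid_norm.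

Let qX := ball_Banach_normed hX.
Let iX := ball_Banach_ideal hX.

Lemma cell_sub_ball w : exists2 r : R, 0 < r & cell w `<=` Rn_ball [tuple 0 | i < n] r.
Proof.
pose r := 1 + \sum_i (`|o i| + (w i).+1%:R * d).
have s0 i : 0 <= `|o i| + (w i).+1%:R * d.
  by rewrite addr_ge0// mulr_ge0// ltW.
have r0 : 0 < r by rewrite ltr_pwDl// sumr_ge0.
exists (r * n.+1%:R); first by rewrite mulr_gt0.
move=> x /gboxP wx; apply: ball_bounded => // i.
have ri : `|o i| + (w i).+1%:R * d < r.
  by rewrite /r (bigD1 i)//= addrA ltr_wpDr ?sumr_ge0// ltrDr.
have wd : 0 <= (w i)%:R * d by rewrite mulr_ge0// ltW.
have /andP[h1 h2] := wx i; apply: le_lt_trans ri.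
have /andP[n1 n2] : - `|o i| <= o i <= `|o i| by rewrite -ler_norml.
rewrite ler_norml; move: h1 h2 wd n1 n2; rewrite -natr1 mulrDl mul1r.
have dd := d0; move: (_ * d) `|_| => y z h1 h2 wd n1 n2.
by apply/andP; split; lra.
Qed.

Lemma grid_cell_mem w : X \1_(cell w).
Proof.
have [r r0 wr] := cell_sub_ball w.
have [_ _ iX' _ [bX _]] := hX.
apply: (iX' \1_(Rn_ball [tuple 0 | i < n] r) _ (bX _ _ r0) _ _).1.
  by apply: measurable_indic; exact: measurable_gbox.
apply: aeW => x; rewrite !indicE; have [|_] := boolP (x \in cell w).
  by rewrite inE => /wr xr; rewrite mem_set.
by rewrite normr0.
Qed.

Lemma cell_bound w : exists C : R, 0 <= C /\ forall f, X f ->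
  (\int[mu]_(x in cell w) `|f x|%:E <= (C * fnorm X f)%:E)%E.
Proof.
have [r r0 wr] := cell_sub_ball w.
have [_ _ _ _ [_ /(_ [tuple 0 | i < n] r r0)[C hC]]] := hX.
exists (Num.max 0 C); split; first by rewrite le_max lexx.
move=> f Xf; have mf := qn_measurable qX Xf.
apply: (@le_trans _ _ (C * fnorm X f)%:E); last first.
  by rewrite lee_fin ler_wpM2r ?(qn_norm_ge0 qX)// le_max lexx orbT.
apply: le_trans (hC f Xf); apply: ge0_subset_integral => //.
- exact: measurable_gbox.
- exact: measurable_Rn_ball.
- by apply/measurable_EFinP; apply: measurable_funTS; exact: measurableT_comp.
Qed.

Lemma mem_cell_integrable f : X f -> integrable f.
Proof.
move=> Xf w; have [C [_ hC]] := cell_bound w.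
exact: le_lt_trans (hC f Xf) (ltry _).
Qed.

Lemma kothe_cell_integrable g : kothe X g -> integrable g.
Proof.
move=> kg w; have kI := kothe_ideal_space qX.
have [mg _] := kg.
have ka : (enorm (kothe X) (absE g) <= (fnorm (kothe X) g)%:E)%E.
  by rewrite enorm_absE// enorm_EFin.
have := kothe_hoelder hX (grid_cell_mem w) (absE_measurable mg) (absE_ge0 g) ka.
move=> /le_lt_trans h; rewrite integral_mkcond; apply: le_lt_trans (h _ (ltry _)).
apply: eq_lew; apply: eq_integral => x _.
by rewrite patchE indicE; case: ifPn => _; rewrite ?normr1 ?normr0 ?mul0e ?mul1e.
Qed.

Lemma grid_step_fun_mem a : X (step_fun a).
Proof.
rewrite /step_fun; elim: (index_enum _) => [|w s IH].
  rewrite (_ : (fun x => _) = cst 0); first exact: qn_mem0 qX.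
  by apply/funext => x; rewrite big_nil.
rewrite (_ : (fun x => _) = (fun x => a w * \1_(cell w) x) \+
    (fun x => \sum_(w' <- s) a w' * \1_(cell w') x)).
  by apply: (qn_memD qX _ IH); apply: (qn_memZ qX); exact: grid_cell_mem.
by apply/funext => x; rewrite big_cons.
Qed.

Lemma grid_norm_seminorm : lattice_seminorm N.
Proof.
have [_ _ iX' _ _] := hX; split.
- move=> a b ab; apply: (iX' _ _ (grid_step_fun_mem b) (measurable_step_fun o d a) _).2.
  apply: aeW => x; have [[w wx]|nx] := step_funP o d K L x; first by rewrite !(step_funE _ d0 wx).
  by rewrite !step_fun_out.
- move=> a b; have := qn_normD qX (grid_step_fun_mem a) (grid_step_fun_mem b).
  rewrite mul1r; apply: le_trans; apply: eq_lew.
  congr (fnorm X); apply/funext => x /=; rewrite -big_split/=.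
  by apply: eq_bigr => w _; rewrite mulrDl.
- move=> c a c0; rewrite -[c in RHS]ger0_norm// -(qn_normZ qX c (grid_step_fun_mem a)).
  congr (fnorm X); apply/funext => x /=; rewrite mulr_sumr.
  by apply: eq_bigr => w _; rewrite mulrA.
Qed.

(** Integrability on balls makes this finite. The bound depends on the grid, which is harmless since
    [vector_maximal_bound] does not let it into its constant. *)
Lemma grid_dual_bound1 : exists2 B, 0 <= B & dual_bound N (fun=> 1) B.
Proof.
have /choice[C hC] := cell_bound.
exists (\sum_w C w / d ^+ n).
  by apply: sumr_ge0 => w _; rewrite divr_ge0 ?exprn_ge0 ?(ltW d0)//; case: (hC w).
move=> h h0; rewrite mulr_suml; apply: ler_sum => w _; rewrite mul1r.
have [_ /(_ _ (grid_step_fun_mem h))] := hC w.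
rewrite cell_avgE//; last exact: cell_integrable_step_fun.
by rewrite cell_avg_step_fun// lee_fin -ler_pdivlMr ?exprn_gt0// mulrAC.
Qed.

(** The classes of level [K] are single cells, and [T] includes that level. *)
Lemma le_mart_max_self (a : Omega -> R) w : a w <= T a w.
Proof.
have -> : a w = class_avg e K a w.
  rewrite /class_avg (big_pred1 w); last first.
    move=> w'; apply/grid_relP/eqP => [h|->//].
    apply/ffunP => i; apply/val_inj; have := h i.
    by rewrite subnn expn0 !divn1.
  rewrite (big_pred1 w) ?divr1//.
  move=> w'; apply/grid_relP/eqP => [h|->//].
  apply/ffunP => i; apply/val_inj; have := h i.
  by rewrite subnn expn0 !divn1.
exact: (le_run_max (class_avg e ^~ a)).
Qed.

Lemma step_fun_lq q m (a : 'I_m -> Omega -> R) : 0 < q -> (forall j w, 0 <= a j w) ->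
  lq_fin q (fun j => absE (step_fun (a j))) =
  EFin \o step_fun (fun w => (\sum_j a j w `^ q) `^ q^-1).
Proof.
move=> q0 a0; apply/funext => x; rewrite /lq_fin /absE lq_fin_EFin /=; congr EFin.
have [[w wx]|nx] := step_funP o d K L x.
  rewrite (step_funE _ d0 wx); congr (_ `^ _); apply: eq_bigr => j _.
  by rewrite (step_funE _ d0 wx) ger0_norm.
rewrite step_fun_out// big1 ?powR0 ?invr_eq0 ?gt_eqF// => j _.
by rewrite step_fun_out// normr0 powR0// gt_eqF.
Qed.

Section with_maximal.
Variable rho : R.
Hypotheses (r0 : 0 < rho) (dr : 2 * (2 ^+ K * d) <= rho).

Lemma step_fun_avg_le f x : measurable_fun [set: Rn] f -> integrable f ->
  ((step_fun (avg f) x)%:E <= (2 ^+ n)%:E * local_maximal rho f x)%E.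
Proof.
move=> mf fi; apply: le_trans (step_fun_mart_max_le x d0 r0 mf fi dr).
rewrite lee_fin; apply: ler_sum => w _; rewrite ler_wpM2r//.
exact: le_mart_max_self.
Qed.

Lemma step_fun_mart_max_step_fun_le a x : (forall w, 0 <= a w) ->
  ((step_fun (T a) x)%:E <= (2 ^+ n)%:E * local_maximal rho (step_fun a) x)%E.
Proof.
move=> a0; rewrite -{1}(_ : avg (step_fun a) = a); last first.
  by apply/funext => w; exact: cell_avg_step_fun.
apply: step_fun_mart_max_le => //; first exact: measurable_step_fun.
exact: cell_integrable_step_fun.
Qed.

Lemma enorm_step_fun_le f C a : 0 <= C -> X f ->
  scalar_bound X rho C -> (forall w, 0 <= a w) ->
  (forall x, ((step_fun a x)%:E <= (2 ^+ n)%:E * local_maximal rho f x)%E) ->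
  N a <= 2 ^+ n * C * fnorm X f.
Proof.
move=> C0 Xf sb a0 h; rewrite -lee_fin -(enorm_EFin iX (grid_step_fun_mem a)).
apply: (@le_trans _ _ (enorm X (fun x => (2 ^+ n)%:E * local_maximal rho f x)%E)).
  apply: le_enorm => //.
  - by apply/measurable_EFinP; exact: measurable_step_fun.
  - by move=> x; rewrite lee_fin step_fun_ge0.
  - exact: aeW.
apply: le_trans (enormZ_le _ iX _) _; first by rewrite exprn_gt0.
rewrite -mulrA EFinM; apply: lee_wpmul2l; first by rewrite lee_fin exprn_ge0.
by rewrite EFinM -(enorm_EFin iX Xf); exact: sb.
Qed.

Lemma grid_norm_mart_max C a : 0 <= C -> scalar_bound X rho C ->
  (forall w, 0 <= a w) -> N (T a) <= 2 ^+ n * C * N a.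
Proof.
move=> C0 sb a0; apply: enorm_step_fun_le => //; first exact: grid_step_fun_mem.
  by move=> w; exact: mart_max_ge0.
by move=> x; exact: step_fun_mart_max_step_fun_le.
Qed.

Lemma grid_norm_avg C f : 0 <= C -> scalar_bound X rho C -> X f ->
  N (avg f) <= 2 ^+ n * C * fnorm X f.
Proof.
move=> C0 sb Xf; apply: enorm_step_fun_le => //.
  by move=> w; exact: cell_avg_ge0.
by move=> x; exact: step_fun_avg_le (qn_measurable qX Xf) (mem_cell_integrable Xf).
Qed.

(** Pairing [f] with the step function of [g] amounts to pairing the cell averages of [f] with [g],
    and averaging is bounded because it is dominated by the maximal operator. The volume d^n of a
    cell converts sums into integrals. *)
Lemma dual_bound_kothe C g B : 0 <= C -> scalar_bound X rho C ->
  (forall w, 0 <= g w) -> 0 <= B -> dual_bound N g B ->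
  (enorm (kothe X) (EFin \o step_fun g) <= (d ^+ n * (B * (2 ^+ n * C)))%:E)%E.
Proof.
move=> C0 sb g0 B0 gB.
have dn : 0 <= d ^+ n by rewrite exprn_ge0// ltW.
apply: (kothe_enorm_le hX).
- by rewrite mulr_ge0// mulr_ge0// mulr_ge0// exprn_ge0.
- by apply/measurable_EFinP; exact: measurable_step_fun.
- by move=> x; rewrite lee_fin step_fun_ge0.
move=> f Xf; have mf := qn_measurable qX Xf.
rewrite (eq_integral (fun x => `|f x * step_fun g x|%:E)); last first.
  by move=> x _; rewrite normrM EFinM [`|step_fun g x|]ger0_norm// step_fun_ge0.
rewrite integral_mul_step_fun//; last exact: mem_cell_integrable.
rewrite lee_fin -[leRHS]mulrA ler_wpM2l//.
apply: le_trans (gB (avg f) _) _; first by move=> w; exact: cell_avg_ge0.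
by rewrite -mulrA ler_wpM2l//; exact: grid_norm_avg.
Qed.

(** A passage through the associate space: [dual_bound_kothe] leads into it, the bound [C2] is
    applied there, and testing on step functions leads back. The volume of a cell cancels, so the
    constant does not depend on the grid. *)
Lemma dual_bound_mart_max C1 C2 g B : 0 <= C1 -> scalar_bound X rho C1 ->
  0 <= C2 -> scalar_bound (kothe X) rho C2 ->
  (forall w, 0 <= g w) -> 0 <= B -> dual_bound N g B ->
  dual_bound N (T g) (2 ^+ n * C2 * (2 ^+ n * C1) * B).
Proof.
move=> C10 sb1 C20 sb2 g0 B0 gB h h0.
have kI := kothe_ideal_space qX.
have kg := dual_bound_kothe C10 sb1 g0 B0 gB.
have klg : kothe X (step_fun g).
  have [] := enorm_mem (le_lt_trans kg (ltry _)) => g' kg' gg'.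
  apply: (ideal_ae_eq kI kg' _ _).1; first exact: measurable_step_fun.
  by apply: filterS gg' => x [].
have := sb2 _ klg => /le_trans/(_ (lee_wpmul2l _ kg)).
rewrite lee_fin => /(_ C20); rewrite -EFinM => kb.
have := kothe_hoelder hX (grid_step_fun_mem h) (measurable_local_maximal rho (step_fun g))
  (fun x => local_maximal_ge0 (step_fun g) x r0) kb.
have dn : 0 < d ^+ n by rewrite exprn_gt0.
have Tg0 w : 0 <= T g w by exact: mart_max_ge0.
have := integral_mul_step_fun d0 (measurable_step_fun o d h) (cell_integrable_step_fun o d0 h0) Tg0.
under eq_bigr do rewrite cell_avg_step_fun//.
move=> hE hk.
have : ((d ^+ n * \sum_w T g w * h w)%:E <=
    (2 ^+ n)%:E * \int[mu]_x (`|step_fun h x|%:E * local_maximal rho (step_fun g) x))%E.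
  have mH : measurable_fun [set: Rn]
      (fun x => `|step_fun h x|%:E * local_maximal rho (step_fun g) x)%E.
    apply: emeasurable_funM; last exact: measurable_local_maximal.
    by apply/measurable_EFinP; apply: measurableT_comp => //; exact: measurable_step_fun.
  have H0 x : (0 <= `|step_fun h x|%:E * local_maximal rho (step_fun g) x)%E.
    by rewrite mule_ge0 ?lee_fin ?local_maximal_ge0.
  have n0 : (0 <= (2 ^+ n)%:E :> \bar R)%E by rewrite lee_fin exprn_ge0.
  rewrite -hE -(ge0_integralZl mu measurableT mH (fun x _ => H0 x) n0).
  apply: ge0_le_integral => //.
  - apply/measurable_EFinP; apply: measurableT_comp => //.
    by apply: measurable_funM; exact: measurable_step_fun.
  - exact: emeasurable_funM.
  move=> x _; rewrite normrM EFinM muleCA; apply: lee_wpmul2l; first by rewrite lee_fin.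
  by rewrite ger0_norm ?step_fun_ge0//; exact: step_fun_mart_max_step_fun_le.
move=> /le_trans/(_ (lee_wpmul2l _ hk)); rewrite lee_fin exprn_ge0// => /(_ isT).
rewrite -EFinM lee_fin => hh; rewrite -(ler_pM2l dn); apply: le_trans hh _.
by apply: eq_lew; rewrite /grid_norm; ring.
Qed.

End with_maximal.
End grid_norm.

(** Hoelder's inequality with the second factor written as a^(q-1), which avoids the conjugate
    exponent; after normalisation it is Young's inequality, summed. *)
Lemma finite_hoelder {R : realType} (q : R) m (x a : 'I_m -> R) : 1 < q ->
  (forall j, 0 <= x j) -> (forall j, 0 <= a j) ->
  \sum_j x j * a j `^ (q - 1) <=
  (\sum_j x j `^ q) `^ q^-1 * ((\sum_j a j `^ q) `^ q^-1) `^ (q - 1).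
Proof.
move=> q1 x0 a0; have q0 : 0 < q by lra.
have qn0 : q != 0 by rewrite gt_eqF.
have q10 : q - 1 != 0 by rewrite gt_eqF//; lra.
have sum0 (y : 'I_m -> R) : (forall j, 0 <= y j) -> \sum_j y j `^ q = 0 -> forall j, y j = 0.
  move=> y0 s0 j; have : y j `^ q <= 0.
    by rewrite -s0 (bigD1 j)//= lerDl sumr_ge0// => i _; exact: powR_ge0.
  move=> h; have : y j `^ q == 0 by rewrite eq_le h powR_ge0.
  by rewrite powR_eq0 => /andP[/eqP].
set SX := \sum_j x j `^ q; set SA := \sum_j a j `^ q.
have SX0 : 0 <= SX by apply: sumr_ge0 => j _; exact: powR_ge0.
have SA0 : 0 <= SA by apply: sumr_ge0 => j _; exact: powR_ge0.
have R0 : 0 <= SX `^ q^-1 * (SA `^ q^-1) `^ (q - 1) by rewrite mulr_ge0// powR_ge0.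
have [sx|sx] := eqVneq SX 0.
  by rewrite big1// => j _; rewrite (sum0 x x0 sx) mul0r.
have [sa|sa] := eqVneq SA 0.
  by rewrite big1// => j _; rewrite (sum0 a a0 sa) powR0// mulr0.
have X0 : 0 < SX `^ q^-1 by rewrite powR_gt0// lt_neqAle eq_sym sx.
have A0 : 0 < SA `^ q^-1 by rewrite powR_gt0// lt_neqAle eq_sym sa.
have XE : (SX `^ q^-1) `^ q = SX by rewrite powRVK.
have AE : (SA `^ q^-1) `^ q = SA by rewrite powRVK.
move: (SX `^ q^-1) (SA `^ q^-1) X0 A0 XE AE R0 => X A X0 A0 XE AE _.
have normed (y : 'I_m -> R) Y : 0 < Y -> (forall j, 0 <= y j) ->
    Y `^ q = \sum_j y j `^ q -> \sum_j (y j / Y) `^ q = 1.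
  move=> Y0 y0 YE; under eq_bigr do rewrite powRM ?invr_ge0 ?(ltW Y0)//.
  rewrite -mulr_suml -YE -powRM ?invr_ge0 ?(ltW Y0)//.
  by rewrite divff ?gt_eqF// powR1.
have h1 := normed x X X0 x0 XE; have h2 := normed a A A0 a0 AE.
have : q * (\sum_j (x j / X) * (a j / A) `^ (q - 1)) <= q.
  rewrite mulr_sumr.
  apply: (@le_trans _ _ (\sum_j ((x j / X) `^ q + (q - 1) * (a j / A) `^ q))).
    apply: ler_sum => j _; apply: young_powRB1 => //; apply: divr_ge0 => //; exact: ltW.
  by rewrite big_split/= -mulr_sumr h1 h2; lra.
rewrite -[leRHS]mulr1 ler_pM2l// => h.
have P0 : 0 < X * A `^ (q - 1) by rewrite mulr_gt0// powR_gt0.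
rewrite -[leRHS]mulr1 -ler_pdivrMl//; apply: le_trans h.
rewrite mulr_sumr; apply: eq_lew; apply: eq_bigr => j _.
rewrite powRM ?invr_ge0 ?(ltW A0)//.
have -> : A^-1 `^ (q - 1) = (A `^ (q - 1))^-1.
  by rewrite -powR_inv1 ?(ltW A0)// -powRrM mulN1r powRN.
by field; rewrite !gt_eqF// powR_gt0.
Qed.

Lemma le_of_mule {R : realType} (x a b y : R) (E F : \bar R) : x%:E = E -> y%:E = F ->
  (E <= a%:E * (b%:E * F))%E -> x <= a * b * y.
Proof. by move=> <- <-; rewrite -!EFinM lee_fin mulrA. Qed.

Section grid_bounds.
Context {R : realType} {n : nat}.
Local Notation Rn := (n.-tuple R).
Local Notation mu := (lebesgue_Rn R n).
Implicit Types (o : 'I_n -> R) (d q C rho : R).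

Lemma minkowski_cell_avg o d K L q m (f : 'I_m -> Rn -> R) (G : Rn -> R) w :
  0 < d -> 1 < q -> (forall j, measurable_fun [set: Rn] (f j)) ->
  measurable_fun [set: Rn] G ->
  (forall j, cell_integrable o d K L (f j)) -> cell_integrable o d K L G ->
  (forall x, G x = (\sum_j `|f j x| `^ q) `^ q^-1) ->
  (\sum_j cell_avg o d (f j) w `^ q) `^ q^-1 <= cell_avg o d (K := K) (L := L) G w.
Proof.
move=> d0 q1 mf mG fi Gi GE; have q0 : 0 < q by lra.
set A := (X in X <= _).
have a0 j : 0 <= cell_avg o d (f j) w by exact: cell_avg_ge0.
have A0 : 0 <= A by exact: powR_ge0.
have [->|An0] := eqVneq A 0; first exact: cell_avg_ge0.
have Ap : 0 < A by rewrite lt_neqAle eq_sym An0.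
have AE : A `^ q = \sum_j cell_avg o d (f j) w `^ q.
  by rewrite powRVK// sumr_ge0// => j _; exact: powR_ge0.
(* Minkowski's inequality by duality: these coefficients norm the vector of averages in l^q, and
   [finite_hoelder] applies under the integral. *)
pose al j := cell_avg o d (f j) w `^ (q - 1).
have al0 j : 0 <= al j by exact: powR_ge0.
have A1 : 0 < A `^ (q - 1) by rewrite powR_gt0.
have key : \sum_j al j * cell_avg o d (f j) w <= A `^ (q - 1) * cell_avg o d G w.
  have dn : 0 < d ^+ n by rewrite exprn_gt0.
  rewrite -(ler_pM2r dn) -mulrA -lee_fin [X in (_ <= X)%E]EFinM -(cell_avgE w d0 Gi).
  have mA (h : Rn -> R) : measurable_fun [set: Rn] h ->
      measurable_fun (cell o d w) (fun x => `|h x|%:E).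
    by move=> mh; apply/measurable_EFinP; apply: measurable_funTS; exact: measurableT_comp.
  have mc : measurable (cell o d w) by exact: measurable_gbox.
  have A1e : (0 <= (A `^ (q - 1))%:E)%E by rewrite lee_fin ltW.
  have G0 x : (0 <= `|G x|%:E)%E by rewrite lee_fin.
  rewrite -(ge0_integralZl mu mc (mA G mG) (fun x _ => G0 x) A1e).
  have -> : ((\sum_j al j * cell_avg o d (f j) w) * d ^+ n)%:E =
      (\int[mu]_(x in cell o d w) \sum_j ((al j)%:E * `|f j x|%:E))%E.
    have ale j : (0 <= (al j)%:E)%E by rewrite lee_fin.
    rewrite (ge0_integral_sum mu mc (fun j => emeasurable_funM (measurable_cst _) (mA _ (mf j)))); last first.
      by move=> j x _; rewrite mule_ge0// lee_fin.
    rewrite mulr_suml -sumEFin; apply: eq_bigr => j _.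
    have F0 x : (0 <= `|f j x|%:E)%E by rewrite lee_fin.
    rewrite (ge0_integralZl mu mc (mA _ (mf j)) (fun x _ => F0 x) (ale j)).
    by rewrite (cell_avgE w d0 (fi j)) -mulrA EFinM.
  apply: ge0_le_integral => //.
  - by move=> x _; apply: sume_ge0 => j _; rewrite mule_ge0// lee_fin.
  - by apply: emeasurable_sum => j; apply: emeasurable_funM => //; exact: mA.
  - by apply: emeasurable_funM => //; exact: mA.
  move=> x _; rewrite (eq_bigr (fun j => (al j * `|f j x|)%:E))// sumEFin -EFinM lee_fin.
  rewrite [`|G x|]ger0_norm ?GE ?powR_ge0// mulrC.
  under eq_bigr do rewrite mulrC.
  apply: (finite_hoelder q1) => //.
rewrite -(ler_pM2l A1); apply: le_trans key.
rewrite mulr_powRB1l// AE; apply: eq_lew.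
by apply: eq_bigr => j _; rewrite mulr_powRB1l.
Qed.

(** The point is the order of the quantifiers: [V] is chosen before the grid and the number of
    functions. *)
Lemma grid_vector_bound (X : fspace R n) rho q C1 C2 : ball_Banach X ->
  0 < rho -> 1 < q -> 0 <= C1 -> scalar_bound X rho C1 ->
  0 <= C2 -> scalar_bound (kothe X) rho C2 ->
  exists2 V, 0 <= V & forall o d K L, 0 < d -> 2 * (2 ^+ K * d) <= rho ->
  forall m (f : 'I_m -> Rn -> R) G, (forall j, X (f j)) -> X G ->
  (forall x, G x = (\sum_j `|f j x| `^ q) `^ q^-1) ->
  fnorm X (step_fun o d (fun w : {ffun 'I_n -> 'I_(L * 2 ^ K)} =>
    (\sum_j mart_max (@grid_rel n K L) K.+1 (cell_avg o d (f j)) w `^ q) `^ q^-1))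
  <= V * fnorm X G.
Proof.
move=> hX r0 q1 C10 sb1 C20 sb2.
pose C := 1 + 2 ^+ n * C1 + 2 ^+ n * C2 * (2 ^+ n * C1).
have n0 : 0 <= 2 ^+ n :> R by rewrite exprn_ge0.
have a0 : 0 <= 2 ^+ n * C1 by rewrite mulr_ge0.
have b0 : 0 <= 2 ^+ n * C2 * (2 ^+ n * C1) by rewrite !mulr_ge0.
have C1le : 1 <= C by rewrite /C -addrA lerDl addr_ge0.
have aC : 2 ^+ n * C1 <= C.
  by rewrite /C addrAC [1 + _ + _]addrC -subr_ge0 addrAC subrr add0r addr_ge0// ?b0.
have bC : 2 ^+ n * C2 * (2 ^+ n * C1) <= C by rewrite /C lerDr addr_ge0.
have V0 := vector_const_gt0 C q1.
exists (vector_const C q * (2 ^+ n * C1)); first by rewrite mulr_ge0// ltW.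
move=> o d K L d0 dr m f G Xf XG GE.
have qX := ball_Banach_normed hX; have iX := ball_Banach_ideal hX.
have sN := grid_norm_seminorm hX o K L d0.
have N0 a := lattice_seminorm_ge0 a sN.
have [B1 B10 hB1] := grid_dual_bound1 hX o K L d0.
have av0 j w : 0 <= cell_avg o d (K := K) (L := L) (f j) w by exact: cell_avg_ge0.
have h1 := @vector_maximal_bound R _ (@grid_rel n K L) (@grid_rel_equivalence n K L)
  (@grid_rel_refine n K L) K.+1 _ C B1 q sN C1le q1.
apply: le_trans (h1 _ _ B10 hB1 m (fun j => cell_avg o d (f j)) av0) _.
- move=> a a0'; apply: le_trans (grid_norm_mart_max hX o d0 r0 dr C10 sb1 a0') _.
  by rewrite ler_wpM2r.
- move=> g B g0 B0 gB h h0.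
  apply: le_trans (dual_bound_mart_max hX d0 r0 dr C10 sb1 C20 sb2 g0 B0 gB h0) _.
  by rewrite ler_wpM2r// ler_wpM2r.
rewrite -[leRHS]mulrA ler_pM2l//.
apply: le_trans (grid_norm_avg hX o L d0 r0 dr C10 sb1 XG).
have [Nle _ _] := sN; apply: Nle => w.
rewrite !ger0_norm ?powR_ge0 ?cell_avg_ge0//.
apply: minkowski_cell_avg => //.
- by move=> j; exact (qn_measurable qX (Xf j)).
- exact (qn_measurable qX XG).
- by move=> j; apply: (mem_cell_integrable hX).
- by apply: (mem_cell_integrable hX).
Qed.

Lemma grid_kothe_bound (X : fspace R n) rho q Cv C1 : ball_Banach X ->
  0 < rho -> 1 < q -> 0 <= Cv -> (forall N, vv_fixed X rho q Cv N) ->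
  0 <= C1 -> scalar_bound X rho C1 ->
  exists2 V, 0 <= V & forall o d K L, 0 < d -> 2 * (2 ^+ K * d) <= rho ->
  forall g, kothe X g ->
  (enorm (kothe X) (EFin \o step_fun o d (mart_max (@grid_rel n K L) K.+1 (cell_avg o d g)))
   <= (V * fnorm (kothe X) g)%:E)%E.
Proof.
move=> hX r0 q1 Cv0 vv C10 sb1.
have q0 : 0 < q by lra.
have qX := ball_Banach_normed hX; have iX := ball_Banach_ideal hX.
have kI := kothe_ideal_space qX.
pose C := 1 + 2 ^+ n * C1 + 2 ^+ n * Cv.
have n0 : 0 < 2 ^+ n :> R by rewrite exprn_gt0.
have a0 : 0 <= 2 ^+ n * C1 by rewrite mulr_ge0// ltW.
have b0 : 0 <= 2 ^+ n * Cv by rewrite mulr_ge0// ltW.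
have C0 : 0 < C by rewrite /C; lra.
have aC : 2 ^+ n * C1 <= C by rewrite /C; lra.
have bC : 2 ^+ n * Cv <= C by rewrite /C; lra.
have D0 : 0 <= dual_const C q.
  by rewrite /dual_const !mulr_ge0 ?powR_ge0 ?(ltW C0).
exists (dual_const C q * (2 ^+ n * C1)); first by rewrite mulr_ge0.
move=> o d K L d0 dr g kg; have [mg _] := kg.
have sN := grid_norm_seminorm hX o K L d0.
have N0 a := lattice_seminorm_ge0 a sN.
have dn : 0 < d ^+ n by rewrite exprn_gt0.
have [_ _ _ kn0] := kI; have B0 := kn0 g kg; set B := fnorm (kothe X) g in B0 *.
have gi : cell_integrable o d K L g by apply: (kothe_cell_integrable hX).
have av0 w : 0 <= cell_avg o d (K := K) (L := L) g w by exact: cell_avg_ge0.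
(* Hoelder's inequality for [g] and a step function, read on the grid; the division by d^n is undone
   by [dual_bound_kothe] at the end. *)
have gB : dual_bound (@grid_norm R n X o d K L) (cell_avg o d (K := K) (L := L) g) (B / d ^+ n).
  move=> h h0; rewrite mulrAC ler_pdivlMr// -lee_fin.
  have ka : (enorm (kothe X) (absE g) <= B%:E)%E by rewrite enorm_absE// enorm_EFin.
  have Xh := grid_step_fun_mem hX o d0 h.
  apply: le_trans (kothe_hoelder hX Xh (absE_measurable mg) (absE_ge0 g) ka).
  rewrite (eq_integral (fun x => `|g x * step_fun o d h x|%:E)); last first.
    by move=> x _; rewrite normrM mulrC EFinM.
  rewrite integral_mul_step_fun// lee_fin mulrC ler_pM2l//.
  by apply: ler_sum => w _; rewrite mulrC.
have := @dual_maximal_bound R _ (@grid_rel n K L) (@grid_rel_equivalence n K L)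
  (@grid_rel_refine n K L) K.+1 _ C q sN C0 q1 _ _ _ _ av0 (divr_ge0 B0 (ltW dn)) gB.
move=> H; have {H} TB : dual_bound (@grid_norm R n X o d K L)
    (mart_max (@grid_rel n K L) K.+1 (cell_avg o d g)) (dual_const C q * (B / d ^+ n)).
  apply: H.
    move=> a a0'; apply: le_trans (grid_norm_mart_max hX o d0 r0 dr C10 sb1 a0') _.
    by rewrite ler_wpM2r.
  move=> phi phi0.
  apply: (@le_trans _ _ (2 ^+ n * Cv * grid_norm X o d
      (fun w => (\sum_k phi k w `^ q) `^ q^-1))); last by rewrite ler_wpM2r.
  have Xs a := grid_step_fun_mem hX o d0 (K := K) (L := L) a.
  have ms a := measurable_step_fun o d (K := K) (L := L) a.
  have NE a : (@grid_norm R n X o d K L a)%:E = enorm X (EFin \o step_fun o d a).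
    by rewrite enorm_EFin.
  apply: (le_of_mule (NE _) (NE _)).
  have hv : (enorm X (lq_fin q (fun k => absE (step_fun o d (phi k)))) < +oo)%E.
    by rewrite step_fun_lq// (enorm_EFin iX (Xs _)) ltry.
  have := vv _ (fun k => step_fun o d (phi k)) (fun k => ms _) hv.
  rewrite /vv_ineq step_fun_lq// => hv2.
  apply: le_trans (lee_wpmul2l _ hv2); last by rewrite lee_fin ltW.
  apply: le_trans (enormZ_le _ iX n0).
  apply: le_enorm => //.
  - by apply/measurable_EFinP; exact: ms.
  - by move=> x; rewrite lee_fin step_fun_ge0// => w; exact: powR_ge0.
  apply: aeW => x; rewrite -lq_finZ ?(ltW n0)//; last first.
    by move=> k; exact: local_maximal_ge0.
  rewrite -(@step_fun_lq R n o d K L d0 q K.+1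
    (fun k w => class_avg (@grid_rel n K L) k (phi k) w))//; last first.
    by move=> k w; exact: class_avg_ge0.
  apply: le_lq_fin => // k; first exact: absE_ge0.
  have ca0 w : 0 <= class_avg (@grid_rel n K L) k (phi k) w by exact: class_avg_ge0.
  rewrite /absE ger0_norm ?step_fun_ge0//.
  (* Each single average of [phi k] is below T (phi k), hence below 2^n times the local maximal
     function of its step function. *)
  apply: le_trans (step_fun_mart_max_step_fun_le o d0 r0 dr x (phi0 k)).
  rewrite lee_fin; apply: ler_sum => w _; rewrite ler_wpM2r//.
  exact: (le_run_max (class_avg (@grid_rel n K L) ^~ (phi k))).
have T0 w : 0 <= mart_max (@grid_rel n K L) K.+1 (cell_avg o d g) w.
  exact: mart_max_ge0.
have DB : 0 <= dual_const C q * (B / d ^+ n) by rewrite mulr_ge0// divr_ge0// ltW.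
apply: le_trans (dual_bound_kothe hX d0 r0 dr C10 sb1 T0 DB TB) _.
rewrite lee_fin; apply: eq_lew.
by field; rewrite gt_eqF.
Qed.

End grid_bounds.

(** * Covering cubes by translated grids *)

(** The least k with s / 2^k <= 6l works: unless k = 0, the preceding value exceeds 6l and is halved
    only once. *)
Lemma dyadic_scale {R : realType} (s l : R) : 0 < l -> 3 * l < s ->
  exists k, 3 * l < s / 2 ^+ k <= 6 * l.
Proof.
move=> l0 ls.
have s0 : 0 < s by lra.
have two k : 0 < 2 ^+ k :> R by rewrite exprn_gt0.
have ex : exists k, s / 2 ^+ k <= 6 * l.
  exists (Num.truncn (s / (6 * l))).+1.
  have l6 : 0 < 6 * l by lra.
  rewrite ler_pdivrMr// mulrC -ler_pdivrMr//.
  apply: ltW; apply: lt_trans (truncnS_gt _) _.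
  by rewrite -natrX ltr_nat ltn_expl.
case: (ex_minnP ex) => k kl kmin; exists k; rewrite kl andbT.
case: k kl kmin => [|k] kl kmin; first by rewrite expr0 divr1.
rewrite ltNge; apply/negP => h; suff /kmin : s / 2 ^+ k <= 6 * l by rewrite ltnn.
have : s / 2 ^+ k = 2 * (s / 2 ^+ k.+1) by rewrite exprS; field; rewrite gt_eqF.
by move=> ->; lra.
Qed.

(* As 3 does not divide 2^k, the endpoints of the two families of intervals
   are at distance at least a third of their length. *)
Lemma third_shift {R : realType} (s a l : R) k : 0 < l -> 3 * l < s / 2 ^+ k ->
  exists (t : bool) (p : int), forall y, a < y < a + l ->
  (if t then s / 3 else 0) + p%:~R * (s / 2 ^+ k) <= y <
  (if t then s / 3 else 0) + (p + 1)%:~R * (s / 2 ^+ k).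
Proof.
move=> l0; set D := s / 2 ^+ k => lD.
have D0 : 0 < D by lra.
have two : 0 < 2 ^+ k :> R by rewrite exprn_gt0.
pose p0 := Num.floor (a / D).
have fl : p0%:~R * D <= a by rewrite -ler_pdivlMr// ge_floor.
have fg : a < (p0 + 1)%:~R * D by rewrite -ltr_pdivrMr// floorD1_gt.
have [h|h] := leP (a + l) ((p0 + 1)%:~R * D).
  by exists false, p0 => y /andP[y1 y2]; rewrite !add0r; apply/andP; split; lra.
(* Writing 2^k = 3u + r with r equal to 1 or 2, the shift is u whole intervals plus rD/3. Moving the
   index back by u leaves the offset rD/3, whose endpoints avoid the interval around the endpoint
   that was hit. *)
have sD : s / 3 = D * ((2 ^ k)%N%:R / 3).
  by rewrite natrX /D; field; rewrite gt_eqF.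
pose u := (2 ^ k %/ 3)%N; pose r := (2 ^ k %% 3)%N.
have r12 : (0 < r < 3)%N.
  rewrite ltn_pmod// andbT lt0n; apply/negP => /eqP r0.
  have : (3 %| 2 ^ k)%N by rewrite /dvdn -/r r0.
  by rewrite Euclid_dvdX.
have sE : s / 3 = D * u%:R + D * (r%:R / 3).
  by rewrite sD (divn_eq (2 ^ k) 3) -/u -/r natrD natrM; field.
have [r1 r2] : (1 <= r%:R :> R) /\ (r%:R <= 2 :> R).
  by rewrite ler1n (ler_nat _ r 2); case/andP: r12.
have q1 : D * 1 <= D * r%:R by rewrite ler_pM2l.
have q2 : D * r%:R <= D * 2 by rewrite ler_pM2l.
exists true, (p0 - u%:Z) => y /andP[y1 y2].
move: fl fg h; rewrite !rmorphD/= !rmorphN/= sE -!pmulrn.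
by move=> fl fg h; apply/andP; split; lra.
Qed.

Section covering_grids.
Context {R : realType} {n : nat}.
Local Notation Rn := (n.-tuple R).
Local Notation mu := (lebesgue_Rn R n).
Implicit Types (rho q C : R) (t : {ffun 'I_n -> bool}) (m : nat) (f : Rn -> R).

(* [2^n] grids, translated by thirds: at stage [m] they have mesh [4 rho / 2^m]
   and extend over [-4 rho m, 4 rho m[ up to the translation. *)
Definition mesh rho m : R := 4 * rho / 2 ^+ m.

Definition origin rho t m (i : 'I_n) : R :=
  (if t i then 4 * rho / 3 else 0) - m%:R * (4 * rho).

Local Notation grid_fun rho t m := (@step_fun R n (origin rho t m) (mesh rho m) m (2 * m)).
Local Notation grid_avg rho t m := (@cell_avg R n (origin rho t m) (mesh rho m) m (2 * m)).
Local Notation grid_integrable rho t m :=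
  (@cell_integrable R n (origin rho t m) (mesh rho m) m (2 * m)).
Local Notation grid_T m := (mart_max (@grid_rel n m (2 * m)) m.+1).

Definition grid_max rho f t m : Rn -> R := grid_fun rho t m (grid_T m (grid_avg rho t m f)).

Lemma mesh_gt0 rho m : 0 < rho -> 0 < mesh rho m.
Proof. by move=> r0; rewrite divr_gt0 ?mulr_gt0// exprn_gt0. Qed.

Lemma mesh_scale rho m : 2 * (2 ^+ m * mesh rho m) <= 2 * (2 * (2 * rho)).
Proof.
have two : 0 < 2 ^+ m :> R by rewrite exprn_gt0.
by rewrite /mesh; apply: eq_lew; field; rewrite gt_eqF.
Qed.

Lemma grid_max_ge0 rho f t m x : 0 < rho -> 0 <= grid_max rho f t m x.
Proof.
by move=> r0; apply: step_fun_ge0 => w; exact: mart_max_ge0.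
Qed.

Lemma local_average_le_grid_max rho f (a : Rn) (l : R) (x : Rn) : 0 < rho ->
  measurable_fun [set: Rn] f -> (forall t m, grid_integrable rho t m f) ->
  0 < l <= rho -> cube a l x ->
  exists t m0, forall m, (m0 <= m)%N ->
  (((l ^+ n)^-1)%:E * \int[mu]_(y in cube a l) `|f y|%:E
    <= (6 ^+ n * grid_max rho f t m x)%:E)%E.
Proof.
move=> r0 mf fi /andP[l0 lr] ax.
have [k /andP[k1 k2]] : exists k, 3 * l < 4 * rho / 2 ^+ k <= 6 * l.
  by apply: dyadic_scale => //; lra.
have /choice[tp htp] : forall i, exists tp : bool * int, forall y,
    tnth a i < y < tnth a i + l ->
    (if tp.1 then 4 * rho / 3 else 0) + tp.2%:~R * (4 * rho / 2 ^+ k) <= y <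
    (if tp.1 then 4 * rho / 3 else 0) + (tp.2 + 1)%:~R * (4 * rho / 2 ^+ k).
  by move=> i; have [t [p h]] := third_shift (tnth a i) l0 k1; exists (t, p).
pose t : {ffun 'I_n -> bool} := [ffun i => (tp i).1].
(* From stage k on the level is present in the grid, and the sum of the indices ensures that the
   grid extends far enough to contain the cell. *)
exists t, (maxn k (\sum_i `|(tp i).2|%N).+1) => m; rewrite geq_max => /andP[km pm].
have two j : 0 < 2 ^+ j :> R by rewrite exprn_gt0.
(* The origin lies m (4 rho) to the left, which is m 2^k cells of level k; this makes the index
   nonnegative. *)
pose P i := absz ((tp i).2 + Posz (m * 2 ^ k)).
have Mm : (m <= m * 2 ^ k)%N by rewrite leq_pmulr// expn_gt0.
have tpm i : (`|(tp i).2| < m)%N.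
  by apply: leq_ltn_trans pm; rewrite (bigD1 i)//= leq_addr.
have PE i : Posz (P i) = (tp i).2 + Posz (m * 2 ^ k).
  by have := tpm i; move: Mm; rewrite /P; move: (m * 2 ^ k)%N (tp i).2 => M p; lia.
have Plt i : (P i < 2 * m * 2 ^ k)%N.
  have := tpm i; move: Mm; rewrite /P -mulnA.
  by move: (m * 2 ^ k)%N (tp i).2 => M p; lia.
have dE : 2 ^+ (m - k) * mesh rho m = 4 * rho / 2 ^+ k.
  rewrite /mesh -{2}(subnK km) exprD; field.
  by rewrite !gt_eqF.
apply: (@local_average_le_step_fun R n (origin rho t m) (mesh rho m) m (2 * m) f k
  P) => //.
- exact: mesh_gt0.
- by rewrite dE.
rewrite dE => y ay; apply/gboxP => i.
have := htp i _ (ay i).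
have e0 : (P i)%:R = (tp i).2%:~R + m%:R * 2 ^+ k :> R.
  by rewrite pmulrn PE rmorphD/= -pmulrn natrM natrX.
rewrite -[(P i).+1%:R]natr1 e0 /origin ffunE rmorphD/= rmorph1.
have e1 : m%:R * (4 * rho) = m%:R * 2 ^+ k * (4 * rho / 2 ^+ k) :> R.
  by field; rewrite gt_eqF.
rewrite e1; move: (4 * rho / 2 ^+ k) (m%:R * 2 ^+ k) => D M.
by move=> /andP[h1 h2]; apply/andP; split; lra.
Qed.

End covering_grids.

(** * From grids to the local maximal operator *)

Lemma lq_fin_absE {R : realType} {n} q m (h : 'I_m -> n.-tuple R -> R) x :
  (forall j, 0 <= h j x) ->
  lq_fin q (fun j => absE (h j)) x = ((\sum_j h j x `^ q) `^ q^-1)%:E.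
Proof.
move=> h0; rewrite /lq_fin /absE lq_fin_EFin; congr ((_ `^ _)%:E).
by apply: eq_bigr => j _; rewrite ger0_norm.
Qed.

Lemma lqZ {R : realType} q m (c : R) (x : 'I_m -> R) : 0 < q -> 0 <= c -> (forall j, 0 <= x j) ->
  (\sum_j (c * x j) `^ q) `^ q^-1 = c * (\sum_j x j `^ q) `^ q^-1.
Proof.
move=> q0 c0 x0; under eq_bigr do rewrite powRM//.
rewrite -mulr_sumr powRM ?powR_ge0 ?powRKV//.
by apply: sumr_ge0 => j _; exact: powR_ge0.
Qed.

(** A crude substitute for Minkowski's inequality, bounding each [h j t] by its l^q norm in t; the
    factor counts the grids and depends only on n. *)
Lemma lq_sum_le {R : realType} (T : finType) q m (h : 'I_m -> T -> R) : 1 <= q ->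
  (forall j t, 0 <= h j t) ->
  (\sum_j (\sum_t h j t) `^ q) `^ q^-1 <=
  #|T|%:R * \sum_t (\sum_j h j t `^ q) `^ q^-1.
Proof.
move=> q1 h0; have q0 : 0 < q by lra.
have sp0 (I : finType) (y : I -> R) : 0 <= \sum_i y i `^ q.
  by apply: sumr_ge0 => i _; exact: powR_ge0.
pose A t := (\sum_j h j t `^ q) `^ q^-1.
have A0 t : 0 <= A t by exact: powR_ge0.
have sA0 : 0 <= \sum_t A t by apply: sumr_ge0 => t _; exact: A0.
have c0 : 0 <= #|T|%:R :> R by [].
have hq j : (\sum_t h j t) `^ q <= #|T|%:R `^ q * \sum_t h j t `^ q.
  have -> : \sum_t h j t `^ q = ((\sum_t h j t `^ q) `^ q^-1) `^ q by rewrite powRVK.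
  rewrite -powRM ?powR_ge0//; apply: le_powR; rewrite ?(ltW q0) ?sumr_ge0//.
  rewrite mulr_natl -sumr_const; apply: ler_sum => t _.
  rewrite -{1}[h j t](powRKV q0)//; apply: le_powR; rewrite ?invr_ge0 ?(ltW q0) ?powR_ge0//.
  by rewrite (bigD1 t)//= lerDl sumr_ge0// => i _; exact: powR_ge0.
have Aq : \sum_t A t `^ q <= (\sum_t A t) `^ q.
  rewrite -(mulr_powRB1l sA0 q0) mulr_sumr; apply: ler_sum => t _.
  rewrite -(mulr_powRB1l (A0 t) q0) ler_wpM2r//; apply: le_powR => //; first by lra.
  by rewrite (bigD1 t)//= lerDl sumr_ge0.
rewrite -[leRHS](powRKV q0) ?mulr_ge0//; apply: le_powR => //.
  by rewrite invr_ge0 ltW.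
rewrite powRM//; apply: le_trans (ler_sum _ (fun j _ => hq j)) _.
rewrite -mulr_sumr ler_wpM2l ?powR_ge0//; apply: le_trans Aq.
rewrite exchange_big/=; apply: ler_sum => t _.
by rewrite powRVK.
Qed.

Lemma fspace_sum {R : realType} {n} (X : fspace R n) (T : finType)
    (u : T -> n.-tuple R -> R) : quasi_normed 1 X -> (forall t, X (u t)) ->
  X (fun x => \sum_t u t x) /\ fnorm X (fun x => \sum_t u t x) <= \sum_t fnorm X (u t).
Proof.
move=> qX Xu; elim: (index_enum T) => [|t s [Xs IH]].
  have -> : (fun x => \sum_(t <- [::]) u t x) = cst 0 by apply/funext => x; rewrite big_nil.
  split; first exact: qn_mem0 qX.
  rewrite big_nil; have [_ h] := qn_norm_eq0 qX (qn_mem0 qX).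
  by rewrite h//; exact: aeW.
have -> : (fun x => \sum_(t <- t :: s) u t x) = u t \+ (fun x => \sum_(t <- s) u t x).
  by apply/funext => x; rewrite big_cons.
split; first exact: (qn_memD qX (Xu t) Xs).
apply: le_trans (qn_normD qX (Xu t) Xs) _.
by rewrite mul1r big_cons lerD2l.
Qed.

Section grids_to_local_maximal.
Context {R : realType} {n : nat}.
Local Notation Rn := (n.-tuple R).
Local Notation mu := (lebesgue_Rn R n).
Variables (X : fspace R n) (rho : R).
Hypotheses (hX : ball_Banach X) (r0 : 0 < rho).
Implicit Types (q C : R) (t : {ffun 'I_n -> bool}).

Let qX := ball_Banach_normed hX.
Let iX := ball_Banach_ideal hX.
Let kI := kothe_ideal_space qX.

Let r2 : 0 < 2 * rho. Proof. by rewrite mulr_gt0. Qed.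
Let r4 : 0 < 2 * (2 * rho). Proof. by rewrite mulr_gt0. Qed.
Let r8 : 0 < 2 * (2 * (2 * rho)). Proof. by rewrite mulr_gt0. Qed.

Let dbl C : R := 6 ^+ n * (C * (C * C)).

Let dbl_ge0 C : 0 <= C -> 0 <= dbl C.
Proof. by move=> C0; rewrite /dbl !mulr_ge0// exprn_ge0. Qed.

Lemma scalar_bound_double3 (Z : fspace R n) C : ideal_space Z -> 0 <= C ->
  scalar_bound Z rho C ->
  exists2 C', 0 <= C' & scalar_bound Z (2 * (2 * (2 * rho))) C'.
Proof.
move=> iZ C0 sb; exists (dbl (dbl (dbl C))); first by rewrite !dbl_ge0.
do 2 ?[apply: scalar_bound_double => //; rewrite ?dbl_ge0//].
exact: scalar_bound_double.
Qed.

Lemma vv_fixed_double3 q C : 0 < q -> 0 <= C -> (forall N, vv_fixed X rho q C N) ->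
  exists2 C', 0 <= C' & forall N, vv_fixed X (2 * (2 * (2 * rho))) q C' N.
Proof.
move=> q0 C0 vv; exists (dbl (dbl (dbl C))); first by rewrite !dbl_ge0.
move=> N; apply: vv_fixed_double => //; rewrite ?dbl_ge0//.
by apply: vv_fixed_double => //; rewrite ?dbl_ge0//; exact: vv_fixed_double.
Qed.

Lemma measurable_grid_max f t m : measurable_fun [set: Rn] (grid_max rho f t m).
Proof. exact: measurable_step_fun. Qed.

Lemma kothe_scalar_bound q C : 1 < q -> 0 <= C -> vv_finite X rho q C ->
  exists C', scalar_bound (kothe X) rho C'.
Proof.
move=> q1 C0 vv; have q0 : 0 < q by lra.
have [C1 C10 vv8] := vv_fixed_double3 q0 C0 (fun N => vv N).
have sb8 := vv_fixed_scalar_bound iX r8 q0 (vv8 1%N).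
have [V V0 hV] := grid_kothe_bound hX r8 q1 C10 vv8 C10 sb8.
exists (6 ^+ n * (#|{ffun 'I_n -> bool}|%:R * V)) => g kg.
have [mg _] := kg.
have [_ _ _ /(_ g kg) g0] := kI.
pose B := 6 ^+ n * (#|{ffun 'I_n -> bool}|%:R * V) * fnorm (kothe X) g.
have B0 : 0 <= B by rewrite !mulr_ge0// exprn_ge0.
(* The grid suited to a cube depends on the cube, so all translated grids are summed; each average
   is then below [S m] from some stage on. *)
pose S m x := 6 ^+ n * \sum_t grid_max rho g t m x.
have s0 : 0 <= 6 ^+ n :> R by rewrite exprn_ge0.
have G0 t m x := grid_max_ge0 g t m x r0.
have S0 m x : 0 <= S m x by rewrite mulr_ge0// sumr_ge0.
have mS m : measurable_fun [set: Rn] (S m).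
  apply: measurable_funM => //; apply: measurable_sum => t.
  exact: measurable_grid_max.
have gi t m : cell_integrable (origin rho t m) (mesh rho m) m (2 * m) g.
  by apply: (kothe_cell_integrable hX) => //; exact: mesh_gt0.
rewrite (enorm_EFin kI kg) -EFinM.
apply: (enorm_liminf kI (@kothe_fatou_enorm R n X hX) mS S0).
- move=> m; apply: (kothe_enorm_le hX B0).
  + by apply/measurable_EFinP; exact: mS.
  + by move=> x; rewrite lee_fin.
  move=> f Xf; have mf := qn_measurable qX Xf.
  have mP t : measurable_fun [set: Rn] (fun x => `|f x|%:E * (grid_max rho g t m x)%:E)%E.
    apply: emeasurable_funM; apply/measurable_EFinP.
      exact: measurableT_comp.
    exact: measurable_grid_max.
  have P0 t x : (0 <= `|f x|%:E * (grid_max rho g t m x)%:E)%E.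
    by rewrite mule_ge0// lee_fin.
  have -> : (\int[mu]_x (`|f x|%:E * (EFin \o S m) x) =
      (6 ^+ n)%:E * \sum_t \int[mu]_x (`|f x|%:E * (grid_max rho g t m x)%:E))%E.
    rewrite -(ge0_integral_sum mu measurableT mP (fun t x _ => P0 t x)).
    have mSm : measurable_fun [set: Rn]
        (fun x => \sum_t (`|f x|%:E * (grid_max rho g t m x)%:E))%E.
      by apply: emeasurable_sum => t; exact: mP.
    rewrite -(ge0_integralZl mu measurableT mSm) ?lee_fin//; last first.
      by move=> x _; apply: sume_ge0 => t _; exact: P0.
    apply: eq_integral => x _.
    rewrite (eq_bigr (fun t => (`|f x| * grid_max rho g t m x)%:E))// sumEFin.
    by rewrite /= -!EFinM /S mulrCA mulr_sumr.
  have -> : B * fnorm X f =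
      6 ^+ n * (#|{ffun 'I_n -> bool}|%:R * (V * fnorm (kothe X) g * fnorm X f)).
    by rewrite /B; ring.
  rewrite [leRHS]EFinM; apply: lee_wpmul2l; first by rewrite lee_fin.
  have Pt t : (\int[mu]_x (`|f x|%:E * (grid_max rho g t m x)%:E) <=
      (V * fnorm (kothe X) g * fnorm X f)%:E)%E.
    have hG := hV (origin rho t m) (mesh rho m) m (2 * m)%N (mesh_gt0 m r0)
      (mesh_scale rho m) g kg.
    apply: (kothe_hoelder hX Xf _ _ hG).
      by apply/measurable_EFinP; exact: measurable_step_fun.
    by move=> x; rewrite lee_fin; exact: G0.
  apply: le_trans (lee_sum _ (fun t _ => Pt t)) _.
  by rewrite sumEFin sumr_const lee_fin mulr_natl.
- exact: measurable_local_maximal.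
- by move=> x; exact: local_maximal_ge0.
apply: aeW => x; apply: local_maximal_le => a l l0 ax.
have [t [m0 hm]] := local_average_le_grid_max r0 mg gi l0 ax.
apply: (@liminfE_ge _ _ _ _ _ m0) => m mm; apply: le_trans (hm m mm) _.
by rewrite lee_fin ler_wpM2l// (bigD1 t)//= lerDl sumr_ge0.
Qed.

Lemma vv_finite_of_scalar_bounds q C1 C2 : 1 < q ->
  0 <= C1 -> scalar_bound X rho C1 -> 0 <= C2 -> scalar_bound (kothe X) rho C2 ->
  exists C, 0 < C /\ vv_finite X rho q C.
Proof.
move=> q1 C10 sb1 C20 sb2; have q0 : 0 < q by lra.
have [D1 D10 sb18] := scalar_bound_double3 iX C10 sb1.
have [D2 D20 sb28] := scalar_bound_double3 kI C20 sb2.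
have [V V0 hV] := grid_vector_bound hX r8 q1 D10 sb18 D20 sb28.
pose c : R := #|{ffun 'I_n -> bool}|%:R.
have c0 : 0 <= c by [].
have s0 : 0 <= 6 ^+ n :> R by rewrite exprn_ge0.
have C0 : 0 <= 6 ^+ n * (c * (c * V)) by rewrite !mulr_ge0.
exists (6 ^+ n * (c * (c * V)) + 1); split; first by rewrite ltr_wpDl.
move=> N f mf ff; pose G x := (\sum_j `|f j x| `^ q) `^ q^-1.
have GE : lq_fin q (fun j => absE (f j)) = EFin \o G.
  by apply/funext => x; rewrite /lq_fin /absE lq_fin_EFin.
have mG : measurable_fun [set: Rn] G.
  apply/measurable_EFinP; rewrite -[X in measurable_fun _ X]GE.
  by apply: measurable_lq_fin => j; exact: absE_measurable.
have XG : X G.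
  move: ff => /enorm_mem[g Xg]; rewrite GE => gG.
  apply: (ideal_ae_eq iX Xg mG _).1.
  by apply: filterS gG => x [].
have fG j x : `|f j x| <= G x.
  have := @le_lq_fin_coord R n _ q (fun j => absE (f j)) x j q0 (fun j => absE_ge0 (f j) x).
  by rewrite GE lee_fin.
have Xf j : X (f j).
  have [_ iX' _ _] := iX; apply: (iX' G (f j) XG (mf j) _).1.
  by apply: aeW => x; apply: le_trans (fG j x) (ler_norm _).
have fi j t m : cell_integrable (origin rho t m) (mesh rho m) m (2 * m) (f j).
  by apply: (mem_cell_integrable hX) => //; exact: mesh_gt0.
have H0 j t m x := grid_max_ge0 (f j) t m x r0.
pose A m t x := (\sum_j grid_max rho (f j) t m x `^ q) `^ q^-1.
have AE m t : A m t = @step_fun R n (origin rho t m) (mesh rho m) m (2 * m) (fun w =>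
    (\sum_j mart_max (@grid_rel n m (2 * m)) m.+1
      (cell_avg (origin rho t m) (mesh rho m) (f j)) w `^ q) `^ q^-1).
  have T0 j (w : {ffun 'I_n -> 'I_(2 * m * 2 ^ m)}) :
      0 <= mart_max (@grid_rel n m (2 * m)) m.+1
      (cell_avg (origin rho t m) (mesh rho m) (f j)) w.
    by exact: mart_max_ge0.
  apply/funext => x; apply: EFin_inj.
  rewrite /A -(@lq_fin_absE _ _ _ _ (fun j => grid_max rho (f j) t m)); last by move=> j; exact: H0.
  have E := step_fun_lq (origin rho t m) (mesh_gt0 m r0) q0 T0.
  exact: (f_equal (fun F : Rn -> \bar R => F x) E).
have A0 m t x : 0 <= A m t x by exact: powR_ge0.
have XA m t : X (A m t) by rewrite AE; apply: (grid_step_fun_mem hX); exact: mesh_gt0.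
have nA m t : fnorm X (A m t) <= V * fnorm X G.
  rewrite AE; apply: (hV _ _ _ _ (mesh_gt0 m r0) (mesh_scale rho m)) => //.
pose S m x := 6 ^+ n * c * \sum_t A m t x.
have S0 m x : 0 <= S m x by rewrite !mulr_ge0// sumr_ge0.
have XS m : X (S m) by apply: (qn_memZ qX); exact: (fspace_sum qX (XA m)).1.
have mS m : measurable_fun [set: Rn] (S m) by exact: (qn_measurable qX (XS m)).
have nG0 : 0 <= fnorm X G by exact: (qn_norm_ge0 qX).
have nS m : fnorm X (S m) <= 6 ^+ n * (c * (c * V)) * fnorm X G.
  rewrite /S (qn_normZ qX _ (fspace_sum qX (XA m)).1) ger0_norm ?mulr_ge0//.
  rewrite -!mulrA; do 2 ![apply: ler_wpM2l => //].
  apply: le_trans (fspace_sum qX (XA m)).2 _.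
  by rewrite mulr_natl -sumr_const; apply: ler_sum => t _; exact: nA.
rewrite /vv_ineq GE (enorm_EFin iX XG) -EFinM.
have [_ _ _ fX _] := hX.
apply: (enorm_liminf iX (fun F B => fatou_enorm iX fX) mS S0).
- move=> m; rewrite (enorm_EFin iX (XS m)) lee_fin; apply: le_trans (nS m) _.
  by rewrite ler_wpM2r// lerDl.
- by apply: measurable_lq_fin => j; exact: measurable_local_maximal.
- by move=> x; exact: lq_fin_ge0.
(* The scalar bound gives finite values almost everywhere, so that they can be approached from below
   by a factor. *)
have fin j : {ae mu, forall x, exists2 M, 0 <= M & local_maximal rho (f j) x = M%:E}.
  have : (enorm X (local_maximal rho (f j)) < +oo)%E.
    by apply: le_lt_trans (sb1 _ (Xf j)) _; rewrite (enorm_EFin iX (Xf j)) -EFinM ltry.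
  move=> /enorm_mem[g _]; apply: filterS => x gx; exists (g x) => //.
  by rewrite -lee_fin -gx local_maximal_ge0.
have : {ae mu, forall x, forall j, exists2 M, 0 <= M & local_maximal rho (f j) x = M%:E}.
  by apply: filter_forall => j; exact: fin.
apply: filterS => x hM.
have /choice[M {}hM] : forall j, exists M, 0 <= M /\ local_maximal rho (f j) x = M%:E.
  by move=> j; have [M ? ?] := hM j; exists M.
(* With a factor [th] below 1, one cube per function nearly attains the supremum. The family being
   finite, a common stage [\max_j m0 j] serves all of these cubes. *)
apply/lee_mul01Pr; first exact: lq_fin_ge0.
move=> th /andP[th0 th1].
have /choice[m0 hm0] : forall j, exists m0, forall m, (m0 <= m)%N ->
    th * M j <= 6 ^+ n * \sum_t grid_max rho (f j) t m x.
  move=> j; have [Mj0 MjE] := hM j.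
  have [Mz|Mn] := eqVneq (M j) 0.
    by exists 0%N => m _; rewrite Mz mulr0 mulr_ge0// sumr_ge0.
  have : ((th * M j)%:E < local_maximal rho (f j) x)%E.
    by rewrite MjE lte_fin gtr_pMl// lt_neqAle eq_sym Mn.
  move=> /ereal_sup_gt[_ [a [l [l0 ax ->]]]]; rewrite inv_lebesgue_cube; last by case/andP: l0.
  move=> avg; have [t [m0 hm]] := local_average_le_grid_max r0 (mf j) (fi j) l0 ax.
  exists m0 => m mm; rewrite -lee_fin; apply: le_trans (ltW avg) _.
  apply: le_trans (hm m mm) _.
  by rewrite lee_fin ler_wpM2l// (bigD1 t)//= lerDl sumr_ge0.
apply: (@liminfE_ge _ _ _ _ _ (\max_j m0 j)) => m mm.
have -> : lq_fin q (fun j => local_maximal rho (f j)) x = ((\sum_j M j `^ q) `^ q^-1)%:E.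
  rewrite -lq_fin_EFin /lq_fin; congr (_ `^ _)%E.
  by apply: eq_bigr => j _; rewrite (hM j).2.
rewrite -EFinM lee_fin -lqZ ?(ltW th0)//; last by move=> j; exact: (hM j).1.
have h0 j t : 0 <= 6 ^+ n * grid_max rho (f j) t m x by rewrite mulr_ge0.
have -> : S m x = #|{ffun 'I_n -> bool}|%:R *
    \sum_t (\sum_j (6 ^+ n * grid_max rho (f j) t m x) `^ q) `^ q^-1.
  under [in RHS]eq_bigr do rewrite lqZ//.
  by rewrite -mulr_sumr /S mulrCA mulrA.
apply: le_trans (lq_sum_le (ltW q1) h0).
apply: le_powR; first by rewrite invr_ge0 ltW.
  by apply: sumr_ge0 => j _; exact: powR_ge0.
apply: ler_sum => j _; apply: le_powR; first exact: ltW.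
  by rewrite mulr_ge0 ?(ltW th0)//; exact: (hM j).1.
rewrite -mulr_sumr; apply: hm0; apply: leq_trans mm.
exact: (leq_bigmax (F := m0)).
Qed.

End grids_to_local_maximal.

Theorem theorem6p1 (R : realType) (n : nat) (hn : (0 < n)%N)
    (rho : R) (hrho : 0 < rho) (X : fspace R n) (hX : ball_Banach X) :
  (* (i) *)
  [/\ [<-> bounded_on (local_maximal rho) X /\
           bounded_on (local_maximal rho) (kothe X) ;
           exists q : R, 1 < q /\ exists C : R, 0 < C /\ vv_finite X rho q C ;
           forall q : R, 1 < q -> exists C : R, 0 < C /\ vv_finite X rho q C],
  (* (ii) *)
      (forall q : R, 0 < q ->
         (exists C : R, forall (N : nat) (f : 'I_N -> n.-tuple R -> R),
            (forall j, measurable_fun [set: n.-tuple R] (f j)) ->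
            vv_ineq X rho q C f) ->
         1 < q) /\
      (forall q : R, 0 < q <= 1 ->
         forall Y : fspace R n, ball_quasi_Banach Y ->
         ~ exists C : R, vv_finite Y rho q C),
  (* (iii) *)
      (forall q C : R, 1 < q -> 0 < C ->
         (vv_finite X rho q C <-> vv_sequence X rho q C)),
  (* (iv), equivalence with the same constant *)
      [<-> exists C : R, 0 < C /\ scalar_bound X rho C ;
           exists C : R, 0 < C /\ max_bound X rho C ;
           exists C : R, 0 < C /\ sup_bound X rho C] /\
      (forall C : R, 0 < C ->
         [<-> scalar_bound X rho C ; max_bound X rho C ; sup_bound X rho C]) &
  (* (iv), boundedness on the associate space may fail *)
      exists Y : fspace R n,
        [/\ ball_Banach Y, exists C : R, 0 < C /\ scalar_bound Y rho C &
            ~ bounded_on (local_maximal rho) (kothe Y)]].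
Proof.
have qX := ball_Banach_normed hX; have iX := ball_Banach_ideal hX.
have kI := kothe_ideal_space qX.
have bounded_scalar (Z : fspace R n) : ideal_space Z ->
    bounded_on (local_maximal rho) Z -> exists2 C, 0 <= C & scalar_bound Z rho C.
  move=> iZ [C bC]; exists (Num.max 0 C); first by rewrite le_max lexx.
  by apply: (scalar_bound_le iZ) bC; rewrite le_max lexx orbT.
have b_a q C : 1 < q -> 0 < C -> vv_finite X rho q C ->
    bounded_on (local_maximal rho) X /\ bounded_on (local_maximal rho) (kothe X).
  move=> q1 C0 vv; have q0 : 0 < q by lra.
  split; last by have [C1 sb] := kothe_scalar_bound hX hrho q1 (ltW C0) vv; exists C1.
  by exists C; apply: (vv_fixed_scalar_bound iX hrho q0) => f; exact: vv.
have a_c : bounded_on (local_maximal rho) X /\ bounded_on (local_maximal rho) (kothe X) ->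
    forall q, 1 < q -> exists C, 0 < C /\ vv_finite X rho q C.
  move=> [/(bounded_scalar _ iX)[C1 C10 sb1] /(bounded_scalar _ kI)[C2 C20 sb2]] q q1.
  exact: (vv_finite_of_scalar_bounds hX hrho q1 C10 sb1 C20 sb2).
have [_ cX iX' fX [bX _]] := hX.
split.
- tfae.
  + by move=> /a_c h; exists 2; split; [lra|apply: h; lra].
  + by move=> [q [q1 [C [C0 /(b_a q C q1 C0)/a_c]]]].
  + by move=> /(_ 2)[|C [C0 vv]]; [lra|apply: (b_a 2 C) => //; lra].
- split=> [q q0 [C vv]|q q01 Y hY]; last exact: vv_finite_gt1.
  rewrite ltNge; apply/negP => q1.
  apply: (@vv_finite_gt1 R n hn rho q X) => //; first by rewrite q0.
    by split => //; exists 1.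
  by exists C => N f mf _; exact: vv.
- move=> q C q1 C0; have q0 : 0 < q by lra.
  split; last exact: vv_sequence_finite.
  exact: vv_finite_sequence iX fX hrho q0 (ltW C0).
- have s_m C : scalar_bound X rho C -> max_bound X rho C.
    by move=> sb; apply: sup_max_bound => //; exact: scalar_sup_bound.
  have m_s C : max_bound X rho C -> sup_bound X rho C.
    by move=> mb; apply: scalar_sup_bound => //; exact: max_scalar_bound.
  have s_s C : sup_bound X rho C -> scalar_bound X rho C.
    by move=> sb; apply: max_scalar_bound => //; exact: sup_max_bound.
  split=> [|C C0]; tfae.
  + by move=> [C [C0 /s_m]]; exists C.
  + by move=> [C [C0 /m_s]]; exists C.
  + by move=> [C [C0 /s_s]]; exists C.
  + exact: s_m.
  + exact: m_s.
  + exact: s_s.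
- exists (@Linf R n); split; first exact: Linf_ball_Banach.
    by exists 1; split => //; exact: Linf_scalar_bound.
  exact: Linf_kothe_unbounded.
Qed.
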